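(* With $S_3,S_4$ as in the context, $$S_3(q)=\frac{(q^{45};q^{45})_\infty}{(q^3;q^3)_\infty} \left(2(q^{18},q^{27};q^{45})_\infty+q(q^{12},q^{33};q^{45})_\infty+q^4(q^3,q^{42};q^{45})_\infty\right),$$ $$S_4(q)=\frac{(q^{45};q^{45})_\infty}{(q^3;q^3)_\infty} \left((q^{21},q^{24};q^{45})_\infty -q^3(q^6,q^{39};q^{45})_\infty+2q^2(q^9,q^{36};q^{45})_\infty \right).$$
   Context: Let $|q|<1$ and use standard $q$-Pochhammer notation $(a;q)_n=\prod_{k=0}^{n-1}(1-aq^k)$, $(a;q)_\infty=\prod_{k\ge0}(1-aq^k)$, $(a_1,\dots,a_m;q)_\infty=(a_1;q)_\infty\cdots(a_m;q)_\infty$. Define $$S_3(q)=\sum_{i,j\geq 0} \frac{q^{2i^2+2ij+2j^2-2i-j}}{(q^3;q^3)_i(q^3;q^3)_j},\qquad S_4(q)=\sum_{i,j\geq 0} \frac{q^{2i^2+2ij+2j^2}}{(q^3;q^3)_i(q^3;q^3)_j}.$$ *)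

(* Defs.v *)
From Stdlib Require Import Reals.
From Coquelicot Require Import Coquelicot.
Open Scope C_scope.

Fixpoint qPoch (a q : C) (n : nat) : C :=
  match n with
  | O => 1
  | S m => qPoch a q m * (1 - a * q ^ m)
  end.

(* infinite q-Pochhammer (a;q)_oo := lim_{n->oo} (a;q)_n  (converges for |q|<1) *)
Definition qPochInf (a q : C) : C :=
  @lim C_CompleteNormedModule (filtermap (fun n => qPoch a q n) eventually).

Fixpoint csum (n : nat) (f : nat -> C) : C :=
  match n with
  | O => 0
  | S m => csum m f + f m
  end.

Definition S3_partial (q : C) (N : nat) : C :=
  csum N (fun i => csum N (fun j =>
    q ^ (2*i*i + 2*i*j + 2*j*j - 2*i - j)%nat
      / (qPoch (q^3) (q^3) i * qPoch (q^3) (q^3) j))).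

Definition S4_partial (q : C) (N : nat) : C :=
  csum N (fun i => csum N (fun j =>
    q ^ (2*i*i + 2*i*j + 2*j*j)%nat
      / (qPoch (q^3) (q^3) i * qPoch (q^3) (q^3) j))).

(* Main.v *)
Require Import Defs.
From Stdlib Require Import Reals Lra Lia Psatz ZArith FunctionalExtensionality.
From Coquelicot Require Import Coquelicot.
Open Scope C_scope.

(** Write [p] for the nome [q] of the theorem and [Q = p^3].  The double sums
    are string-function sums of the affine Lie algebra of type A_1 at level 3.
    Start from the unit Bailey pair in base [Q] relative to [a = z Q^(-2M)],
    iterate the Bailey lemma and let [M] tend to infinity.  This gives
    bilateral identities whose [d]-fold versions are, for [d = 1, 2], the
    Jacobi triple product and the quintuple product, and for [d = 4]
      sum over N1 >= N2 >= N3 in Z of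
        z^(N1+N2+N3) Q^(N1^2+N2^2+N3^2) / ((Q)_(N1-N2) (Q)_(N2-N3))
      = sum over r of z^(5r) Q^(5r^2-r) (1 - z Q^(2r)) / ((z)_oo (Q/z)_oo).
    Put [i = N1 - N2], [j = N2 - N3], [m = N1 + N2 + N3] and [z = -p].  Then
    the summand on the left is [(-1)^m p^(m^2+m)] times the summand of S_4, with
    [m = i - j] mod 3.  The sums of [(-1)^m p^(m^2+m)] over the residue classes
    0, 1, 2 of [m] are [t, 0, -t].  So if [C_c] is the part of S_4 with
    [i - j = c] mod 3, then [C_0 - C_2] is known; the quintuple product turns it
    into [(p^2,p^3,p^5;p^5)_oo / (p^3;p^3)_oo].  The exponents of [p] in [C_c] are
    [2c^2] mod 3, so the same identity at [omega p], with [omega] a primitive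
    cube root of unity, separates [C_0] from [C_2 = C_1], and the Jacobi theta
    series splits in the same way into theta functions of base [p^45].  For S_3
    the threefold sum carries an extra factor [Q^(N3)]: [z = -p^(-2)] gives
    the class difference with value [(p,p^4,p^5;p^5)_oo / (p^3;p^3)_oo], and
    [z = -1] shows that two of the classes have equal sums. *)

(** * Limits and series of complex numbers *)

(** The shift [a = z Q^(-2M)] centres everything: with [s = M + r], completing the square turns
    [a^s Q^(s^2)] into [z^r Q^(r^2)] times a factor free of [r], and these factors cancel between
    the two sides. What still depends on [M] is a bounded weight whose limit is free of the
    summation indices, so dominated convergence (Tannery) serves for every passage to the limit.
    [lim] is a total function, hence every series must come with an explicit geometric bound;
    quadratic exponents supply it. The sign in [z = -p^e] has a purpose: for odd [b] the reflection
    [m -> -b - m] fixes [m^2 + b m] and changes [(-1)^m], so among the three residue classes of [m]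
    one cancels itself and the other two are opposite. The quintuple product applies because the
    numerator has quadratic coefficient [5 * 3] in base [p^3], which is also [3 * 5], that of the
    quintuple series in base [p^5]; the leftover infinite products are two dissections of
    [(-p;p)_oo]. Negative powers of [p] occur throughout, so [q = 0] is settled by hand. *)

Definition cvg (u : nat -> C) (l : C) : Prop :=
  forall eps : R, (0 < eps)%R ->
    exists N, forall n, (N <= n)%nat -> (Cmod (u n - l) < eps)%R.

(** Balls of [C_UniformSpace] constrain the two coordinates separately, so they compare with [Cmod]
    only up to [sqrt 2]. *)
Lemma cvg_filterlim (u : nat -> C) (l : C) :
  cvg u l <-> filterlim u eventually (@locally C_UniformSpace l).
Proof.
  split.
  - intros H. apply filterlim_locally. intros eps.
    destruct (H eps (cond_pos eps)) as [N HN]. exists N. intros n Hn.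
    specialize (HN n Hn).
    apply (C_NormedModule_mixin_compat1 l (u n) eps). exact HN.
  - intros H eps Heps.
    assert (Hs : (0 < sqrt 2)%R) by (apply sqrt_lt_R0; lra).
    assert (He : (0 < eps / sqrt 2)%R) by (apply Rdiv_lt_0_compat; assumption).
    destruct (proj1 (filterlim_locally u l) H (mkposreal _ He)) as [N HN].
    exists N. intros n Hn. specialize (HN n Hn).
    apply (C_NormedModule_mixin_compat2 l (u n) (mkposreal _ He)) in HN.
    simpl in HN. replace eps with (sqrt 2 * (eps / sqrt 2))%R by (field; lra).
    exact HN.
Qed.

Lemma Cmod_minus_sym (x y : C) : Cmod (x - y) = Cmod (y - x).
Proof. rewrite <- Cmod_opp. f_equal. ring. Qed.

Lemma cvg_unique (u : nat -> C) (l l' : C) : cvg u l -> cvg u l' -> l = l'.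
Proof.
  intros H1 H2.
  assert (Hz : Cmod (l - l') = 0%R).
  { destruct (Rle_lt_or_eq_dec 0 _ (Cmod_ge_0 (l - l'))) as [Hp|He]; [|now symmetry].
    destruct (H1 (Cmod (l - l') / 2)%R) as [N1 HN1]; [lra|].
    destruct (H2 (Cmod (l - l') / 2)%R) as [N2 HN2]; [lra|].
    specialize (HN1 (max N1 N2) ltac:(lia)). specialize (HN2 (max N1 N2) ltac:(lia)).
    pose proof (Cmod_triangle (l - u (max N1 N2)) (u (max N1 N2) - l')) as HT.
    replace (l - u (max N1 N2) + (u (max N1 N2) - l')) with (l - l') in HT by ring.
    rewrite (Cmod_minus_sym l (u _)) in HT. lra. }
  apply Cmod_eq_0 in Hz. replace l with (l - l' + l') by ring. rewrite Hz. ring.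
Qed.

Lemma cvg_ext_from (u v : nat -> C) (l : C) (K : nat) :
  (forall n, (K <= n)%nat -> u n = v n) -> cvg u l -> cvg v l.
Proof.
  intros He H eps Heps. destruct (H eps Heps) as [N HN]. exists (max N K). intros n Hn.
  rewrite <- He by lia. apply HN. lia.
Qed.

Lemma cvg_ext (u v : nat -> C) (l : C) :
  (forall n, u n = v n) -> cvg u l -> cvg v l.
Proof. intros He. apply (cvg_ext_from u v l 0). auto. Qed.

Lemma cvg_const (c : C) : cvg (fun _ => c) c.
Proof.
  intros eps He. exists 0%nat. intros n _. replace (c - c) with (RtoC 0) by ring.
  rewrite Cmod_0. exact He.
Qed.

Lemma cvg_plus (u v : nat -> C) (a b : C) :
  cvg u a -> cvg v b -> cvg (fun n => u n + v n) (a + b).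
Proof.
  intros H1 H2 eps He.
  destruct (H1 (eps / 2)%R) as [N1 HN1]; [lra|].
  destruct (H2 (eps / 2)%R) as [N2 HN2]; [lra|].
  exists (max N1 N2). intros n Hn.
  specialize (HN1 n ltac:(lia)). specialize (HN2 n ltac:(lia)).
  replace (u n + v n - (a + b)) with ((u n - a) + (v n - b)) by ring.
  pose proof (Cmod_triangle (u n - a) (v n - b)). lra.
Qed.

Lemma cvg_mult (u v : nat -> C) (a b : C) :
  cvg u a -> cvg v b -> cvg (fun n => u n * v n) (a * b).
Proof.
  intros H1 H2 eps He.
  pose proof (Cmod_ge_0 a) as Ha. pose proof (Cmod_ge_0 b) as Hb.
  set (K := (Cmod a + Cmod b + 1)%R).
  assert (HK : (0 < K)%R) by (unfold K; lra).
  assert (Hd : (0 < Rmin 1 (eps / (2 * K)))%R).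
  { apply Rmin_pos; [lra|]. apply Rdiv_lt_0_compat; lra. }
  destruct (H1 _ Hd) as [N1 HN1]. destruct (H2 _ Hd) as [N2 HN2].
  exists (max N1 N2). intros n Hn.
  specialize (HN1 n ltac:(lia)). specialize (HN2 n ltac:(lia)).
  pose proof (Rmin_l 1 (eps / (2 * K))) as L1. pose proof (Rmin_r 1 (eps / (2 * K))) as L2.
  replace (u n * v n - a * b)
    with ((u n - a) * (v n - b) + (a * (v n - b) + b * (u n - a))) by ring.
  set (x := u n - a) in *. set (y := v n - b) in *.
  pose proof (Cmod_triangle (x * y) (a * y + b * x)) as T1.
  pose proof (Cmod_triangle (a * y) (b * x)) as T2.
  rewrite !Cmod_mult in *.
  pose proof (Cmod_ge_0 x) as Hx. pose proof (Cmod_ge_0 y) as Hy.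
  set (d := Rmin 1 (eps / (2 * K))) in *.
  assert (E1 : (Cmod x * Cmod y <= 1 * d)%R) by (apply Rmult_le_compat; lra).
  assert (E2 : (Cmod a * Cmod y <= Cmod a * d)%R) by (apply Rmult_le_compat_l; lra).
  assert (E3 : (Cmod b * Cmod x <= Cmod b * d)%R) by (apply Rmult_le_compat_l; lra).
  assert (E4 : (K * d <= K * (eps / (2 * K)))%R) by (apply Rmult_le_compat_l; lra).
  replace (K * (eps / (2 * K)))%R with (eps / 2)%R in E4 by (field; lra).
  unfold K in E4. lra.
Qed.

Lemma cvg_scal (c : C) (u : nat -> C) (a : C) :
  cvg u a -> cvg (fun n => c * u n) (c * a).
Proof. apply cvg_mult, cvg_const. Qed.

Lemma cvg_opp (u : nat -> C) (a : C) : cvg u a -> cvg (fun n => - u n) (- a).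
Proof.
  intros H. replace (- a) with (- (1) * a) by ring.
  apply cvg_ext with (fun n => - (1) * u n); [intros; ring|]. now apply cvg_scal.
Qed.

Lemma cvg_minus (u v : nat -> C) (a b : C) :
  cvg u a -> cvg v b -> cvg (fun n => u n - v n) (a - b).
Proof. intros H1 H2. apply cvg_plus; [assumption | now apply cvg_opp]. Qed.

Lemma cvg_inv (u : nat -> C) (a : C) :
  a <> 0 -> (forall n, u n <> 0) -> cvg u a -> cvg (fun n => / u n) (/ a).
Proof.
  intros Ha Hu H eps He.
  assert (Hp : (0 < Cmod a)%R) by now apply Cmod_gt_0.
  assert (Hd : (0 < Rmin (Cmod a / 2) (eps * (Cmod a * Cmod a) / 2))%R).
  { apply Rmin_pos; [lra|]. apply Rdiv_lt_0_compat; [|lra].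
    apply Rmult_lt_0_compat; [lra|]. now apply Rmult_lt_0_compat. }
  destruct (H _ Hd) as [N HN]. exists N. intros n Hn. specialize (HN n Hn).
  pose proof (Rmin_l (Cmod a / 2) (eps * (Cmod a * Cmod a) / 2)) as L1.
  pose proof (Rmin_r (Cmod a / 2) (eps * (Cmod a * Cmod a) / 2)) as L2.
  assert (Hun : (0 < Cmod (u n))%R) by now apply Cmod_gt_0.
  assert (Hlow : (Cmod a / 2 <= Cmod (u n))%R).
  { pose proof (Cmod_triangle (a - u n) (u n)) as T.
    replace (a - u n + u n) with a in T by ring. rewrite (Cmod_minus_sym a) in T. lra. }
  replace (/ u n - / a) with ((a - u n) / (u n * a)) by (field; auto).
  rewrite Cmod_div by (apply Cmult_neq_0; auto). rewrite Cmod_mult, Cmod_minus_sym.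
  apply (Rmult_lt_reg_r (Cmod (u n) * Cmod a)); [now apply Rmult_lt_0_compat|].
  unfold Rdiv. rewrite Rmult_assoc, Rinv_l, Rmult_1_r
    by (apply Rgt_not_eq; now apply Rmult_lt_0_compat).
  assert (eps * (Cmod a / 2 * Cmod a) <= eps * (Cmod (u n) * Cmod a))%R.
  { apply Rmult_le_compat_l; [lra|]. apply Rmult_le_compat_r; lra. }
  lra.
Qed.

Lemma cvg_comp (u : nat -> C) (l : C) (phi : nat -> nat) :
  (forall K, exists N, forall n, (N <= n)%nat -> (K <= phi n)%nat) ->
  cvg u l -> cvg (fun n => u (phi n)) l.
Proof.
  intros Hphi H eps He. destruct (H eps He) as [K HK]. destruct (Hphi K) as [N HN].
  exists N. intros n Hn. apply HK, HN, Hn.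
Qed.

Lemma cvg_Cmod_le (u : nat -> C) (l : C) (B : R) :
  (forall n, (Cmod (u n) <= B)%R) -> cvg u l -> (Cmod l <= B)%R.
Proof.
  intros HB H. apply Rnot_lt_le. intros Hlt.
  destruct (H (Cmod l - B)%R) as [N HN]; [lra|]. specialize (HN N (le_n N)).
  pose proof (Cmod_triangle (l - u N) (u N)) as T.
  replace (l - u N + u N) with l in T by ring. rewrite Cmod_minus_sym in T.
  specialize (HB N). lra.
Qed.

Lemma cvg_Cmod_ge (u : nat -> C) (l : C) (B : R) :
  (forall n, (B <= Cmod (u n))%R) -> cvg u l -> (B <= Cmod l)%R.
Proof.
  intros HB H. apply Rnot_lt_le. intros Hlt.
  destruct (H (B - Cmod l)%R) as [N HN]; [lra|]. specialize (HN N (le_n N)).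
  pose proof (Cmod_triangle (u N - l) l) as T.
  replace (u N - l + l) with (u N) in T by ring.
  specialize (HB N). lra.
Qed.

(** Written like the body of [qPochInf], so that [qPochInf a q] and [clim (qPoch a q)] are
    convertible. *)
Definition clim (u : nat -> C) : C :=
  @lim C_CompleteNormedModule (filtermap u eventually).

(** [lim] is specified only for Cauchy filters: a convergent sequence gives one, completeness
    returns some limit, and uniqueness identifies it with [l]. *)
Lemma clim_cvg (u : nat -> C) (l : C) : cvg u l -> clim u = l.
Proof.
  intros H. apply (cvg_unique u); [|exact H].
  assert (HF : filterlim u eventually (@locally C_UniformSpace l)) by now apply cvg_filterlim.
  assert (HC : cauchy (T := C_CompleteNormedModule) (filtermap u eventually)).
  { intros eps. exists l. exact (proj1 (filterlim_locally u l) HF eps). }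
  apply cvg_filterlim. apply filterlim_locally. intros eps.
  exact (complete_cauchy (T := C_CompleteNormedModule) (filtermap u eventually)
    (filtermap_proper_filter _ _ u eventually eventually_filter) HC eps).
Qed.

Lemma csum_ext (n : nat) (f g : nat -> C) :
  (forall k, (k < n)%nat -> f k = g k) -> csum n f = csum n g.
Proof.
  induction n as [|n IH]; intros H; simpl; [reflexivity|].
  rewrite IH by (intros; apply H; lia). now rewrite H by lia.
Qed.

Lemma csum_plus (n : nat) (f g : nat -> C) :
  csum n (fun k => f k + g k) = csum n f + csum n g.
Proof. induction n as [|n IH]; simpl; [ring|]. rewrite IH. ring. Qed.

Lemma csum_scal (n : nat) (c : C) (f : nat -> C) :
  csum n (fun k => c * f k) = c * csum n f.
Proof. induction n as [|n IH]; simpl; [ring|]. rewrite IH. ring. Qed.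

Lemma csum_minus (n : nat) (f g : nat -> C) :
  csum n (fun k => f k - g k) = csum n f - csum n g.
Proof. induction n as [|n IH]; simpl; [ring|]. rewrite IH. ring. Qed.

Lemma csum_zero (n : nat) (f : nat -> C) :
  (forall k, (k < n)%nat -> f k = 0) -> csum n f = 0.
Proof.
  intros H. induction n as [|n IH]; simpl; [reflexivity|].
  rewrite IH by (intros; apply H; lia). rewrite H by lia. ring.
Qed.

Lemma csum_add (n m : nat) (f : nat -> C) :
  csum (n + m) f = csum n f + csum m (fun k => f (n + k)%nat).
Proof.
  induction m as [|m IH]; [rewrite Nat.add_0_r; simpl; ring|].
  rewrite Nat.add_succ_r. simpl. rewrite IH. ring.
Qed.

Lemma csum_S_l (n : nat) (f : nat -> C) :
  csum (S n) f = f 0%nat + csum n (fun k => f (S k)).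
Proof.
  change (S n) with (1 + n)%nat. rewrite csum_add. simpl. ring.
Qed.

Lemma csum_rev (n : nat) (f : nat -> C) :
  csum n f = csum n (fun k => f (n - 1 - k)%nat).
Proof.
  revert f. induction n as [|n IH]; intros f; [reflexivity|].
  rewrite csum_S_l. cbn [csum].
  replace (S n - 1 - n)%nat with 0%nat by lia. rewrite (IH (fun k => f (S k))).
  rewrite Cplus_comm. f_equal. apply csum_ext. intros k Hk. f_equal. lia.
Qed.

Lemma csum_swap (n m : nat) (f : nat -> nat -> C) :
  csum n (fun i => csum m (fun j => f i j)) = csum m (fun j => csum n (fun i => f i j)).
Proof.
  induction n as [|n IH]; simpl.
  - symmetry. now apply csum_zero.
  - rewrite IH, <- csum_plus. reflexivity.
Qed.

(** The factor [1 - rho ^ n], the exact finite geometric sum, is kept because the cruder bound of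
    the next lemma does not pass through the induction. *)
Lemma csum_Cmod_geom (n : nat) (f : nat -> C) (K rho : R) :
  (0 <= K)%R -> (0 <= rho < 1)%R ->
  (forall k, (Cmod (f k) <= K * rho ^ k)%R) ->
  (Cmod (csum n f) <= K / (1 - rho) * (1 - rho ^ n))%R.
Proof.
  intros HK Hr H. induction n as [|n IH]; simpl.
  - rewrite Cmod_0. lra.
  - eapply Rle_trans; [apply Cmod_triangle|]. specialize (H n).
    replace (K / (1 - rho) * (1 - rho * rho ^ n))%R
      with (K / (1 - rho) * (1 - rho ^ n) + K * rho ^ n)%R by (field; lra). lra.
Qed.

Lemma csum_Cmod_bound (n : nat) (f : nat -> C) (K rho : R) :
  (0 <= K)%R -> (0 <= rho < 1)%R ->
  (forall k, (Cmod (f k) <= K * rho ^ k)%R) ->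
  (Cmod (csum n f) <= K / (1 - rho))%R.
Proof.
  intros HK Hr H. eapply Rle_trans; [now apply csum_Cmod_geom with (rho := rho) (K := K)|].
  assert (0 <= K / (1 - rho))%R by (apply Rle_mult_inv_pos; lra).
  assert (0 <= rho ^ n)%R by (apply pow_le; lra).
  rewrite <- (Rmult_1_r (K / (1 - rho))) at 2. apply Rmult_le_compat_l; lra.
Qed.

Lemma pow_small (rho eps : R) : (0 <= rho < 1)%R -> (0 < eps)%R ->
  exists N, forall n, (N <= n)%nat -> (rho ^ n < eps)%R.
Proof.
  intros Hr He. destruct (pow_lt_1_zero rho ltac:(rewrite Rabs_pos_eq; lra) eps He) as [N HN].
  exists N. intros n Hn. specialize (HN n Hn). rewrite Rabs_pos_eq in HN by (apply pow_le; lra).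
  exact HN.
Qed.

(** * Series under geometric domination and Tannery's theorem *)

Definition cseries (f : nat -> C) : C := clim (fun n => csum n f).

Definition geom_dom (K rho : R) (f : nat -> C) : Prop :=
  forall n, (Cmod (f n) <= K * rho ^ n)%R.

Lemma cseries_cvg (f : nat -> C) (K rho : R) :
  (0 <= K)%R -> (0 <= rho < 1)%R -> geom_dom K rho f -> cvg (fun n => csum n f) (cseries f).
Proof.
  intros HK Hr H.
  destruct (proj1 (@filterlim_locally_cauchy nat C_CompleteNormedModule eventually _
    (fun n => csum n f)))
    as [l Hl].
  - intros eps. destruct (pow_small rho (eps * (1 - rho) / (K + 1))) as [N HN]; [exact Hr| |].
    { apply Rdiv_lt_0_compat; [|lra]. apply Rmult_lt_0_compat; [apply cond_pos|lra]. }
    assert (Hkey : forall n m, (N <= n)%nat -> (n <= m)%nat ->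
      (Cmod (csum m f - csum n f) < eps)%R).
    { intros n m Hn Hm. replace m with (n + (m - n))%nat by lia.
      rewrite csum_add.
      replace (csum n f + csum (m - n) (fun k => f (n + k)%nat) - csum n f)
        with (csum (m - n) (fun k => f (n + k)%nat)) by ring.
      eapply Rle_lt_trans.
      { apply (csum_Cmod_bound _ _ (K * rho ^ n) rho); [|exact Hr|].
        - apply Rmult_le_pos; [exact HK|apply pow_le; lra].
        - intros k. eapply Rle_trans; [apply H|]. rewrite pow_add. right. ring. }
      specialize (HN n Hn). pose proof (cond_pos eps).
      assert (0 <= rho ^ n)%R by (apply pow_le; lra).
      apply (Rmult_lt_reg_r (1 - rho)); [lra|].
      replace (K * rho ^ n / (1 - rho) * (1 - rho))%R with (K * rho ^ n)%R by (field; lra).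
      apply (Rmult_lt_compat_l (K + 1)) in HN; [|lra].
      replace ((K + 1) * (eps * (1 - rho) / (K + 1)))%R with (eps * (1 - rho))%R in HN by (field; lra).
      lra. }
    exists (fun n => (N <= n)%nat). split; [exists N; auto|].
    intros u v Hu Hv. apply (C_NormedModule_mixin_compat1 (csum u f) (csum v f) eps).
    change (Cmod (csum v f - csum u f) < eps)%R.
    destruct (Nat.le_ge_cases u v); [now apply Hkey|].
    rewrite Cmod_minus_sym. now apply Hkey.
  - change (@locally C_UniformSpace l) with (@locally C_UniformSpace (l : C)) in Hl.
    assert (Hc : cvg (fun n => csum n f) l) by (apply cvg_filterlim; exact Hl).
    unfold cseries. now rewrite (clim_cvg _ _ Hc).
Qed.

Lemma cseries_ext (f g : nat -> C) : (forall n, f n = g n) -> cseries f = cseries g.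
Proof.
  intros H. f_equal. now apply functional_extensionality.
Qed.

Lemma cseries_eq (f : nat -> C) (l : C) : cvg (fun n => csum n f) l -> cseries f = l.
Proof. apply clim_cvg. Qed.

(** Tannery's theorem, that is, dominated convergence for series. The terms and the truncation
    [phi m] may both move with [m]; the domination is uniform in [m]. *)
Lemma tannery (f : nat -> nat -> C) (l : nat -> C) (phi : nat -> nat) (K rho : R) :
  (0 <= K)%R -> (0 <= rho < 1)%R ->
  (forall m, geom_dom K rho (f m)) ->
  (forall n, cvg (fun m => f m n) (l n)) ->
  (forall k, exists N, forall n, (N <= n)%nat -> (k <= phi n)%nat) ->
  geom_dom K rho l /\ cvg (fun m => csum (phi m) (f m)) (cseries l).
Proof.
  intros HK Hr Hf Hl Hphi.
  assert (Hdl : geom_dom K rho l).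
  { intros n. apply (cvg_Cmod_le (fun m => f m n)); [|apply Hl]. intros m. apply Hf. }
  split; [exact Hdl|]. intros eps He.
  pose proof (cseries_cvg l K rho HK Hr Hdl) as Hs.
  (* Cut at a fixed [n]: the tails of all [f m] are small uniformly by this bound, the tail of [l]
     by its convergence, and the first [n] terms converge as a finite sum. *)
  assert (Htail : forall g, geom_dom K rho g -> forall n m, (n <= m)%nat ->
    (Cmod (csum m g - csum n g) <= K / (1 - rho) * rho ^ n)%R).
  { intros g Hg n m Hm. replace m with (n + (m - n))%nat by lia. rewrite csum_add.
    replace (csum n g + csum (m - n) (fun k => g (n + k)%nat) - csum n g)
      with (csum (m - n) (fun k => g (n + k)%nat)) by ring.
    replace (K / (1 - rho) * rho ^ n)%R with (K * rho ^ n / (1 - rho))%R by (field; lra).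
    apply csum_Cmod_bound; [|exact Hr|].
    - apply Rmult_le_pos; [exact HK|apply pow_le; lra].
    - intros k. eapply Rle_trans; [apply Hg|]. rewrite pow_add. right. ring. }
  assert (HKr : (0 <= K / (1 - rho))%R) by (apply Rle_mult_inv_pos; lra).
  destruct (pow_small rho (eps / 4 / (K / (1 - rho) + 1))) as [N0 HN0]; [exact Hr| |].
  { apply Rdiv_lt_0_compat; lra. }
  destruct (Hs (eps / 4)%R) as [N1 HN1]; [lra|].
  set (n := max N0 N1).
  assert (Hfin : cvg (fun m => csum n (f m)) (csum n l)).
  { clear -Hl. induction n as [|n IH]; simpl; [apply cvg_const|]. apply cvg_plus; [exact IH|apply Hl]. }
  destruct (Hfin (eps / 4)%R) as [N2 HN2]; [lra|].
  destruct (Hphi n) as [N3 HN3].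
  exists (max N2 N3). intros m Hm.
  specialize (HN3 m ltac:(lia)). specialize (HN2 m ltac:(lia)).
  specialize (HN1 n ltac:(unfold n; lia)). specialize (HN0 n ltac:(unfold n; lia)).
  pose proof (Htail (f m) (Hf m) n (phi m) HN3) as HT.
  assert (Hsm : (K / (1 - rho) * rho ^ n <= eps / 4)%R).
  { apply (Rmult_lt_compat_l (K / (1 - rho) + 1)) in HN0; [|lra].
    replace ((K / (1 - rho) + 1) * (eps / 4 / (K / (1 - rho) + 1)))%R with (eps / 4)%R in HN0
      by (field; split; lra).
    assert (0 <= rho ^ n)%R by (apply pow_le; lra). lra. }
  replace (csum (phi m) (f m) - cseries l)
    with ((csum (phi m) (f m) - csum n (f m)) + ((csum n (f m) - csum n l) + (csum n l - cseries l))) by ring.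
  pose proof (Cmod_triangle (csum (phi m) (f m) - csum n (f m))
    ((csum n (f m) - csum n l) + (csum n l - cseries l))) as T1.
  pose proof (Cmod_triangle (csum n (f m) - csum n l) (csum n l - cseries l)) as T2.
  lra.
Qed.

(** * q-Pochhammer symbols *)

Lemma qPoch_add (a q : C) (n m : nat) :
  qPoch a q (n + m) = qPoch a q n * qPoch (a * q ^ n) q m.
Proof.
  induction m as [|m IH]; [rewrite Nat.add_0_r; simpl; ring|].
  rewrite Nat.add_succ_r. simpl. rewrite IH, Cpow_add_r. ring.
Qed.

Lemma qPoch_S_l (a q : C) (n : nat) : qPoch a q (S n) = (1 - a) * qPoch (a * q) q n.
Proof.
  change (S n) with (1 + n)%nat. rewrite qPoch_add. simpl.
  replace (a * (q * 1)) with (a * q) by ring. ring.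
Qed.

Lemma qPoch_neq_0 (a q : C) (n : nat) :
  (forall k, (k < n)%nat -> 1 - a * q ^ k <> 0) -> qPoch a q n <> 0.
Proof.
  intros H. induction n as [|n IH]; simpl; [apply C1_nz|].
  apply Cmult_neq_0; [apply IH; intros; apply H; lia|apply H; lia].
Qed.

(** [1 + x <= exp x] factor by factor; the exponents add up to a geometric series. *)
Lemma qPoch_bounded (a q : C) : (Cmod q < 1)%R ->
  exists B : R, (0 < B)%R /\ forall n, (Cmod (qPoch a q n) <= B)%R.
Proof.
  intros Hq. set (r := Cmod q). assert (Hr : (0 <= r < 1)%R) by (split; [apply Cmod_ge_0|exact Hq]).
  exists (exp (Cmod a / (1 - r))). split; [apply exp_pos|].
  pose proof (Cmod_ge_0 a) as Ha.
  assert (H : forall n, (Cmod (qPoch a q n) <= exp (Cmod a / (1 - r) * (1 - r ^ n)))%R).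
  { induction n as [|n IH]; simpl.
    - rewrite Cmod_1. replace (Cmod a / (1 - r) * (1 - 1))%R with 0%R by ring. rewrite exp_0. lra.
    - rewrite Cmod_mult.
      replace (Cmod a / (1 - r) * (1 - r * r ^ n))%R
        with (Cmod a / (1 - r) * (1 - r ^ n) + Cmod a * r ^ n)%R by (field; lra).
      rewrite exp_plus. apply Rmult_le_compat; [apply Cmod_ge_0|apply Cmod_ge_0|exact IH|].
      eapply Rle_trans; [apply Cmod_triangle|].
      rewrite Cmod_1, Cmod_opp, Cmod_mult, Cmod_pow. fold r. apply exp_ineq1_le. }
  intros n. eapply Rle_trans; [apply H|].
  assert (0 <= r ^ n)%R by (apply pow_le; lra).
  assert (0 <= Cmod a / (1 - r))%R by (apply Rle_mult_inv_pos; lra).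
  destruct (Rle_lt_or_eq_dec (Cmod a / (1 - r) * (1 - r ^ n)) (Cmod a / (1 - r))) as [H2|H2].
  - rewrite <- (Rmult_1_r (Cmod a / (1 - r))) at 2. apply Rmult_le_compat_l; lra.
  - left. now apply exp_increasing.
  - rewrite H2. lra.
Qed.

(** Consecutive products differ by [- a * q ^ k * qPoch a q k], which is geometrically small since
    the products are bounded; so the product is [1] plus a convergent series. *)
Lemma qPoch_cvg (a q : C) : (Cmod q < 1)%R -> cvg (qPoch a q) (qPochInf a q).
Proof.
  intros Hq. destruct (qPoch_bounded a q Hq) as [B [HB Hb]].
  set (f := fun k => - a * q ^ k * qPoch a q k).
  assert (Hs : forall n, qPoch a q n = 1 + csum n f).
  { induction n as [|n IH]; simpl; [ring|]. unfold f at 2. rewrite IH at 1.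
    replace (1 + csum n f) with (qPoch a q n) by now rewrite IH.
    replace (1 + (csum n f + - a * q ^ n * qPoch a q n))
      with ((1 + csum n f) + - a * q ^ n * qPoch a q n) by ring. rewrite <- IH. ring. }
  assert (Hc : cvg (qPoch a q) (1 + cseries f)).
  { apply cvg_ext with (fun n => 1 + csum n f); [intros; now rewrite Hs|].
    apply cvg_plus; [apply cvg_const|].
    apply (cseries_cvg f (Cmod a * B) (Cmod q)).
    - apply Rmult_le_pos; [apply Cmod_ge_0|lra].
    - split; [apply Cmod_ge_0|exact Hq].
    - intros k. unfold f. rewrite !Cmod_mult, Cmod_opp, Cmod_pow.
      replace (Cmod a * B * Cmod q ^ k)%R with (Cmod a * Cmod q ^ k * B)%R by ring.
      apply Rmult_le_compat_l; [|apply Hb].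
      apply Rmult_le_pos; [apply Cmod_ge_0|apply pow_le, Cmod_ge_0]. }
  change (qPochInf a q) with (clim (qPoch a q)). now rewrite (clim_cvg _ _ Hc).
Qed.

Lemma qPochInf_eq (a q l : C) : cvg (qPoch a q) l -> qPochInf a q = l.
Proof. apply clim_cvg. Qed.

(** Weierstrass's inequality: a product of factors [1 - x_k] is at least [1] minus the sum of the
    [x_k], and that sum is at most [1/2] here. *)
Lemma qPoch_lower_small (b q : C) : (Cmod q < 1)%R -> (Cmod b / (1 - Cmod q) <= 1 / 2)%R ->
  forall n, (1 / 2 <= Cmod (qPoch b q n))%R.
Proof.
  intros Hq Hb. set (r := Cmod q) in *.
  assert (Hr : (0 <= r < 1)%R) by (split; [apply Cmod_ge_0|exact Hq]).
  pose proof (Cmod_ge_0 b) as Hb0.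
  assert (Hb1 : (Cmod b <= 1 / 2)%R).
  { apply Rle_trans with (Cmod b / (1 - r))%R; [|exact Hb].
    apply (Rmult_le_reg_r (1 - r)); [lra|].
    replace (Cmod b / (1 - r) * (1 - r))%R with (Cmod b) by (field; lra). nra. }
  assert (H : forall n, (1 - Cmod b / (1 - r) * (1 - r ^ n) <= Cmod (qPoch b q n))%R).
  { induction n as [|n IH]; simpl.
    - rewrite Cmod_1. lra.
    - rewrite Cmod_mult.
      assert (Hf : (1 - Cmod b * r ^ n <= Cmod (1 - b * q ^ n))%R).
      { pose proof (Cmod_triangle (1 - b * q ^ n) (b * q ^ n)) as T.
        replace (1 - b * q ^ n + b * q ^ n) with (RtoC 1) in T by ring.
        rewrite Cmod_1, Cmod_mult, Cmod_pow in T. fold r in T. lra. }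
      assert (Hp : (0 <= r ^ n <= 1)%R).
      { split; [apply pow_le; lra|]. rewrite <- (pow1 n). apply pow_incr. lra. }
      replace (Cmod b / (1 - r) * (1 - r * r ^ n))%R
        with (Cmod b / (1 - r) * (1 - r ^ n) + Cmod b * r ^ n)%R by (field; lra).
      assert (Hx : (0 <= Cmod b / (1 - r) * (1 - r ^ n) <= 1 / 2)%R).
      { split; [apply Rmult_le_pos; [apply Rle_mult_inv_pos; lra|lra]|].
        apply Rle_trans with (Cmod b / (1 - r) * 1)%R; [|lra].
        apply Rmult_le_compat_l; [apply Rle_mult_inv_pos; lra|lra]. }
      assert (Hy : (0 <= Cmod b * r ^ n <= 1 / 2)%R) by nra.
      set (x := (Cmod b / (1 - r) * (1 - r ^ n))%R) in *.
      set (y := (Cmod b * r ^ n)%R) in *.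
      apply Rle_trans with ((1 - x) * (1 - y))%R; [nra|].
      apply Rmult_le_compat; lra. }
  intros n. eapply Rle_trans; [|apply H].
  assert (0 <= r ^ n)%R by (apply pow_le; lra).
  assert (0 <= Cmod b / (1 - r))%R by (apply Rle_mult_inv_pos; lra). nra.
Qed.

(** For a suitable [N], [a * q ^ N] is small enough for [qPoch_lower_small]; the finitely many
    products of length up to [N] are nonzero and have a positive minimum. This keeps the infinite
    product away from zero. *)
Lemma qPoch_lower (a q : C) : (Cmod q < 1)%R -> (forall k, 1 - a * q ^ k <> 0) ->
  exists c : R, (0 < c)%R /\ forall n, (c <= Cmod (qPoch a q n))%R.
Proof.
  intros Hq Hk. set (r := Cmod q) in *.
  assert (Hr : (0 <= r < 1)%R) by (split; [apply Cmod_ge_0|exact Hq]).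
  pose proof (Cmod_ge_0 a) as Ha.
  destruct (pow_small r ((1 - r) / 2 / (Cmod a + 1)) Hr) as [N HN].
  { apply Rdiv_lt_0_compat; lra. }
  specialize (HN N (le_n N)).
  assert (Hb : (Cmod (a * q ^ N) / (1 - r) <= 1 / 2)%R).
  { rewrite Cmod_mult, Cmod_pow. fold r. apply (Rmult_le_reg_r (1 - r)); [lra|].
    replace (Cmod a * r ^ N / (1 - r) * (1 - r))%R with (Cmod a * r ^ N)%R by (field; lra).
    apply (Rmult_lt_compat_l (Cmod a + 1)) in HN; [|lra].
    replace ((Cmod a + 1) * ((1 - r) / 2 / (Cmod a + 1)))%R with ((1 - r) / 2)%R in HN
      by (field; lra).
    assert (0 <= r ^ N)%R by (apply pow_le; lra). nra. }
  pose proof (qPoch_lower_small (a * q ^ N) q Hq Hb) as Hlow.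
  assert (Hpos : forall n, (0 < Cmod (qPoch a q n))%R).
  { intros n. apply Cmod_gt_0, qPoch_neq_0. auto. }
  assert (Hfin : exists c : R, (0 < c)%R /\ forall n, (n <= N)%nat -> (c <= Cmod (qPoch a q n))%R).
  { clear -Hpos. induction N as [|N [c [Hc H]]].
    - exists (Cmod (qPoch a q 0)). split; [apply Hpos|]. intros n Hn. replace n with 0%nat by lia. lra.
    - exists (Rmin c (Cmod (qPoch a q (S N)))). split; [apply Rmin_pos; [exact Hc|apply Hpos]|].
      intros n Hn. destruct (Nat.eq_dec n (S N)) as [->|]; [apply Rmin_r|].
      eapply Rle_trans; [apply Rmin_l|]. apply H. lia. }
  destruct Hfin as [c [Hc H]]. exists (c / 2)%R. split; [lra|]. intros n.
  destruct (Nat.le_gt_cases n N) as [Hn|Hn]; [specialize (H n Hn); lra|].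
  replace n with (N + (n - N))%nat by lia. rewrite qPoch_add, Cmod_mult.
  specialize (H N (le_n N)). specialize (Hlow (n - N)%nat). nra.
Qed.

Lemma qPochInf_neq_0 (a q : C) : (Cmod q < 1)%R -> (forall k, 1 - a * q ^ k <> 0) ->
  qPochInf a q <> 0.
Proof.
  intros Hq Hk. destruct (qPoch_lower a q Hq Hk) as [c [Hc H]].
  pose proof (cvg_Cmod_ge _ _ c H (qPoch_cvg a q Hq)). apply Cmod_gt_0. lra.
Qed.

Lemma inv_qPoch_bounded (a q : C) : (Cmod q < 1)%R -> (forall k, 1 - a * q ^ k <> 0) ->
  exists B : R, (0 < B)%R /\ forall n, (Cmod (/ qPoch a q n) <= B)%R.
Proof.
  intros Hq Hk. destruct (qPoch_lower a q Hq Hk) as [c [Hc H]].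
  exists (/ c)%R. split; [now apply Rinv_0_lt_compat|]. intros n.
  rewrite Cmod_inv by (apply qPoch_neq_0; auto). now apply Rinv_le_contravar.
Qed.

Lemma inv_qPoch_cvg (a q : C) : (Cmod q < 1)%R -> (forall k, 1 - a * q ^ k <> 0) ->
  cvg (fun n => / qPoch a q n) (/ qPochInf a q).
Proof.
  intros Hq Hk. apply cvg_inv.
  - now apply qPochInf_neq_0.
  - intros n. apply qPoch_neq_0. auto.
  - now apply qPoch_cvg.
Qed.

Lemma Cmod_pow_lt_1 (q : C) (n : nat) : (Cmod q < 1)%R -> (0 < n)%nat -> (Cmod (q ^ n) < 1)%R.
Proof.
  intros Hq Hn. rewrite Cmod_pow. apply pow_lt_1_compat; [|exact Hn].
  split; [apply Cmod_ge_0|exact Hq].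
Qed.

Lemma one_minus_neq_0 (x : C) : (Cmod x < 1)%R -> 1 - x <> 0.
Proof.
  intros Hx H. assert (He : x = 1) by (replace x with (1 - (1 - x)) by ring; rewrite H; ring).
  rewrite He, Cmod_1 in Hx. lra.
Qed.

Lemma qPochInf_sqr (a q : C) : (Cmod q < 1)%R ->
  qPochInf (a ^ 2) (q ^ 2) = qPochInf a q * qPochInf (- a) q.
Proof.
  intros Hq. apply qPochInf_eq.
  apply cvg_ext with (fun n => qPoch a q n * qPoch (- a) q n).
  - induction n as [|n IH]; cbn [qPoch]; [ring|]. rewrite <- IH, <- Cpow_mult_r.
    replace (2 * n)%nat with (n + n)%nat by lia. rewrite Cpow_add_r. ring.
  - apply cvg_mult; now apply qPoch_cvg.
Qed.

Fixpoint cprod (n : nat) (f : nat -> C) : C :=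
  match n with O => 1 | S m => cprod m f * f m end.

(** The factors of [qPoch a q (k * n)] are sorted by their exponent mod [k]. *)
Lemma qPochInf_multisect (a q : C) (k : nat) : (Cmod q < 1)%R -> (0 < k)%nat ->
  qPochInf a q = cprod k (fun c => qPochInf (a * q ^ c) (q ^ k)).
Proof.
  intros Hq Hk. apply cvg_unique with (fun n => qPoch a q (k * n)).
  - apply (cvg_comp (qPoch a q)); [|now apply qPoch_cvg]. intros K. exists K. intros n Hn. nia.
  - apply cvg_ext with (fun n => cprod k (fun c => qPoch (a * q ^ c) (q ^ k) n)).
    + induction n as [|n IH].
      * rewrite Nat.mul_0_r. simpl. clear. induction k as [|k IH]; simpl; [reflexivity|].
        rewrite IH. ring.
      * replace (k * S n)%nat with (k * n + k)%nat by lia. rewrite qPoch_add, <- IH.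
        rewrite Cpow_mult_r. set (x := (q ^ k) ^ n).
        assert (H : forall m f, cprod m (fun c => qPoch (f c) (q ^ k) (S n))
          = cprod m (fun c => qPoch (f c) (q ^ k) n) * cprod m (fun c => 1 - f c * x)).
        { induction m as [|m IHm]; intros f; cbn [cprod]; [ring|]. rewrite IHm.
          cbn [qPoch]. fold x. ring. }
        rewrite (H k (fun c => a * q ^ c)). f_equal. clearbody x. clear.
        induction k as [|k IH]; simpl; [reflexivity|]. rewrite IH. f_equal. ring.
    + assert (H : forall m, cvg (fun n => cprod m (fun c => qPoch (a * q ^ c) (q ^ k) n))
        (cprod m (fun c => qPochInf (a * q ^ c) (q ^ k)))).
      { induction m as [|m IHm]; simpl; [apply cvg_const|]. apply cvg_mult; [exact IHm|].
        apply qPoch_cvg. now apply Cmod_pow_lt_1. }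
      apply H.
Qed.

(** * Bilateral series *)

Definition zpow (x : C) (k : Z) : C :=
  match k with
  | Z0 => 1
  | Zpos n => x ^ Pos.to_nat n
  | Zneg n => / x ^ Pos.to_nat n
  end.

Lemma zpow_nat (x : C) (n : nat) : zpow x (Z.of_nat n) = x ^ n.
Proof.
  destruct n as [|n]; [reflexivity|]. simpl zpow. now rewrite SuccNat2Pos.id_succ.
Qed.

Lemma zpow_pos (x : C) (k : Z) : (0 <= k)%Z -> zpow x k = x ^ Z.to_nat k.
Proof. intros H. rewrite <- zpow_nat. f_equal. lia. Qed.

Lemma zpow_frac (x : C) (n m : nat) : x <> 0 ->
  zpow x (Z.of_nat n - Z.of_nat m) = x ^ n / x ^ m.
Proof.
  intros Hx. destruct (Nat.le_ge_cases m n) as [H|H].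
  - replace (Z.of_nat n - Z.of_nat m)%Z with (Z.of_nat (n - m)) by lia. rewrite zpow_nat.
    replace n with (n - m + m)%nat at 2 by lia. rewrite Cpow_add_r. field. now apply Cpow_nz.
  - destruct (Nat.eq_dec m n) as [->|Hne].
    + rewrite Z.sub_diag. simpl. field. now apply Cpow_nz.
    + replace (Z.of_nat n - Z.of_nat m)%Z with (Zneg (Pos.of_nat (m - n))) by lia.
      simpl zpow. rewrite Nat2Pos.id by lia.
      replace m with (m - n + n)%nat at 2 by lia. rewrite Cpow_add_r.
      field. split; now apply Cpow_nz.
Qed.

Lemma zpow_frac_ex (x : C) (k : Z) : x <> 0 -> exists n m,
  k = (Z.of_nat n - Z.of_nat m)%Z /\ zpow x k = x ^ n / x ^ m.
Proof.
  intros Hx. exists (Z.to_nat k), (Z.to_nat (- k)).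
  assert (k = (Z.of_nat (Z.to_nat k) - Z.of_nat (Z.to_nat (- k)))%Z) as E by lia.
  split; [exact E|]. rewrite E at 1. now apply zpow_frac.
Qed.

Lemma zpow_add (x : C) (k l : Z) : x <> 0 -> zpow x (k + l) = zpow x k * zpow x l.
Proof.
  intros Hx. destruct (zpow_frac_ex x k Hx) as [n [m [-> ->]]].
  destruct (zpow_frac_ex x l Hx) as [n' [m' [-> ->]]].
  replace (Z.of_nat n - Z.of_nat m + (Z.of_nat n' - Z.of_nat m'))%Z
    with (Z.of_nat (n + n') - Z.of_nat (m + m'))%Z by lia.
  rewrite zpow_frac by exact Hx. rewrite !Cpow_add_r. field. split; now apply Cpow_nz.
Qed.

Lemma zpow_neq_0 (x : C) (k : Z) : x <> 0 -> zpow x k <> 0.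
Proof.
  intros Hx H. assert (E : zpow x (k + - k) = 1) by (now rewrite Z.add_opp_diag_r).
  rewrite zpow_add, H, Cmult_0_l in E by exact Hx. symmetry in E. now apply C1_nz.
Qed.

Lemma zpow_opp (x : C) (k : Z) : x <> 0 -> zpow x (- k) = / zpow x k.
Proof.
  intros Hx. assert (E : zpow x (- k + k) = 1) by (now rewrite Z.add_opp_diag_l).
  rewrite zpow_add in E by exact Hx. pose proof (zpow_neq_0 x k Hx).
  apply (f_equal (fun c => c * / zpow x k)) in E. rewrite Cmult_1_l in E. rewrite <- E. field; auto.
Qed.

Lemma zpow_mult_l (x y : C) (k : Z) : x <> 0 -> y <> 0 -> zpow (x * y) k = zpow x k * zpow y k.
Proof.
  intros Hx Hy. destruct k as [|n|n]; simpl; [ring|apply Cpow_mult_l|].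
  rewrite Cpow_mult_l. field. split; now apply Cpow_nz.
Qed.

Lemma zpow_zpow (x : C) (k l : Z) : x <> 0 -> zpow (zpow x k) l = zpow x (k * l).
Proof.
  intros Hx. pose proof (zpow_neq_0 x k Hx) as Hk.
  assert (H : forall n, zpow x k ^ n = zpow x (k * Z.of_nat n)).
  { induction n as [|n IH]; [now rewrite Z.mul_0_r|].
    rewrite Cpow_S, IH, <- zpow_add by exact Hx. f_equal. lia. }
  destruct l as [|n|n].
  - now rewrite Z.mul_0_r.
  - simpl zpow at 1. rewrite H. f_equal. lia.
  - simpl zpow at 1. rewrite H, <- zpow_opp by exact Hx. f_equal. lia.
Qed.

Lemma zpow_1_l (k : Z) : zpow 1 k = 1.
Proof. destruct k; simpl; rewrite ?Cpow_1_l; [reflexivity..|field; apply C1_nz]. Qed.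

Lemma zpow_1_r (x : C) : zpow x 1 = x.
Proof. simpl. ring. Qed.

Lemma m1_neq_0 : - (1) <> 0 :> C.
Proof. intros H. apply C1_nz. replace (RtoC 1) with (- - (1)) by ring. rewrite H. ring. Qed.

Lemma zpow_m1_sqr (k : Z) : zpow (- (1)) k * zpow (- (1)) k = 1.
Proof.
  rewrite <- zpow_mult_l by apply m1_neq_0. replace (- (1) * - (1)) with (RtoC 1) by ring.
  apply zpow_1_l.
Qed.

Lemma zpow_m1_even (k : Z) : zpow (- (1)) (2 * k) = 1.
Proof.
  rewrite <- zpow_zpow by apply m1_neq_0. replace (zpow (- (1)) 2) with (RtoC 1) by (simpl; ring).
  apply zpow_1_l.
Qed.

Lemma zpow_m1_parity (k l m : Z) : (k = l + 2 * m)%Z -> zpow (- (1)) k = zpow (- (1)) l.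
Proof.
  intros ->. rewrite zpow_add, zpow_m1_even by apply m1_neq_0. ring.
Qed.

Lemma Cmod_zpow_m1 (k : Z) : Cmod (zpow (- (1)) k) = 1%R.
Proof.
  assert (H : (Cmod (zpow (- (1)) k) * Cmod (zpow (- (1)) k) = 1)%R).
  { rewrite <- Cmod_mult, zpow_m1_sqr. apply Cmod_1. }
  pose proof (Cmod_ge_0 (zpow (- (1)) k)). nra.
Qed.

(** Turns a lower bound on an exponent into geometric decay in [n]; the slack [K] absorbs the few
    indices where a quadratic exponent falls below [Z.abs n]. *)
Lemma Cmod_zpow_le (p : C) (k n : Z) (K : nat) : p <> 0 -> (Cmod p < 1)%R ->
  (Z.abs n <= k + Z.of_nat K)%Z ->
  (Cmod (zpow p k) <= (/ Cmod p) ^ K * Cmod p ^ Z.abs_nat n)%R.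
Proof.
  intros Hp Hq H. assert (Hp0 : (0 < Cmod p)%R) by now apply Cmod_gt_0.
  replace k with (Z.of_nat (Z.to_nat (k + Z.of_nat K)) - Z.of_nat K)%Z by lia.
  rewrite zpow_frac by exact Hp. rewrite Cmod_div by now apply Cpow_nz.
  rewrite !Cmod_pow, pow_inv. unfold Rdiv. rewrite Rmult_comm.
  apply Rmult_le_compat_l; [left; apply Rinv_0_lt_compat, pow_lt, Hp0|].
  replace (Z.to_nat (k + Z.of_nat K))
    with (Z.abs_nat n + (Z.to_nat (k + Z.of_nat K) - Z.abs_nat n))%nat by lia.
  rewrite pow_add. rewrite <- (Rmult_1_r (Cmod p ^ Z.abs_nat n)) at 2.
  apply Rmult_le_compat_l; [apply pow_le; lra|].
  rewrite <- (pow1 (Z.to_nat (k + Z.of_nat K) - Z.abs_nat n)). apply pow_incr. lra.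
Qed.

Lemma zpow_neq_1 (p : C) (k : Z) : p <> 0 -> (Cmod p < 1)%R -> k <> 0%Z -> Cmod (zpow p k) <> 1%R.
Proof.
  intros Hp Hq Hk. assert (Hp0 : (0 < Cmod p)%R) by now apply Cmod_gt_0.
  assert (H : forall k, (0 < k)%Z -> (Cmod (zpow p k) < 1)%R).
  { intros l Hl. rewrite zpow_pos by lia. apply Cmod_pow_lt_1; [exact Hq|lia]. }
  destruct (Z.lt_ge_cases 0 k) as [H1|H1]; [specialize (H k H1); lra|].
  specialize (H (- k)%Z ltac:(lia)). rewrite zpow_opp, Cmod_inv in H by auto using zpow_neq_0.
  intros E. rewrite E, Rinv_1 in H. lra.
Qed.

Lemma one_minus_neq_0_Cmod (x : C) : Cmod x <> 1%R -> 1 - x <> 0.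
Proof.
  intros Hx H. apply Hx. replace x with (1 - (1 - x)) by ring. rewrite H.
  replace (1 - 0) with (RtoC 1) by ring. apply Cmod_1.
Qed.

(** The negative half is indexed by [-1 - n], so that the reflection [n -> -1 - n] just exchanges
    the two halves. *)
Definition zseries (f : Z -> C) : C :=
  cseries (fun n => f (Z.of_nat n)) + cseries (fun n => f (-1 - Z.of_nat n)%Z).

Definition zdom (K rho : R) (f : Z -> C) : Prop :=
  forall n, (Cmod (f n) <= K * rho ^ Z.abs_nat n)%R.

(** Stronger than absolute summability, but stable under sums, scalings and suitable reindexing, and
    within reach of all theta series because their exponents are quadratic. *)
Definition zsummable (f : Z -> C) : Prop :=
  exists K rho : R, (0 <= K)%R /\ (0 < rho < 1)%R /\ zdom K rho f.

Definition zsum (M : nat) (f : Z -> C) : C :=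
  csum (2 * M + 1) (fun k => f (Z.of_nat k - Z.of_nat M)%Z).

Lemma zsum_halves (M : nat) (f : Z -> C) :
  zsum M f = csum (M + 1) (fun n => f (Z.of_nat n)) + csum M (fun n => f (-1 - Z.of_nat n)%Z).
Proof.
  unfold zsum. replace (2 * M + 1)%nat with (M + (M + 1))%nat by lia.
  rewrite csum_add, Cplus_comm. f_equal.
  - apply csum_ext. intros k Hk. f_equal. lia.
  - rewrite csum_rev. apply csum_ext. intros k Hk. f_equal. lia.
Qed.

Lemma pow_le_mono (rho : R) (n m : nat) : (0 <= rho <= 1)%R -> (n <= m)%nat -> (rho ^ m <= rho ^ n)%R.
Proof.
  intros Hr H. replace m with (n + (m - n))%nat by lia. rewrite pow_add.
  rewrite <- (Rmult_1_r (rho ^ n)) at 2. apply Rmult_le_compat_l; [apply pow_le; lra|].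
  rewrite <- (pow1 (m - n)). apply pow_incr. lra.
Qed.

Lemma zdom_reindex (K rho : R) (f : Z -> C) (g : nat -> Z) :
  (0 <= K)%R -> (0 < rho < 1)%R -> zdom K rho f -> (forall n, (n <= Z.abs_nat (g n))%nat) ->
  geom_dom K rho (fun n => f (g n)).
Proof.
  intros HK Hr H Hg n. eapply Rle_trans; [apply H|]. apply Rmult_le_compat_l; [exact HK|].
  apply pow_le_mono; [lra|apply Hg].
Qed.

Lemma zsummable_cvg_pos (f : Z -> C) : zsummable f ->
  cvg (fun N => csum N (fun n => f (Z.of_nat n))) (cseries (fun n => f (Z.of_nat n))).
Proof.
  intros [K [rho [HK [Hr H]]]]. apply (cseries_cvg _ K rho); [exact HK|lra|].
  apply (zdom_reindex K rho f Z.of_nat); auto. intros; lia.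
Qed.

Lemma zsummable_cvg_neg (f : Z -> C) : zsummable f ->
  cvg (fun N => csum N (fun n => f (-1 - Z.of_nat n)%Z)) (cseries (fun n => f (-1 - Z.of_nat n)%Z)).
Proof.
  intros [K [rho [HK [Hr H]]]]. apply (cseries_cvg _ K rho); [exact HK|lra|].
  apply (zdom_reindex K rho f (fun n => (-1 - Z.of_nat n)%Z)); auto. intros; lia.
Qed.

Lemma zseries_eq (f : Z -> C) (a b : C) :
  cvg (fun N => csum N (fun n => f (Z.of_nat n))) a ->
  cvg (fun N => csum N (fun n => f (-1 - Z.of_nat n)%Z)) b -> zseries f = a + b.
Proof. intros H1 H2. unfold zseries. now rewrite (cseries_eq _ a), (cseries_eq _ b). Qed.

Lemma ztannery (f : nat -> Z -> C) (l : Z -> C) (K rho : R) :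
  (0 <= K)%R -> (0 < rho < 1)%R -> (forall m, zdom K rho (f m)) ->
  (forall n, cvg (fun m => f m n) (l n)) ->
  zdom K rho l /\ cvg (fun M => zsum M (f M)) (zseries l).
Proof.
  intros HK Hr Hf Hl. split.
  - intros n. apply (cvg_Cmod_le (fun m => f m n)); [|apply Hl]. intros m. apply Hf.
  - apply cvg_ext with (fun M => csum (M + 1) (fun n => f M (Z.of_nat n))
      + csum M (fun n => f M (-1 - Z.of_nat n)%Z)); [intros; symmetry; apply zsum_halves|].
    apply cvg_plus.
    + apply (tannery (fun M n => f M (Z.of_nat n)) (fun n => l (Z.of_nat n)) (fun M => (M + 1)%nat) K rho);
        [exact HK|lra| |auto|intros k; exists k; lia].
      intros m. apply (zdom_reindex K rho (f m) Z.of_nat); auto. intros; lia.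
    + apply (tannery (fun M n => f M (-1 - Z.of_nat n)%Z) (fun n => l (-1 - Z.of_nat n)%Z) (fun M => M) K rho);
        [exact HK|lra| |auto|intros k; exists k; lia].
      intros m. apply (zdom_reindex K rho (f m) (fun n => (-1 - Z.of_nat n)%Z)); auto. intros; lia.
Qed.

Lemma zseries_ext (f g : Z -> C) : (forall n, f n = g n) -> zseries f = zseries g.
Proof. intros H. f_equal. now apply functional_extensionality. Qed.

Lemma zseries_scal (c : C) (f : Z -> C) : zsummable f -> zseries (fun n => c * f n) = c * zseries f.
Proof.
  intros H. unfold zseries at 2. rewrite Cmult_plus_distr_l. apply zseries_eq.
  - eapply cvg_ext; [intros; symmetry; apply csum_scal|]. now apply cvg_scal, zsummable_cvg_pos.
  - eapply cvg_ext; [intros; symmetry; apply csum_scal|]. now apply cvg_scal, zsummable_cvg_neg.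
Qed.

Lemma zseries_plus (f g : Z -> C) : zsummable f -> zsummable g ->
  zseries (fun n => f n + g n) = zseries f + zseries g.
Proof.
  intros Hf Hg. unfold zseries at 2 3.
  rewrite (zseries_eq _ (cseries (fun n => f (Z.of_nat n)) + cseries (fun n => g (Z.of_nat n)))
    (cseries (fun n => f (-1 - Z.of_nat n)%Z) + cseries (fun n => g (-1 - Z.of_nat n)%Z))).
  - ring.
  - eapply cvg_ext; [intros; symmetry; apply csum_plus|].
    now apply cvg_plus; apply zsummable_cvg_pos.
  - eapply cvg_ext; [intros; symmetry; apply csum_plus|].
    now apply cvg_plus; apply zsummable_cvg_neg.
Qed.

Lemma zseries_reflect (f : Z -> C) : zseries (fun n => f (-1 - n)%Z) = zseries f.
Proof.
  unfold zseries. rewrite Cplus_comm. f_equal. apply cseries_ext. intros n. f_equal. lia.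
Qed.

(** The shift moves the single term [f 0] from one half to the other. *)
Lemma zseries_succ (f : Z -> C) : zsummable f -> zseries (fun n => f (n + 1)%Z) = zseries f.
Proof.
  intros H. unfold zseries at 2.
  rewrite (zseries_eq _ (cseries (fun n => f (Z.of_nat n)) - f 0%Z)
    (f 0%Z + cseries (fun n => f (-1 - Z.of_nat n)%Z))); [ring| |].
  - apply cvg_ext with (fun N => csum (N + 1) (fun n => f (Z.of_nat n)) - f 0%Z).
    + intros N. replace (N + 1)%nat with (S N) by lia. rewrite csum_S_l. simpl Z.of_nat at 1.
      replace (csum N (fun k => f (Z.of_nat (S k)))) with (csum N (fun n => f (Z.of_nat n + 1)%Z));
        [ring|]. apply csum_ext. intros k Hk. f_equal. lia.
    + apply cvg_minus; [|apply cvg_const].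
      apply (cvg_comp (fun N => csum N (fun n => f (Z.of_nat n))) _ (fun N => (N + 1)%nat));
        [intros k; exists k; lia|now apply zsummable_cvg_pos].
  - apply cvg_ext_from with (fun N => f 0%Z + csum (N - 1) (fun n => f (-1 - Z.of_nat n)%Z)) 1%nat.
    + intros N HN. replace N with (S (N - 1)) at 2 by lia. rewrite csum_S_l. f_equal.
      apply csum_ext. intros k Hk. f_equal. lia.
    + apply cvg_plus; [apply cvg_const|].
      apply (cvg_comp (fun N => csum N (fun n => f (-1 - Z.of_nat n)%Z)) _ (fun N => (N - 1)%nat));
        [intros k; exists (k + 1)%nat; lia|now apply zsummable_cvg_neg].
Qed.

Lemma zsummable_reindex (f : Z -> C) (g : Z -> Z) :
  (forall n, (Z.abs n <= Z.abs (g n))%Z) -> zsummable f -> zsummable (fun n => f (g n)).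
Proof.
  intros Hg [K [rho [HK [Hr H]]]]. exists K, rho. repeat split; try tauto. intros n.
  eapply Rle_trans; [apply H|]. apply Rmult_le_compat_l; [exact HK|].
  apply pow_le_mono; [lra|]. specialize (Hg n). lia.
Qed.

Lemma zseries_opp_index (f : Z -> C) : zsummable f -> zseries (fun n => f (- n)%Z) = zseries f.
Proof.
  intros H. rewrite <- zseries_succ.
  - rewrite <- zseries_reflect. apply zseries_ext. intros n. f_equal. lia.
  - apply zsummable_reindex; [intros; lia|exact H].
Qed.

Lemma csum_blocks2 (N : nat) (f : nat -> C) :
  csum (2 * N) f = csum N (fun n => f (2 * n)%nat) + csum N (fun n => f (2 * n + 1)%nat).
Proof.
  induction N as [|N IH]; [simpl; ring|]. replace (2 * S N)%nat with (S (S (2 * N))) by lia.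
  cbn [csum]. rewrite IH. replace (S (2 * N)) with (2 * N + 1)%nat by lia. ring.
Qed.

Lemma csum_blocks3 (N : nat) (f : nat -> C) :
  csum (3 * N) f = csum N (fun n => f (3 * n)%nat) + csum N (fun n => f (3 * n + 1)%nat)
    + csum N (fun n => f (3 * n + 2)%nat).
Proof.
  induction N as [|N IH]; [simpl; ring|]. replace (3 * S N)%nat with (S (S (S (3 * N)))) by lia.
  cbn [csum]. rewrite IH. replace (S (S (3 * N))) with (3 * N + 2)%nat by lia.
  replace (S (3 * N)) with (3 * N + 1)%nat by lia. ring.
Qed.

Lemma cvg_sub_limit (u : nat -> C) (l l' : C) (phi : nat -> nat) :
  (forall K, exists N, forall n, (N <= n)%nat -> (K <= phi n)%nat) ->
  cvg u l -> cvg (fun n => u (phi n)) l' -> l = l'.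
Proof. intros Hphi H H'. apply (cvg_unique (fun n => u (phi n))); [now apply cvg_comp|exact H']. Qed.

Lemma zseries_split2 (f : Z -> C) : zsummable f ->
  zseries f = zseries (fun n => f (2 * n)%Z) + zseries (fun n => f (2 * n + 1)%Z).
Proof.
  intros H.
  assert (H0 : zsummable (fun n => f (2 * n)%Z)) by (apply zsummable_reindex; [intros; lia|exact H]).
  assert (H1 : zsummable (fun n => f (2 * n + 1)%Z)) by (apply zsummable_reindex; [intros; lia|exact H]).
  unfold zseries at 1.
  rewrite (cvg_sub_limit _ _
    (cseries (fun n => f (2 * Z.of_nat n)%Z) + cseries (fun n => f (2 * Z.of_nat n + 1)%Z))
    (fun N => (2 * N)%nat) ltac:(intros k; exists k; lia) (zsummable_cvg_pos f H)).
  (* In the negative half [-1 - 2n = 2(-1 - n) + 1]: even positions carry odd indices, so the two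
     classes swap places. *)
  rewrite (cvg_sub_limit _ _
    (cseries (fun n => f (2 * (-1 - Z.of_nat n) + 1)%Z) + cseries (fun n => f (2 * (-1 - Z.of_nat n))%Z))
    (fun N => (2 * N)%nat) ltac:(intros k; exists k; lia) (zsummable_cvg_neg f H)).
  - unfold zseries. ring.
  - eapply cvg_ext.
    2:{ apply cvg_plus; [apply (zsummable_cvg_neg _ H1)|apply (zsummable_cvg_neg _ H0)]. }
    intros N. cbv beta. rewrite csum_blocks2. f_equal; apply csum_ext; intros k Hk; f_equal; lia.
  - eapply cvg_ext.
    2:{ apply cvg_plus; [apply (zsummable_cvg_pos _ H0)|apply (zsummable_cvg_pos _ H1)]. }
    intros N. cbv beta. rewrite csum_blocks2. f_equal; apply csum_ext; intros k Hk; f_equal; lia.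
Qed.

Lemma zseries_split3 (f : Z -> C) : zsummable f ->
  zseries f = zseries (fun n => f (3 * n)%Z) + zseries (fun n => f (3 * n + 1)%Z)
    + zseries (fun n => f (3 * n + 2)%Z).
Proof.
  intros H.
  assert (H0 : zsummable (fun n => f (3 * n)%Z)) by (apply zsummable_reindex; [intros; lia|exact H]).
  assert (H1 : zsummable (fun n => f (3 * n + 1)%Z)) by (apply zsummable_reindex; [intros; lia|exact H]).
  assert (H2 : zsummable (fun n => f (3 * n + 2)%Z)) by (apply zsummable_reindex; [intros; lia|exact H]).
  unfold zseries at 1.
  rewrite (cvg_sub_limit _ _
    (cseries (fun n => f (3 * Z.of_nat n)%Z) + cseries (fun n => f (3 * Z.of_nat n + 1)%Z)
      + cseries (fun n => f (3 * Z.of_nat n + 2)%Z))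
    (fun N => (3 * N)%nat) ltac:(intros k; exists k; lia) (zsummable_cvg_pos f H)).
  rewrite (cvg_sub_limit _ _
    (cseries (fun n => f (3 * (-1 - Z.of_nat n) + 2)%Z)
      + cseries (fun n => f (3 * (-1 - Z.of_nat n) + 1)%Z)
      + cseries (fun n => f (3 * (-1 - Z.of_nat n))%Z))
    (fun N => (3 * N)%nat) ltac:(intros k; exists k; lia) (zsummable_cvg_neg f H)).
  - unfold zseries. ring.
  - eapply cvg_ext.
    2:{ apply cvg_plus; [apply cvg_plus|];
        [apply (zsummable_cvg_neg _ H2)|apply (zsummable_cvg_neg _ H1)|apply (zsummable_cvg_neg _ H0)]. }
    intros N. cbv beta. rewrite csum_blocks3.
    f_equal; [f_equal|]; apply csum_ext; intros k Hk; f_equal; lia.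
  - eapply cvg_ext.
    2:{ apply cvg_plus; [apply cvg_plus|];
        [apply (zsummable_cvg_pos _ H0)|apply (zsummable_cvg_pos _ H1)|apply (zsummable_cvg_pos _ H2)]. }
    intros N. cbv beta. rewrite csum_blocks3.
    f_equal; [f_equal|]; apply csum_ext; intros k Hk; f_equal; lia.
Qed.

(** * The Bailey lemma *)

(* [1 / (q;q)_(n-k)], read as [0] when [k > n]. *)
Definition inv_qfact (q : C) (n k : nat) : C :=
  if Nat.leb k n then / qPoch q q (n - k) else 0.

Definition q_generic (q : C) : Prop := forall k, 1 - q * q ^ k <> 0.

Lemma inv_qfact_le (q : C) (n k : nat) : (k <= n)%nat -> inv_qfact q n k = / qPoch q q (n - k).
Proof. intros H. unfold inv_qfact. now rewrite (proj2 (Nat.leb_le k n) H). Qed.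

Lemma inv_qfact_gt (q : C) (n k : nat) : (n < k)%nat -> inv_qfact q n k = 0.
Proof. intros H. unfold inv_qfact. now rewrite (proj2 (Nat.leb_gt k n) H). Qed.

Lemma q_generic_qPoch (q : C) (n : nat) : q_generic q -> qPoch q q n <> 0.
Proof. intros H. apply qPoch_neq_0. auto. Qed.

Lemma inv_qfact_succ_r (q : C) (n k : nat) : q_generic q -> (k <= n)%nat ->
  inv_qfact q n (S k) = (1 - q ^ (n - k)) * inv_qfact q n k.
Proof.
  intros Hq Hk. destruct (Nat.eq_dec k n) as [->|Hne].
  - rewrite inv_qfact_gt by lia. rewrite Nat.sub_diag. simpl. ring.
  - rewrite !inv_qfact_le by lia. replace (n - k)%nat with (S (n - S k)) by lia.
    cbn [qPoch]. rewrite Cpow_S. field. split; [apply Hq|now apply q_generic_qPoch].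
Qed.

(** This is [n (n - 1) / 2], built as [0 + 1 + ... + (n - 1)] so that no division occurs in natural
    exponents. *)
Fixpoint triangular (n : nat) : nat := match n with O => O | S m => (triangular m + m)%nat end.

(** The q-Chu-Vandermonde sum with one parameter sent to infinity. Induction on [K] for all [b] at
    once: multiply by [1 - q ^ S K = (1 - q ^ (S K - k)) + q ^ (S K - k) * (1 - q ^ k)]. The first
    part lowers [K] with the same [b]; the second also shifts [k] and turns [b] into [b * q]. *)
Lemma q_vandermonde_limit (q : C) (K : nat) : q_generic q -> forall b,
  (forall k, 1 - b * q * q ^ k <> 0) ->
  csum (K + 1) (fun k => b ^ k * q ^ (k * k) / (qPoch q q (K - k) * qPoch q q k * qPoch (b * q) q k))
  = / (qPoch q q K * qPoch (b * q) q K).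
Proof.
  intros Hq. induction K as [|K IH]; intros b Hb.
  - simpl. field.
  - assert (Hbq : forall k, 1 - b * q * q * q ^ k <> 0).
    { intros k. specialize (Hb (S k)). rewrite Cpow_S in Hb. rewrite <- Cmult_assoc. exact Hb. }
    assert (Hb0 : 1 - b * q <> 0) by (specialize (Hb 0%nat); simpl in Hb; now rewrite Cmult_1_r in Hb).
    assert (Hn : forall n, qPoch q q n <> 0) by (intros; now apply q_generic_qPoch).
    assert (Hnb : forall n, qPoch (b * q) q n <> 0) by (intros; apply qPoch_neq_0; auto).
    assert (Hnbq : forall n, qPoch (b * q * q) q n <> 0) by (intros; apply qPoch_neq_0; auto).
    pose proof (IH b Hb) as IH1. pose proof (IH (b * q) Hbq) as IH2.
    set (f := fun k => b ^ k * q ^ (k * k)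
      / (qPoch q q (S K - k) * qPoch q q k * qPoch (b * q) q k)).
    assert (E1 : csum (S K + 1) (fun k => (1 - q ^ (S K - k)) * f k)
      = / (qPoch q q K * qPoch (b * q) q K)).
    { replace (S K + 1)%nat with (S (K + 1)) by lia. cbn [csum].
      replace (S K - (K + 1))%nat with 0%nat by lia.
      rewrite <- IH1. replace ((1 - q ^ 0) * f (K + 1)%nat) with (RtoC 0) by (simpl; ring).
      rewrite Cplus_0_r. apply csum_ext. intros k Hk. unfold f.
      replace (S K - k)%nat with (S (K - k)) by lia. cbn [qPoch]. rewrite Cpow_S.
      field. repeat split; auto; apply Hq. }
    assert (E2 : csum (S K + 1) (fun k => q ^ (S K - k) * (1 - q ^ k) * f k)
      = b * q ^ S K / (1 - b * q) * / (qPoch q q K * qPoch (b * q * q) q K)).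
    { replace (S K + 1)%nat with (S (K + 1)) by lia. rewrite csum_S_l.
      replace (q ^ (S K - 0) * (1 - q ^ 0) * f 0%nat) with (RtoC 0) by (simpl; ring).
      rewrite Cplus_0_l, <- IH2, <- csum_scal. apply csum_ext. intros k Hk. unfold f.
      replace (S K - S k)%nat with (K - k)%nat by lia.
      replace (q ^ S K) with (q * (q ^ (K - k) * q ^ k))
        by (rewrite <- Cpow_add_r, <- Cpow_S; f_equal; lia).
      replace (S k * S k)%nat with (k * k + k + k + 1)%nat by lia.
      rewrite (qPoch_S_l (b * q)). cbn [qPoch]. rewrite !Cpow_add_r, !Cpow_S, Cpow_mult_l.
      simpl (q ^ 0). field. repeat split; auto; apply Hq. }
    assert (E3 : (1 - q ^ S K) * csum (S K + 1) f
      = csum (S K + 1) (fun k => (1 - q ^ (S K - k)) * f k)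
        + csum (S K + 1) (fun k => q ^ (S K - k) * (1 - q ^ k) * f k)).
    { rewrite <- csum_plus, <- csum_scal. apply csum_ext. intros k Hk.
      replace (q ^ S K) with (q ^ (S K - k) * q ^ k) by (rewrite <- Cpow_add_r; f_equal; lia). ring. }
    rewrite E1, E2 in E3. pose proof (Hq K) as HqK. rewrite <- Cpow_S in HqK.
    assert (E4 : qPoch (b * q) q (S K) = (1 - b * q) * qPoch (b * q * q) q K) by apply qPoch_S_l.
    cbn [qPoch] in E4. specialize (Hb K).
    assert (E5 : qPoch (b * q * q) q K = qPoch (b * q) q K * (1 - b * q * q ^ K) / (1 - b * q))
      by (rewrite E4; field; auto).
    apply (f_equal (fun c => c / (1 - q ^ S K))) in E3.
    replace ((1 - q ^ S K) * csum (S K + 1) f / (1 - q ^ S K)) with (csum (S K + 1) f) in E3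
      by (field; auto).
    fold f. rewrite E3, E5. cbn [qPoch]. rewrite Cpow_S in *.
    field. repeat split; auto.
Qed.

(** The Bailey pair relation [beta_L = sum alpha_s / ((q)_(L-s) (aq)_(L+s))] with the usual factor
    [(a)_s / (1 - a)] taken out of [alpha_s], which makes [(a q^s)_(L+1)] the denominator. *)
Definition bailey_sum (a q : C) (alpha : nat -> C) (L : nat) : C :=
  csum (L + 1) (fun s => alpha s * inv_qfact q L s / qPoch (a * q ^ s) q (L + 1)).

Definition poch_generic (a q : C) : Prop := forall k, 1 - a * q ^ k <> 0.

Lemma poch_generic_shift (a q : C) (s : nat) : poch_generic a q -> poch_generic (a * q ^ s) q.
Proof. intros H k. rewrite <- Cmult_assoc, <- Cpow_add_r. apply H. Qed.

Lemma poch_generic_qPoch (a q : C) (n : nat) : poch_generic a q -> qPoch a q n <> 0.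
Proof. intros H. apply qPoch_neq_0. auto. Qed.

(** The terms with [n < s] vanish; substituting [n = s + k] and [b = a * q ^ (2 * s)] in the others
    leaves exactly the limiting q-Vandermonde sum. *)
Lemma bailey_step_kernel (a q : C) (L s : nat) : q_generic q -> poch_generic a q -> (s <= L)%nat ->
  csum (L + 1) (fun n => a ^ n * q ^ (n * n) * inv_qfact q L n * (inv_qfact q n s / qPoch (a * q ^ s) q (n + 1)))
  = a ^ s * q ^ (s * s) * inv_qfact q L s / qPoch (a * q ^ s) q (L + 1).
Proof.
  intros Hq Ha Hs.
  replace (L + 1)%nat with (s + (L - s + 1))%nat at 1 by lia. rewrite csum_add.
  rewrite csum_zero.
  2:{ intros k Hk. rewrite (inv_qfact_gt q k s) by lia. unfold Cdiv. ring. }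
  set (b := a * q ^ (2 * s)).
  assert (Hb : forall k, 1 - b * q * q ^ k <> 0).
  { intros k. unfold b. replace (a * q ^ (2 * s) * q * q ^ k) with (a * q ^ (2 * s + S k));
      [apply Ha|]. rewrite Cpow_add_r, Cpow_S. ring. }
  assert (Hsplit : forall k, qPoch (a * q ^ s) q (s + k + 1)
    = qPoch (a * q ^ s) q (s + 1) * qPoch (b * q) q k).
  { intros k. replace (s + k + 1)%nat with (s + 1 + k)%nat by lia. rewrite qPoch_add. f_equal.
    f_equal. unfold b. replace (2 * s)%nat with (s + s)%nat by lia. rewrite !Cpow_add_r. simpl. ring. }
  assert (Hn : forall n, qPoch q q n <> 0) by (intros; now apply q_generic_qPoch).
  assert (H1 : qPoch (a * q ^ s) q (s + 1) <> 0) by (apply poch_generic_qPoch, poch_generic_shift, Ha).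
  assert (H2 : forall n, qPoch (b * q) q n <> 0) by (intros; apply qPoch_neq_0; auto).
  rewrite Cplus_0_l.
  rewrite (csum_ext _ _ (fun k => a ^ s * q ^ (s * s) / qPoch (a * q ^ s) q (s + 1) *
    (b ^ k * q ^ (k * k) / (qPoch q q (L - s - k) * qPoch q q k * qPoch (b * q) q k)))).
  - rewrite csum_scal, (q_vandermonde_limit q (L - s) Hq b Hb).
    rewrite inv_qfact_le by exact Hs.
    replace (L + 1)%nat with (s + (L - s) + 1)%nat by lia. rewrite Hsplit. field. auto.
  - intros k Hk. rewrite Hsplit, !inv_qfact_le by lia.
    replace (L - (s + k))%nat with (L - s - k)%nat by lia.
    replace (s + k - s)%nat with k by lia.
    replace ((s + k) * (s + k))%nat with (s * s + (2 * s) * k + k * k)%nat by lia.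
    unfold b. rewrite !Cpow_add_r, Cpow_mult_l, <- Cpow_mult_r. field. auto.
Qed.

Lemma bailey_sum_widen (a q : C) (alpha : nat -> C) (n L : nat) : (n <= L)%nat ->
  bailey_sum a q alpha n
  = csum (L + 1) (fun s => alpha s * (inv_qfact q n s / qPoch (a * q ^ s) q (n + 1))).
Proof.
  intros H. unfold bailey_sum. replace (L + 1)%nat with (n + 1 + (L - n))%nat by lia.
  rewrite (csum_add (n + 1) (L - n)), (csum_zero (L - n)), Cplus_0_r.
  - apply csum_ext. intros k Hk. unfold Cdiv. ring.
  - intros k Hk. rewrite inv_qfact_gt by lia. unfold Cdiv. ring.
Qed.

(** The Bailey lemma with both free parameters at infinity: exchange the two sums and apply the
    kernel. *)
Lemma bailey_lemma (a q : C) (alpha : nat -> C) (L : nat) : q_generic q -> poch_generic a q ->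
  csum (L + 1) (fun n => a ^ n * q ^ (n * n) * inv_qfact q L n * bailey_sum a q alpha n)
  = bailey_sum a q (fun s => a ^ s * q ^ (s * s) * alpha s) L.
Proof.
  intros Hq Ha.
  rewrite (csum_ext _ _ (fun n => csum (L + 1) (fun s => alpha s *
    (a ^ n * q ^ (n * n) * inv_qfact q L n * (inv_qfact q n s / qPoch (a * q ^ s) q (n + 1)))))).
  - rewrite csum_swap. apply csum_ext. intros s Hs. rewrite csum_scal, bailey_step_kernel by (auto; lia).
    unfold Cdiv. ring.
  - intros n Hn. rewrite (bailey_sum_widen a q alpha n L) by lia. rewrite <- csum_scal.
    apply csum_ext. intros s Hs. ring.
Qed.

(** The classical unit pair in this normalisation, that is, without the factor [(a)_s / (1 - a)]. *)
Definition unit_alpha (a q : C) (s : nat) : C :=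
  (- (1)) ^ s * q ^ triangular s * (1 - a * q ^ (2 * s)) / qPoch q q s.

(** Once multiplied by [1 - q ^ L], the partial sums have a closed form. At [R = L] that form
    contains [inv_qfact q L (S L) = 0], which is why the full sum vanishes for [L > 0]. *)
Lemma unit_pair_partial (a q : C) (L R : nat) : q_generic q -> poch_generic a q -> (R <= L)%nat ->
  (1 - q ^ L) * csum (R + 1) (fun s => unit_alpha a q s * inv_qfact q L s / qPoch (a * q ^ s) q (L + 1))
  = (- (1)) ^ R * q ^ triangular (S R) * inv_qfact q L (S R) / (qPoch q q R * qPoch (a * q ^ S R) q L).
Proof.
  intros Hq Ha. induction R as [|R IH]; intros HR.
  - cbn [csum Nat.add]. unfold unit_alpha.
    rewrite (inv_qfact_succ_r q L 0) by (auto; lia). rewrite Nat.sub_0_r.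
    replace (L + 1)%nat with (S L) by lia. rewrite (qPoch_S_l (a * q ^ 0)).
    replace (a * q ^ 0 * q) with (a * q ^ 1) by (simpl; ring).
    simpl (2 * 0)%nat. simpl (triangular _). simpl (_ ^ 0). simpl (qPoch q q 0).
    pose proof (poch_generic_qPoch _ _ L (poch_generic_shift a q 1 Ha)) as H1.
    pose proof (Ha 0%nat) as H0. simpl in H0. rewrite Cmult_1_r in H0.
    field. split; [exact H1|exact H0].
  - replace (S R + 1)%nat with (S (R + 1)) by lia. cbn [csum].
    rewrite Cmult_plus_distr_l, IH by lia. replace (R + 1)%nat with (S R) by lia.
    set (s := S R). unfold unit_alpha.
    rewrite (inv_qfact_succ_r q L s) by (auto; unfold s; lia).
    assert (Hc : qPoch (a * q ^ s) q (L + 1) = (1 - a * q ^ s) * qPoch (a * q ^ S s) q L).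
    { replace (L + 1)%nat with (S L) by lia. rewrite qPoch_S_l. f_equal. f_equal. simpl. ring. }
    assert (Hd : qPoch (a * q ^ s) q (L + 1) = qPoch (a * q ^ s) q L * (1 - a * q ^ s * q ^ L)).
    { replace (L + 1)%nat with (S L) by lia. reflexivity. }
    assert (He : qPoch q q s = qPoch q q R * (1 - q ^ s)) by (unfold s; cbn [qPoch]; now rewrite Cpow_S).
    assert (HqR : 1 - q ^ s <> 0) by (unfold s; rewrite Cpow_S; apply Hq).
    pose proof (Ha s) as Has.
    assert (HaL : 1 - a * q ^ s * q ^ L <> 0) by (apply (poch_generic_shift a q s Ha)).
    pose proof (poch_generic_qPoch _ _ L (poch_generic_shift a q s Ha)) as N1.
    pose proof (poch_generic_qPoch _ _ L (poch_generic_shift a q (S s) Ha)) as N2.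
    pose proof (q_generic_qPoch q R Hq) as N3.
    assert (Hx : qPoch (a * q ^ S s) q L = qPoch (a * q ^ s) q L * (1 - a * q ^ s * q ^ L) / (1 - a * q ^ s))
      by (rewrite <- Hd, Hc; field; auto).
    rewrite He, Hd, Hx.
    replace (triangular (S s)) with (triangular s + s)%nat by reflexivity.
    replace ((- (1)) ^ s) with (- (- (1)) ^ R) by (unfold s; simpl; ring).
    replace (2 * s)%nat with (s + s)%nat by lia. rewrite !Cpow_add_r.
    replace (q ^ L) with (q ^ (L - s) * q ^ s) in * by (rewrite <- Cpow_add_r; f_equal; unfold s; lia).
    field. repeat split; auto.
Qed.

Lemma unit_pair (a q : C) (L : nat) : q_generic q -> poch_generic a q ->
  bailey_sum a q (unit_alpha a q) L = (if Nat.eqb L 0 then 1 else 0).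
Proof.
  intros Hq Ha. destruct L as [|L].
  - unfold bailey_sum, unit_alpha. simpl. pose proof (Ha 0%nat) as H0. simpl in H0.
    rewrite Cmult_1_r in H0. unfold inv_qfact. simpl. field. exact H0.
  - pose proof (unit_pair_partial a q (S L) (S L) Hq Ha (le_n _)) as H.
    rewrite (inv_qfact_gt q (S L) (S (S L))) in H by lia.
    simpl Nat.eqb. unfold bailey_sum.
    pose proof (Hq L) as HL. rewrite <- Cpow_S in HL.
    match type of H with _ * ?x = _ => set (X := x) in * end.
    assert (E : X = (1 - q ^ S L) * X / (1 - q ^ S L)) by (field; exact HL).
    rewrite E, H. unfold Cdiv. ring.
Qed.

Lemma bailey_sum_ext (a q : C) (f g : nat -> C) (L : nat) :
  (forall s, (s <= L)%nat -> f s = g s) -> bailey_sum a q f L = bailey_sum a q g L.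
Proof. intros H. apply csum_ext. intros k Hk. now rewrite H by lia. Qed.

(** In the sum given by [bailey_lemma] only [n = 0] survives, since the unit pair has [beta_n = 0]
    for [n > 0]. *)
Lemma bailey_first (a q : C) (L : nat) : q_generic q -> poch_generic a q ->
  bailey_sum a q (fun s => a ^ s * q ^ (s * s) * unit_alpha a q s) L = / qPoch q q L.
Proof.
  intros Hq Ha. rewrite <- bailey_lemma by auto. replace (L + 1)%nat with (S L) by lia.
  rewrite csum_S_l, unit_pair by auto. rewrite csum_zero.
  - rewrite inv_qfact_le by lia. rewrite Nat.sub_0_r. simpl. ring.
  - intros k Hk. rewrite unit_pair by auto. simpl Nat.eqb. cbv iota. ring.
Qed.

(** Passage from parameter [a * q] down to [a], by [1 - a q^(2s+1) = (1 - a q^(s+L+1)) - a q^(2s+1)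
    (1 - q^(L-s))]. The first part changes [(a q^(s+1))_(L+1)] into [(a q^s)_(L+1)]; the second
    cancels against [(q)_(L-s)] and is reindexed by [s + 1]. *)
Lemma bailey_lower (a q : C) (c : nat -> C) (L : nat) : q_generic q -> poch_generic a q ->
  bailey_sum (a * q) q (fun s => (1 - a * q ^ (2 * s + 1)) * c s) L
  = bailey_sum a q (fun s => (1 - a * q ^ s) * c s
      - match s with O => 0 | S s' => a * q ^ (2 * s' + 1) * c s' end) L.
Proof.
  intros Hq Ha. unfold bailey_sum.
  set (P := fun s => qPoch (a * q ^ s) q (L + 1)).
  assert (HP : forall s, P s <> 0) by (intros s; apply poch_generic_qPoch, poch_generic_shift, Ha).
  transitivity (csum (L + 1) (fun s => (1 - a * q ^ s) * c s * inv_qfact q L s / P s)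
    - csum (L + 1) (fun s => a * q ^ (2 * s + 1) * c s * inv_qfact q L (S s) / P (S s))).
  - rewrite <- csum_minus. apply csum_ext. intros s Hs. rewrite inv_qfact_succ_r by (auto; lia).
    assert (E1 : P s * (1 - a * q ^ s * q ^ (L + 1)) = (1 - a * q ^ s) * P (S s)).
    { unfold P. replace (a * q ^ S s) with (a * q ^ s * q) by (simpl; ring).
      rewrite <- qPoch_S_l. reflexivity. }
    replace (a * q * q ^ s) with (a * q ^ S s) by (simpl; ring). fold (P (S s)).
    pose proof (HP s) as H1. pose proof (HP (S s)) as H2.
    assert (H3 : 1 - a * q ^ s * q ^ (L + 1) <> 0) by (apply (poch_generic_shift a q s Ha)).
    pose proof (Ha s) as H4.
    assert (E2 : P (S s) = P s * (1 - a * q ^ s * q ^ (L + 1)) / (1 - a * q ^ s))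
      by (rewrite E1; field; auto).
    rewrite E2. replace (q ^ (2 * s + 1)) with (q ^ s * q ^ s * q)
      by (rewrite Cpow_add_r; replace (2 * s)%nat with (s + s)%nat by lia; rewrite Cpow_add_r; simpl; ring).
    replace (q ^ (L + 1)) with (q ^ (L - s) * q ^ s * q) in *
      by (rewrite <- Cpow_add_r, Cmult_comm, <- Cpow_S; f_equal; lia).
    field. auto.
  - replace (csum (L + 1) (fun s => a * q ^ (2 * s + 1) * c s * inv_qfact q L (S s) / P (S s)))
      with (csum (L + 1) (fun s => match s with O => 0 | S s' => a * q ^ (2 * s' + 1) * c s' end
        * inv_qfact q L s / P s)).
    + rewrite <- csum_minus. apply csum_ext. intros s Hs. fold (P s). unfold Cdiv. ring.
    + replace (L + 1)%nat with (S L) at 1 by lia. rewrite csum_S_l.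
      replace (L + 1)%nat with (S L) by lia. cbn [csum]. rewrite (inv_qfact_gt q L (S L)) by lia.
      unfold Cdiv. ring.
Qed.

(** * Bilateral form of the Bailey pairs *)

Definition bilateral_generic (z q : C) : Prop := forall k : Z, 1 - z * zpow q k <> 0.

(* [1 / ((q;q)_(M-r) (q;q)_(M+r))], read as [0] outside [-M <= r <= M]. *)
Definition inv_qfact_pair (q : C) (M : nat) (r : Z) : C :=
  if Z.leb (Z.abs r) (Z.of_nat M)
  then / qPoch q q (Z.to_nat (Z.of_nat M - r)) * / qPoch q q (Z.to_nat (Z.of_nat M + r))
  else 0.

(** What remains of [1 / ((q)_s (q)_(2M-s) (a q^s)_(2M+1))] at [a = z q^(-2M)], [s = M + r], once
    powers of [z] and [q] and signs are pulled out. It stays bounded, and its limit does not depend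
    on [r]. *)
Definition bailey_weight (q z : C) (M : nat) (r : Z) : C :=
  inv_qfact_pair q M r * (/ qPoch z q (Z.to_nat (Z.of_nat M + r + 1))
    * / qPoch (q / z) q (Z.to_nat (Z.of_nat M - r))).

Lemma q_generic_small (q : C) : (Cmod q < 1)%R -> q_generic q.
Proof.
  intros Hq k. rewrite <- Cpow_S. apply one_minus_neq_0, Cmod_pow_lt_1; [exact Hq|lia].
Qed.

Lemma bilateral_generic_poch_generic (z q : C) : bilateral_generic z q -> poch_generic z q.
Proof. intros H k. rewrite <- zpow_nat. apply H. Qed.

Lemma bilateral_generic_poch_generic_inv (z q : C) : z <> 0 -> q <> 0 -> bilateral_generic z q -> poch_generic (q / z) q.
Proof.
  intros Hz Hq H k E. apply (H (- (Z.of_nat (S k)))%Z).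
  rewrite zpow_opp, zpow_nat by exact Hq. pose proof (Cpow_nz q (S k) Hq) as Hk.
  replace (1 - z * / q ^ S k) with (- z / q ^ S k * (1 - q / z * q ^ k)).
  - rewrite E. ring.
  - rewrite Cpow_S in *. pose proof (Cpow_nz q k Hq). field. auto.
Qed.

Lemma bilateral_generic_poch_generic_shift (z q : C) (M : nat) : q <> 0 -> bilateral_generic z q ->
  poch_generic (z * zpow q (- Z.of_nat M)) q.
Proof.
  intros Hq H k. rewrite <- zpow_nat, <- Cmult_assoc, <- zpow_add by exact Hq. apply H.
Qed.

(** The first [n] factors [1 - z q^(-k)], [k = n, ..., 1], are turned around as
    [- z q^(-k) (1 - q^k / z)]; the powers of [q] collect to [triangular (S n) = n (n + 1) / 2]. *)
Lemma qPoch_reflect (z q : C) (n m : nat) : z <> 0 -> q <> 0 ->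
  q ^ triangular (S n) * qPoch (z * zpow q (- Z.of_nat n)) q (n + m)
  = (- z) ^ n * qPoch (q / z) q n * qPoch z q m.
Proof.
  intros Hz Hq. induction n as [|n IH].
  - simpl. replace (z * 1) with z by ring. ring.
  - replace (S n + m)%nat with (S (n + m)) by lia. rewrite qPoch_S_l.
    replace (z * zpow q (- Z.of_nat (S n)) * q) with (z * zpow q (- Z.of_nat n)).
    2:{ replace (- Z.of_nat n)%Z with (- Z.of_nat (S n) + 1)%Z by lia.
        rewrite zpow_add, zpow_1_r by exact Hq. ring. }
    change (triangular (S (S n))) with (triangular (S n) + S n)%nat. rewrite Cpow_add_r.
    rewrite zpow_opp, zpow_nat by exact Hq.
    transitivity (q ^ S n * (1 - z * / q ^ S n)
      * (q ^ triangular (S n) * qPoch (z * zpow q (- Z.of_nat n)) q (n + m))); [ring|].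
    rewrite IH. cbn [qPoch]. rewrite (Cpow_S (- z)). pose proof (Cpow_nz q (S n) Hq) as Hk.
    rewrite Cpow_S in *. pose proof (Cpow_nz q n Hq). field. auto.
Qed.

Lemma triangular_double (n : nat) : (2 * Z.of_nat (triangular n) = Z.of_nat n * (Z.of_nat n - 1))%Z.
Proof. induction n as [|n IH]; [reflexivity|]. simpl triangular. lia. Qed.

Lemma pow_m1_zpow (n : nat) : (- (1)) ^ n = zpow (- (1)) (Z.of_nat n).
Proof. now rewrite zpow_nat. Qed.

(** Completing the square: [s^2 - 2 M s = r^2 - M^2]. *)
Lemma shifted_gauss (z q : C) (M s : nat) (r : Z) : z <> 0 -> q <> 0 ->
  r = (Z.of_nat s - Z.of_nat M)%Z ->
  (z * zpow q (- Z.of_nat (2 * M))) ^ s * q ^ (s * s)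
  = zpow z (Z.of_nat M + r) * zpow q (r * r - Z.of_nat M * Z.of_nat M).
Proof.
  intros Hz Hq ->. rewrite <- !zpow_nat. rewrite zpow_mult_l by auto using zpow_neq_0.
  rewrite zpow_zpow, <- Cmult_assoc, <- zpow_add by exact Hq. f_equal; f_equal; lia.
Qed.

Lemma shifted_unit (z q : C) (M s : nat) (r : Z) : z <> 0 -> q <> 0 -> (Cmod q < 1)%R ->
  bilateral_generic z q -> (s <= 2 * M)%nat -> r = (Z.of_nat s - Z.of_nat M)%Z ->
  let a := z * zpow q (- Z.of_nat (2 * M)) in
  (- (1)) ^ s * q ^ triangular s / qPoch q q s * (inv_qfact q (2 * M) s / qPoch (a * q ^ s) q (2 * M + 1))
  = zpow z (r - Z.of_nat M) * zpow q (Z.of_nat M * Z.of_nat M + r * r - r) * bailey_weight q z M r.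
Proof.
  intros Hz Hq Hq1 Hg Hs Hr a. set (n := (2 * M - s)%nat).
  assert (Hgq := q_generic_small q Hq1).
  unfold bailey_weight, inv_qfact_pair. rewrite (proj2 (Z.leb_le _ _)) by lia.
  replace (Z.to_nat (Z.of_nat M - r)) with n by lia.
  replace (Z.to_nat (Z.of_nat M + r)) with s by lia.
  replace (Z.to_nat (Z.of_nat M + r + 1)) with (s + 1)%nat by lia.
  rewrite inv_qfact_le by exact Hs. fold n.
  replace (a * q ^ s) with (z * zpow q (- Z.of_nat n)).
  2:{ unfold a. rewrite <- zpow_nat, <- Cmult_assoc, <- zpow_add by exact Hq. do 2 f_equal. lia. }
  pose proof (qPoch_reflect z q n (s + 1) Hz Hq) as E.
  replace (n + (s + 1))%nat with (2 * M + 1)%nat in E by lia.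
  set (X := qPoch (z * zpow q (- Z.of_nat n)) q (2 * M + 1)) in *.
  assert (N1 : qPoch z q (s + 1) <> 0) by (apply poch_generic_qPoch, bilateral_generic_poch_generic, Hg).
  assert (N2 : qPoch (q / z) q n <> 0) by (apply poch_generic_qPoch, bilateral_generic_poch_generic_inv; auto).
  assert (N3 : forall k, q ^ k <> 0) by (intros; now apply Cpow_nz).
  assert (N4 : forall k, qPoch q q k <> 0) by (intros; now apply q_generic_qPoch).
  assert (N5 : (- z) ^ n <> 0).
  { apply Cpow_nz. intros H0. apply Hz. replace z with (- - z) by ring. rewrite H0. ring. }
  assert (EX : X = (- z) ^ n * qPoch (q / z) q n * qPoch z q (s + 1) / q ^ triangular (S n)).
  { rewrite <- E. field. apply N3. }
  rewrite EX.
  (* [n + s = 2 M], so [(-1)^n] and [(-1)^s] agree and the sign of the unit pair disappears. *)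
  assert (Ez : zpow z (r - Z.of_nat M) = (- (1)) ^ s / (- z) ^ n).
  { replace ((- z) ^ n) with ((- (1)) ^ n * z ^ n) by (rewrite <- Cpow_mult_l; f_equal; ring).
    replace (r - Z.of_nat M)%Z with (- Z.of_nat n)%Z by lia. rewrite zpow_opp, zpow_nat by exact Hz.
    rewrite !pow_m1_zpow.
    rewrite (zpow_m1_parity (Z.of_nat s) (Z.of_nat n) (Z.of_nat s - Z.of_nat M)) by lia.
    pose proof (zpow_neq_0 (- (1)) (Z.of_nat n) m1_neq_0). pose proof (Cpow_nz z n Hz).
    field. auto. }
  (* [triangular s + triangular (n + 1) = M^2 + r^2 - r] for [s = M + r] and [n = M - r]. *)
  assert (Eq : zpow q (Z.of_nat M * Z.of_nat M + r * r - r) = q ^ triangular s * q ^ triangular (S n)).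
  { rewrite <- Cpow_add_r, <- zpow_nat. f_equal.
    pose proof (triangular_double s) as T1. pose proof (triangular_double (S n)) as T2.
    assert (Hn : Z.of_nat n = (2 * Z.of_nat M - Z.of_nat s)%Z) by lia.
    rewrite Nat2Z.inj_succ in T2. nia. }
  rewrite Ez, Eq. field. repeat split; auto.
Qed.

Definition level_coef (d : Z) (z q : C) (r : Z) : C :=
  zpow z ((d + 1) * r) * zpow q ((d + 1) * (r * r) - r) * (1 - z * zpow q (2 * r)).

Definition iter_alpha (a q : C) (d : nat) (s : nat) : C :=
  (a ^ s * q ^ (s * s)) ^ d * unit_alpha a q s.

(** Each of the [S d] Gaussian factors contributes [z^M q^(-M^2)], but the unit pair contributes the
    inverse of one of them, hence the power [d]. *)
Lemma bailey_symmetric (z q : C) (M d : nat) : z <> 0 -> q <> 0 -> (Cmod q < 1)%R -> bilateral_generic z q ->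
  bailey_sum (z * zpow q (- Z.of_nat (2 * M))) q
    (iter_alpha (z * zpow q (- Z.of_nat (2 * M))) q (S d)) (2 * M)
  = (zpow z (Z.of_nat M) * zpow q (- (Z.of_nat M * Z.of_nat M))) ^ d
    * zsum M (fun r => level_coef (Z.of_nat (S d)) z q r * bailey_weight q z M r).
Proof.
  intros Hz Hq Hq1 Hg. unfold zsum. rewrite <- csum_scal. apply csum_ext. intros s Hs.
  set (a := z * zpow q (- Z.of_nat (2 * M))). unfold iter_alpha, unit_alpha.
  set (r := (Z.of_nat s - Z.of_nat M)%Z).
  pose proof (shifted_unit z q M s r Hz Hq Hq1 Hg ltac:(lia) eq_refl) as E. cbv zeta in E. fold a in E.
  assert (E2 : 1 - a * q ^ (2 * s) = 1 - z * zpow q (2 * r)).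
  { unfold a. rewrite <- zpow_nat, <- Cmult_assoc, <- zpow_add by exact Hq.
    replace (- Z.of_nat (2 * M) + Z.of_nat (2 * s))%Z with (2 * r)%Z by lia. reflexivity. }
  rewrite E2. unfold a at 1. rewrite (shifted_gauss z q M s r Hz Hq eq_refl).
  transitivity ((zpow z (Z.of_nat M + r) * zpow q (r * r - Z.of_nat M * Z.of_nat M)) ^ S d
    * (1 - z * zpow q (2 * r)) * ((- (1)) ^ s * q ^ triangular s / qPoch q q s
      * (inv_qfact q (2 * M) s / qPoch (a * q ^ s) q (2 * M + 1)))); [unfold Cdiv; ring|].
  rewrite E. unfold level_coef.
  transitivity (((zpow z (Z.of_nat M + r) * zpow q (r * r - Z.of_nat M * Z.of_nat M)) ^ S d
    * (zpow z (r - Z.of_nat M) * zpow q (Z.of_nat M * Z.of_nat M + r * r - r)))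
    * ((1 - z * zpow q (2 * r)) * bailey_weight q z M r)); [ring|].
  transitivity (((zpow z (Z.of_nat M) * zpow q (- (Z.of_nat M * Z.of_nat M))) ^ d
    * (zpow z ((Z.of_nat (S d) + 1) * r) * zpow q ((Z.of_nat (S d) + 1) * (r * r) - r)))
    * ((1 - z * zpow q (2 * r)) * bailey_weight q z M r)); [|ring].
  f_equal. rewrite <- !zpow_nat.
  rewrite !(zpow_mult_l (zpow z _)) by (now apply zpow_neq_0).
  rewrite !zpow_zpow by assumption.
  transitivity (zpow z ((Z.of_nat M + r) * Z.of_nat (S d) + (r - Z.of_nat M))
    * zpow q ((r * r - Z.of_nat M * Z.of_nat M) * Z.of_nat (S d)
      + (Z.of_nat M * Z.of_nat M + r * r - r))).
  { rewrite !zpow_add by assumption. ring. }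
  transitivity (zpow z (Z.of_nat M * Z.of_nat d + (Z.of_nat (S d) + 1) * r)
    * zpow q (- (Z.of_nat M * Z.of_nat M) * Z.of_nat d + ((Z.of_nat (S d) + 1) * (r * r) - r))).
  { f_equal; f_equal; lia. }
  rewrite !zpow_add by assumption. ring.
Qed.

(** * Theta functions *)

Lemma inv_qPoch_shift_cvg (a q : C) (phi : nat -> nat) (r : Z) :
  (Cmod q < 1)%R -> poch_generic a q ->
  (forall M, (Z.of_nat M - Z.abs r <= Z.of_nat (phi M))%Z) ->
  cvg (fun M => / qPoch a q (phi M)) (/ qPochInf a q).
Proof.
  intros Hq Ha Hphi. apply (cvg_comp (fun n => / qPoch a q n)).
  - intros K. exists (K + Z.to_nat (Z.abs r))%nat. intros n Hn. specialize (Hphi n). lia.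
  - now apply inv_qPoch_cvg.
Qed.

Lemma inv_qfact_pair_cvg (q : C) (r : Z) : (Cmod q < 1)%R ->
  cvg (fun M => inv_qfact_pair q M r) (/ qPochInf q q * / qPochInf q q).
Proof.
  intros Hq. eapply cvg_ext_from with (K := Z.to_nat (Z.abs r)).
  2:{ apply cvg_mult.
      - apply (inv_qPoch_shift_cvg q q (fun M => Z.to_nat (Z.of_nat M - r)) r Hq (q_generic_small q Hq)).
        intros; lia.
      - apply (inv_qPoch_shift_cvg q q (fun M => Z.to_nat (Z.of_nat M + r)) r Hq (q_generic_small q Hq)).
        intros; lia. }
  intros M HM. unfold inv_qfact_pair. now rewrite (proj2 (Z.leb_le _ _)) by lia.
Qed.

Lemma inv_qfact_pair_bounded (q : C) : (Cmod q < 1)%R ->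
  exists B : R, (0 < B)%R /\ forall M r, (Cmod (inv_qfact_pair q M r) <= B)%R.
Proof.
  intros Hq. destruct (inv_qPoch_bounded q q Hq (q_generic_small q Hq)) as [B [HB H]].
  exists (B * B)%R. split; [now apply Rmult_lt_0_compat|]. intros M r. unfold inv_qfact_pair.
  destruct (Z.leb _ _).
  - rewrite Cmod_mult. apply Rmult_le_compat; auto using Cmod_ge_0.
  - rewrite Cmod_0. nra.
Qed.

Lemma bailey_weight_cvg (q z : C) (r : Z) : z <> 0 -> q <> 0 -> (Cmod q < 1)%R -> bilateral_generic z q ->
  cvg (fun M => bailey_weight q z M r)
    (/ qPochInf q q * / qPochInf q q * (/ qPochInf z q * / qPochInf (q / z) q)).
Proof.
  intros Hz Hq0 Hq Hg. apply cvg_mult; [now apply inv_qfact_pair_cvg|]. apply cvg_mult.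
  - apply (inv_qPoch_shift_cvg z q (fun M => Z.to_nat (Z.of_nat M + r + 1)) r Hq);
      [now apply bilateral_generic_poch_generic|intros; lia].
  - apply (inv_qPoch_shift_cvg (q / z) q (fun M => Z.to_nat (Z.of_nat M - r)) r Hq);
      [now apply bilateral_generic_poch_generic_inv|intros; lia].
Qed.

Lemma bailey_weight_bounded (q z : C) : z <> 0 -> q <> 0 -> (Cmod q < 1)%R -> bilateral_generic z q ->
  exists B : R, (0 < B)%R /\ forall M r, (Cmod (bailey_weight q z M r) <= B)%R.
Proof.
  intros Hz Hq0 Hq Hg. destruct (inv_qfact_pair_bounded q Hq) as [B1 [HB1 H1]].
  destruct (inv_qPoch_bounded z q Hq (bilateral_generic_poch_generic z q Hg)) as [B2 [HB2 H2]].
  destruct (inv_qPoch_bounded (q / z) q Hq (bilateral_generic_poch_generic_inv z q Hz Hq0 Hg)) as [B3 [HB3 H3]].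
  exists (B1 * (B2 * B3))%R. split; [repeat apply Rmult_lt_0_compat; assumption|].
  intros M r. unfold bailey_weight. rewrite !Cmod_mult.
  apply Rmult_le_compat; auto using Cmod_ge_0.
  - apply Rmult_le_pos; apply Cmod_ge_0.
  - apply Rmult_le_compat; auto using Cmod_ge_0.
Qed.

(** The weights share one limit [W] for all indices, so it factors out of the limiting series. *)
Lemma weighted_tannery (c : Z -> C) (w : nat -> Z -> C) (B : R) (W : C) :
  zsummable c -> (forall M r, (Cmod (w M r) <= B)%R) -> (forall r, cvg (fun M => w M r) W) ->
  cvg (fun M => zsum M (fun r => c r * w M r)) (zseries c * W).
Proof.
  intros Hc HB HW. destruct Hc as [K [rho [HK [Hr H]]]].
  assert (HB0 : (0 <= B)%R) by (eapply Rle_trans; [apply Cmod_ge_0|apply (HB 0%nat 0%Z)]).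
  rewrite Cmult_comm, <- zseries_scal by (exists K, rho; auto).
  apply (ztannery (fun M r => c r * w M r) (fun r => W * c r) (K * B) rho).
  - now apply Rmult_le_pos.
  - exact Hr.
  - intros M r. rewrite Cmod_mult. specialize (H r). specialize (HB M r).
    replace (K * B * rho ^ Z.abs_nat r)%R with (K * rho ^ Z.abs_nat r * B)%R by ring.
    apply Rmult_le_compat; auto using Cmod_ge_0.
  - intros r. rewrite (Cmult_comm W). now apply cvg_scal.
Qed.

Lemma cvg_double (u : nat -> C) (l : C) : cvg u l -> cvg (fun M => u (2 * M)%nat) l.
Proof. apply (cvg_comp u l (fun M => (2 * M)%nat)). intros K. exists K. intros; lia. Qed.

(* The Jacobi triple product with the terms of index [2 r] and [2 r + 1] grouped together. *)
Lemma jacobi_paired (z q : C) : z <> 0 -> q <> 0 -> (Cmod q < 1)%R -> bilateral_generic z q ->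
  zsummable (level_coef 1 z q) ->
  zseries (level_coef 1 z q) = qPochInf q q * (qPochInf z q * qPochInf (q / z) q).
Proof.
  intros Hz Hq0 Hq Hg Hs.
  destruct (bailey_weight_bounded q z Hz Hq0 Hq Hg) as [B [_ HB]].
  pose proof (weighted_tannery _ (bailey_weight q z) B _ Hs HB (fun r => bailey_weight_cvg q z r Hz Hq0 Hq Hg)) as H1.
  pose proof (cvg_double _ _ (inv_qPoch_cvg q q Hq (q_generic_small q Hq))) as H2.
  (* One Bailey step evaluates the finite sum as [1 / (q)_(2M)], so two expressions for the limit of
     one sequence are compared. *)
  assert (E : / qPochInf q q = zseries (level_coef 1 z q)
    * (/ qPochInf q q * / qPochInf q q * (/ qPochInf z q * / qPochInf (q / z) q))).
  { eapply cvg_unique; [exact H2|]. refine (cvg_ext _ _ _ _ H1). intros M. cbv beta.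
    pose proof (bailey_symmetric z q M 0 Hz Hq0 Hq Hg) as E.
    simpl (_ ^ 0) in E. rewrite Cmult_1_l in E. change (Z.of_nat 1) with 1%Z in E. rewrite <- E.
    rewrite <- (bailey_first (z * zpow q (- Z.of_nat (2 * M))) q (2 * M));
      [|now apply q_generic_small|now apply bilateral_generic_poch_generic_shift].
    apply bailey_sum_ext. intros s _. unfold iter_alpha. simpl. ring. }
  pose proof (qPochInf_neq_0 q q Hq (q_generic_small q Hq)) as N1.
  pose proof (qPochInf_neq_0 z q Hq (bilateral_generic_poch_generic z q Hg)) as N2.
  pose proof (qPochInf_neq_0 (q / z) q Hq (bilateral_generic_poch_generic_inv z q Hz Hq0 Hg)) as N3.
  apply (f_equal (fun c => c * (qPochInf q q * qPochInf q q * (qPochInf z q * qPochInf (q / z) q)))) in E.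
  transitivity (/ qPochInf q q * (qPochInf q q * qPochInf q q * (qPochInf z q * qPochInf (q / z) q))).
  - rewrite E. field. auto.
  - field. auto.
Qed.

(** Two Bailey steps on the unit pair, written once as a sum over the outer index and once through
    [bailey_symmetric]; the factor [(q)_oo^2] drops out in the limit. The series on the right is a
    theta series, so the triple product makes this the quintuple product. *)
Lemma quintuple (z q : C) : z <> 0 -> q <> 0 -> (Cmod q < 1)%R -> bilateral_generic z q ->
  zsummable (level_coef 2 z q) -> zsummable (fun n => zpow z n * zpow q (n * n)) ->
  zseries (level_coef 2 z q)
  = qPochInf z q * qPochInf (q / z) q * zseries (fun n => zpow z n * zpow q (n * n)).
Proof.
  intros Hz Hq0 Hq Hg Hs Ht.
  destruct (bailey_weight_bounded q z Hz Hq0 Hq Hg) as [B [_ HB]].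
  destruct (inv_qfact_pair_bounded q Hq) as [B' [_ HB']].
  pose proof (weighted_tannery _ (bailey_weight q z) B _ Hs HB (fun r => bailey_weight_cvg q z r Hz Hq0 Hq Hg)) as H1.
  pose proof (weighted_tannery _ (inv_qfact_pair q) B' _ Ht HB' (fun r => inv_qfact_pair_cvg q r Hq)) as H2.
  assert (E : zseries (fun n => zpow z n * zpow q (n * n)) * (/ qPochInf q q * / qPochInf q q)
    = zseries (level_coef 2 z q)
      * (/ qPochInf q q * / qPochInf q q * (/ qPochInf z q * / qPochInf (q / z) q))).
  { eapply cvg_unique; [exact H2|]. refine (cvg_ext _ _ _ _ H1). intros M. cbv beta.
    pose proof (bailey_symmetric z q M 1 Hz Hq0 Hq Hg) as E.
    change (Z.of_nat 2) with 2%Z in E. rewrite Cpow_1_r in E.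
    set (c := zpow z (Z.of_nat M) * zpow q (- (Z.of_nat M * Z.of_nat M))) in *.
    assert (Hc : c <> 0) by (apply Cmult_neq_0; now apply zpow_neq_0).
    set (a := z * zpow q (- Z.of_nat (2 * M))) in *.
    assert (Hgq : q_generic q) by now apply q_generic_small.
    assert (Hga : poch_generic a q) by now apply bilateral_generic_poch_generic_shift.
    assert (E2 : bailey_sum a q (iter_alpha a q 2) (2 * M)
      = c * zsum M (fun r => zpow z r * zpow q (r * r) * inv_qfact_pair q M r)).
    { transitivity (bailey_sum a q (fun s => a ^ s * q ^ (s * s) * iter_alpha a q 1 s) (2 * M)).
      { apply bailey_sum_ext. intros s _. unfold iter_alpha. simpl. ring. }
      rewrite <- bailey_lemma by assumption. unfold zsum. rewrite <- csum_scal.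
      apply csum_ext. intros n Hn.
      replace (bailey_sum a q (iter_alpha a q 1) n) with (/ qPoch q q n).
      2:{ rewrite <- (bailey_first a q n) by assumption.
          apply bailey_sum_ext. intros s _. unfold iter_alpha. simpl. ring. }
      set (r := (Z.of_nat n - Z.of_nat M)%Z). unfold a.
      rewrite (shifted_gauss z q M n r Hz Hq0 eq_refl). rewrite inv_qfact_le by lia.
      unfold inv_qfact_pair. rewrite (proj2 (Z.leb_le _ _)) by lia.
      replace (Z.to_nat (Z.of_nat M - r)) with (2 * M - n)%nat by lia.
      replace (Z.to_nat (Z.of_nat M + r)) with n by lia. unfold c.
      replace (r * r - Z.of_nat M * Z.of_nat M)%Z
        with (- (Z.of_nat M * Z.of_nat M) + r * r)%Z by lia.
      rewrite !zpow_add by assumption. ring. }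
    rewrite E2 in E. apply (f_equal (fun x => / c * x)) in E.
    rewrite !Cmult_assoc, !Cinv_l, !Cmult_1_l in E by exact Hc. now symmetry. }
  pose proof (qPochInf_neq_0 q q Hq (q_generic_small q Hq)) as N1.
  pose proof (qPochInf_neq_0 z q Hq (bilateral_generic_poch_generic z q Hg)) as N2.
  pose proof (qPochInf_neq_0 (q / z) q Hq (bilateral_generic_poch_generic_inv z q Hz Hq0 Hg)) as N3.
  apply (f_equal (fun c => c * (qPochInf q q * qPochInf q q * (qPochInf z q * qPochInf (q / z) q)))) in E.
  match type of E with ?l = ?r => transitivity r; [field; auto|rewrite <- E; field; auto] end.
Qed.

Lemma zsummable_theta (p : C) (c : Z -> C) (Q : Z -> Z) (K : Z) : p <> 0 -> (Cmod p < 1)%R ->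
  (forall n, (Cmod (c n) <= 1)%R) -> (forall n, (Z.abs n <= Q n + K)%Z) ->
  zsummable (fun n => c n * zpow p (Q n)).
Proof.
  intros Hp Hp1 Hc HQ. assert (Hp0 : (0 < Cmod p)%R) by now apply Cmod_gt_0.
  exists ((/ Cmod p) ^ Z.to_nat K)%R, (Cmod p). repeat split; try assumption.
  - left. now apply pow_lt, Rinv_0_lt_compat.
  - intros n. rewrite Cmod_mult. rewrite <- (Rmult_1_l (_ ^ _ * _)).
    apply Rmult_le_compat; auto using Cmod_ge_0.
    apply Cmod_zpow_le; try assumption. specialize (HQ n). lia.
Qed.

Lemma zsummable_ext (f g : Z -> C) : (forall n, f n = g n) -> zsummable f -> zsummable g.
Proof.
  intros H [K [rho [HK [Hr Hd]]]]. exists K, rho. repeat split; try tauto.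
  intros n. rewrite <- H. apply Hd.
Qed.

Lemma zsummable_plus (f g : Z -> C) : zsummable f -> zsummable g -> zsummable (fun n => f n + g n).
Proof.
  intros [K [rho [HK [Hr H]]]] [K' [rho' [HK' [Hr' H']]]].
  exists (K + K')%R, (Rmax rho rho'). split; [lra|]. split.
  - split; [eapply Rlt_le_trans; [apply Hr|apply Rmax_l]|apply Rmax_lub_lt; tauto].
  - intros n. eapply Rle_trans; [apply Cmod_triangle|]. rewrite Rmult_plus_distr_r.
    apply Rplus_le_compat.
    + eapply Rle_trans; [apply H|]. apply Rmult_le_compat_l; [exact HK|].
      apply pow_incr. split; [lra|apply Rmax_l].
    + eapply Rle_trans; [apply H'|]. apply Rmult_le_compat_l; [exact HK'|].
      apply pow_incr. split; [lra|apply Rmax_r].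
Qed.

(** Normalised so that [0 < e < f] gives [(p^e, p^(f-e), p^f; p^f)_oo]. The division is exact
    because [n * (n - 1)] is even. *)
Definition theta (p : C) (f e n : Z) : C :=
  zpow (- (1)) n * zpow p (f * (n * (n - 1) / 2) + e * n).

Lemma half_consecutive (n : Z) : (2 * (n * (n - 1) / 2) = n * (n - 1))%Z.
Proof.
  destruct (Z.Even_or_Odd n) as [[m ->]|[m ->]].
  - replace (2 * m * (2 * m - 1))%Z with (m * (2 * m - 1) * 2)%Z by ring.
    rewrite Z.div_mul by lia. ring.
  - replace ((2 * m + 1) * (2 * m + 1 - 1))%Z with ((2 * m + 1) * m * 2)%Z by ring.
    rewrite Z.div_mul by lia. ring.
Qed.

Lemma zsummable_theta_series (p : C) (f e : Z) : p <> 0 -> (Cmod p < 1)%R -> (0 < f)%Z ->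
  zsummable (theta p f e).
Proof.
  intros Hp Hp1 Hf. unfold theta.
  apply (zsummable_theta p _ _ ((Z.abs e + f + 1) * (Z.abs e + f + 1))); try assumption.
  - intros n. rewrite Cmod_zpow_m1. lra.
  - intros n. pose proof (half_consecutive n) as H. set (h := (n * (n - 1) / 2)%Z) in *.
    (* [2 B] is at least the total linear coefficient [f + 2 |e| + 2], so [(|n| - B)^2 >= 0] pays
       for all linear terms. *)
    set (B := (Z.abs e + f + 1)%Z). 
    assert (H1 : (- (Z.abs e * Z.abs n) <= e * n)%Z) by (rewrite <- Z.abs_mul; lia).
    assert (H2 : (f * (n * n) - f * n = 2 * (f * h))%Z)
      by (replace (2 * (f * h))%Z with (f * (2 * h))%Z by ring; rewrite H; ring).
    assert (H3 : (n * n <= f * (n * n))%Z) by nia.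
    assert (H4 : (f * n <= f * Z.abs n)%Z) by nia.
    assert (H5 : (n * n = Z.abs n * Z.abs n)%Z) by nia.
    assert (H6 : (0 <= (Z.abs n - B) * (Z.abs n - B))%Z) by apply Z.square_nonneg.
    assert (H7 : (2 * Z.abs n <= 2 * (f * h) + 2 * (e * n) + 2 * (B * B))%Z).
    { apply Z.le_trans with (Z.abs n * Z.abs n - f * Z.abs n - 2 * (Z.abs e * Z.abs n) + 2 * (B * B))%Z;
        [|lia]. unfold B in *. nia. }
    lia.
Qed.

Lemma jacobi_triple (p : C) (f e : nat) : p <> 0 -> (Cmod p < 1)%R -> (0 < e < f)%nat ->
  zseries (theta p (Z.of_nat f) (Z.of_nat e))
  = qPochInf (p ^ f) (p ^ f) * (qPochInf (p ^ e) (p ^ f) * qPochInf (p ^ (f - e)) (p ^ f)).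
Proof.
  intros Hp Hp1 He.
  assert (Hz : p ^ e <> 0) by now apply Cpow_nz.
  assert (Hq : p ^ f <> 0) by now apply Cpow_nz.
  assert (Hq1 : (Cmod (p ^ f) < 1)%R) by (apply Cmod_pow_lt_1; [exact Hp1|lia]).
  assert (Hg : bilateral_generic (p ^ e) (p ^ f)).
  { intros k. rewrite <- !zpow_nat, zpow_zpow, <- zpow_add by exact Hp.
    apply one_minus_neq_0_Cmod, zpow_neq_1; [exact Hp|exact Hp1|].
    destruct (Z.lt_ge_cases k 0); nia. }
  pose proof (zsummable_theta_series p (Z.of_nat f) (Z.of_nat e) Hp Hp1 ltac:(lia)) as Hs.
  assert (Hl : forall r, level_coef 1 (p ^ e) (p ^ f) r
    = theta p (Z.of_nat f) (Z.of_nat e) (2 * r) + theta p (Z.of_nat f) (Z.of_nat e) (2 * r + 1)).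
  { intros r. unfold level_coef, theta. rewrite zpow_m1_even.
    rewrite (zpow_m1_parity (2 * r + 1) 1 r) by lia. rewrite zpow_1_r.
    rewrite <- !zpow_nat, !zpow_zpow, <- !zpow_add by exact Hp.
    pose proof (half_consecutive (2 * r)) as H1. pose proof (half_consecutive (2 * r + 1)) as H2.
    replace (2 * r * (2 * r - 1) / 2)%Z with (2 * (r * r) - r)%Z by lia.
    replace ((2 * r + 1) * (2 * r + 1 - 1) / 2)%Z with (2 * (r * r) + r)%Z by lia.
    set (x := (Z.of_nat e * ((1 + 1) * r) + Z.of_nat f * ((1 + 1) * (r * r) - r))%Z).
    set (y := (Z.of_nat e + Z.of_nat f * (2 * r))%Z).
    replace (Z.of_nat f * (2 * (r * r) - r) + Z.of_nat e * (2 * r))%Z with x by (unfold x; ring).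
    replace (Z.of_nat f * (2 * (r * r) + r) + Z.of_nat e * (2 * r + 1))%Z with (x + y)%Z
      by (unfold x, y; ring).
    rewrite (zpow_add p x y) by exact Hp. ring. }
  rewrite zseries_split2 by exact Hs.
  assert (S0 : zsummable (fun n => theta p (Z.of_nat f) (Z.of_nat e) (2 * n)))
    by (apply (zsummable_reindex (theta p (Z.of_nat f) (Z.of_nat e))); [intros; lia|exact Hs]).
  assert (S1 : zsummable (fun n => theta p (Z.of_nat f) (Z.of_nat e) (2 * n + 1)))
    by (apply (zsummable_reindex (theta p (Z.of_nat f) (Z.of_nat e)) (fun n => (2 * n + 1)%Z)); [intros; lia|exact Hs]).
  rewrite <- zseries_plus by assumption.
  rewrite <- (zseries_ext _ _ Hl). rewrite jacobi_paired; try assumption.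
  - do 3 f_equal. replace f with (f - e + e)%nat at 1 by lia. rewrite Cpow_add_r. field. exact Hz.
  - apply (zsummable_ext _ _ (fun r => eq_sym (Hl r))). now apply zsummable_plus.
Qed.

(** * The threefold sums *)

Lemma csum_row_rev (n L : nat) (h : nat -> C) : (n <= L)%nat ->
  csum (n + 1) h = csum (L + 1) (fun i => if Nat.leb i n then h (n - i)%nat else 0).
Proof.
  intros H. replace (L + 1)%nat with (n + 1 + (L - n))%nat by lia.
  rewrite (csum_add (n + 1) (L - n)), (csum_zero (L - n)), Cplus_0_r.
  - rewrite csum_rev. apply csum_ext. intros k Hk.
    rewrite (proj2 (Nat.leb_le _ _)) by lia. f_equal. lia.
  - intros k Hk. now rewrite (proj2 (Nat.leb_gt _ _)) by lia.
Qed.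

(** The variables [i = n1 - n2] and [n2] run over a full square, padded by zeros, so that neither
    range depends on the other and Tannery's theorem can be applied. *)
Lemma csum_triangle (L : nat) (F : nat -> nat -> C) :
  csum (L + 1) (fun n1 => csum (n1 + 1) (fun n2 => F n1 n2))
  = csum (L + 1) (fun i => csum (L + 1) (fun n2 => if Nat.leb (n2 + i) L then F (n2 + i)%nat n2 else 0)).
Proof.
  rewrite (csum_ext _ _ (fun n1 => csum (L + 1)
    (fun i => if Nat.leb i n1 then F n1 (n1 - i)%nat else 0))).
  2:{ intros n1 H1. apply (csum_row_rev n1 L (F n1)). lia. }
  rewrite csum_swap. apply csum_ext. intros i Hi.
  replace (L + 1)%nat with (i + (L + 1 - i))%nat at 1 by lia. rewrite csum_add, csum_zero.
  2:{ intros k Hk. now rewrite (proj2 (Nat.leb_gt _ _)) by lia. }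
  replace (L + 1)%nat with ((L + 1 - i) + i)%nat at 2 by lia. rewrite csum_add.
  rewrite (csum_zero i).
  2:{ intros k Hk. now rewrite (proj2 (Nat.leb_gt _ _)) by lia. }
  rewrite Cplus_0_l, Cplus_0_r. apply csum_ext. intros k Hk.
  rewrite !(proj2 (Nat.leb_le _ _)) by lia. f_equal; lia.
Qed.

(** Three nested Bailey sums started from [/ qPoch q q n3], the [beta] after one step on the unit
    pair. The exponent [e] is [0] for S_4 and [1] for S_3. *)
Definition chain3 (a q : C) (e L : nat) : C :=
  csum (L + 1) (fun n1 => a ^ n1 * q ^ (n1 * n1) * inv_qfact q L n1 *
    csum (n1 + 1) (fun n2 => a ^ n2 * q ^ (n2 * n2) * inv_qfact q n1 n2 *
      csum (n2 + 1) (fun n3 => a ^ n3 * q ^ (n3 * n3) * q ^ (e * n3) * inv_qfact q n2 n3 * / qPoch q q n3))).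

(* [1 / ((q;q)_(M-N-i) (q;q)_(M+N-j))], read as [0] when an index is negative. *)
Definition inv_qfact_pair_shift (q : C) (i j M : nat) (N : Z) : C :=
  if (Z.leb (N + Z.of_nat i) (Z.of_nat M) && Z.leb (Z.of_nat j) (Z.of_nat M + N))%bool
  then / qPoch q q (Z.to_nat (Z.of_nat M - N - Z.of_nat i))
    * / qPoch q q (Z.to_nat (Z.of_nat M + N - Z.of_nat j))
  else 0.

Definition gauss (z q : C) (N : Z) : C := zpow z N * zpow q (N * N).

(** [N] is the middle index [N2], with [N1 = N + i] and [N3 = N - j]; this is the part of the
    summand free of [M]. *)
Definition chain_coef (z q : C) (e i j : nat) (N : Z) : C :=
  / qPoch q q i * / qPoch q q j * (gauss z q (N + Z.of_nat i) * gauss z q N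
    * (gauss z q (N - Z.of_nat j) * zpow q (Z.of_nat e * (N - Z.of_nat j)))).

Lemma shifted_gauss_nat (z q : C) (M s : nat) : z <> 0 -> q <> 0 ->
  (z * zpow q (- Z.of_nat (2 * M))) ^ s * q ^ (s * s)
  = zpow z (Z.of_nat M) * zpow q (- (Z.of_nat M * Z.of_nat M))
    * gauss z q (Z.of_nat s - Z.of_nat M).
Proof.
  intros Hz Hq. rewrite (shifted_gauss z q M s _ Hz Hq eq_refl). unfold gauss.
  set (r := (Z.of_nat s - Z.of_nat M)%Z).
  replace (r * r - Z.of_nat M * Z.of_nat M)%Z with (- (Z.of_nat M * Z.of_nat M) + r * r)%Z by lia.
  rewrite !zpow_add by assumption. ring.
Qed.

(** Each of the three Gaussian factors yields [z^M q^(-M^2)], and [q^(e n3)] yields [q^(e M)] since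
    [n3 = N3 + M]. *)
Lemma chain3_symmetric (z q : C) (e M : nat) : z <> 0 -> q <> 0 ->
  chain3 (z * zpow q (- Z.of_nat (2 * M))) q e (2 * M)
  = (zpow z (Z.of_nat M) * zpow q (- (Z.of_nat M * Z.of_nat M))) ^ 3 * q ^ (e * M)
    * csum (2 * M + 1) (fun i => csum (2 * M + 1) (fun j =>
        zsum M (fun N => chain_coef z q e i j N * inv_qfact_pair_shift q i j M N))).
Proof.
  intros Hz Hq. unfold chain3. set (L := (2 * M)%nat).
  set (c := zpow z (Z.of_nat M) * zpow q (- (Z.of_nat M * Z.of_nat M))).
  set (a := z * zpow q (- Z.of_nat L)).
  assert (Hg : forall s, a ^ s * q ^ (s * s) = c * gauss z q (Z.of_nat s - Z.of_nat M))
    by (intros s; apply (shifted_gauss_nat z q M s Hz Hq)).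
  transitivity (csum (L + 1) (fun n1 => csum (n1 + 1) (fun n2 =>
    (a ^ n1 * q ^ (n1 * n1) * inv_qfact q L n1) * ((a ^ n2 * q ^ (n2 * n2) * inv_qfact q n1 n2) *
      csum (n2 + 1) (fun n3 => a ^ n3 * q ^ (n3 * n3) * q ^ (e * n3) * inv_qfact q n2 n3 * / qPoch q q n3))))).
  { apply csum_ext. intros n1 H1. now rewrite csum_scal. }
  rewrite (csum_triangle L). rewrite <- csum_scal. apply csum_ext. intros i Hi.
  transitivity (csum (L + 1) (fun n2 => csum (L + 1) (fun j =>
    (if Nat.leb (n2 + i) L then
      (a ^ (n2 + i) * q ^ ((n2 + i) * (n2 + i)) * inv_qfact q L (n2 + i))
        * (a ^ n2 * q ^ (n2 * n2) * inv_qfact q (n2 + i) n2) else 0)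
    * (if Nat.leb j n2 then a ^ (n2 - j) * q ^ ((n2 - j) * (n2 - j)) * q ^ (e * (n2 - j))
        * inv_qfact q n2 (n2 - j) * / qPoch q q (n2 - j) else 0)))).
  { apply csum_ext. intros n2 H2. rewrite csum_scal.
    destruct (Nat.leb (n2 + i) L); [|ring].
    rewrite (csum_row_rev n2 L) by lia. ring. }
  rewrite csum_swap, <- csum_scal. apply csum_ext. intros j Hj.
  unfold zsum. fold L. rewrite <- csum_scal. apply csum_ext. intros n2 H2.
  rewrite !Hg. unfold inv_qfact_pair_shift.
  destruct (Nat.leb_spec (n2 + i) L) as [Hi2|Hi2].
  2:{ rewrite (proj2 (Z.leb_gt _ _)) by lia. simpl. ring. }
  destruct (Nat.leb_spec j n2) as [Hj2|Hj2].
  2:{ rewrite (proj2 (Z.leb_gt (Z.of_nat j) _)) by lia. rewrite Bool.andb_false_r. ring. }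
  rewrite !(proj2 (Z.leb_le _ _)) by lia. simpl andb. cbv iota.
  rewrite !inv_qfact_le by lia.
  replace (n2 + i - n2)%nat with i by lia. replace (n2 - (n2 - j))%nat with j by lia.
  set (N := (Z.of_nat n2 - Z.of_nat M)%Z).
  replace (Z.to_nat (Z.of_nat M - N - Z.of_nat i)) with (L - (n2 + i))%nat by lia.
  replace (Z.to_nat (Z.of_nat M + N - Z.of_nat j)) with (n2 - j)%nat by lia.
  unfold chain_coef.
  replace (Z.of_nat (n2 + i) - Z.of_nat M)%Z with (N + Z.of_nat i)%Z by lia.
  replace (Z.of_nat (n2 - j) - Z.of_nat M)%Z with (N - Z.of_nat j)%Z by lia.
  replace (q ^ (e * (n2 - j))) with (q ^ (e * M) * zpow q (Z.of_nat e * (N - Z.of_nat j))).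
  - ring.
  - rewrite <- !zpow_nat, <- zpow_add by exact Hq. f_equal. unfold N. nia.
Qed.

Lemma inv_qfact_pair_shift_cvg (q : C) (i j : nat) (N : Z) : (Cmod q < 1)%R ->
  cvg (fun M => inv_qfact_pair_shift q i j M N) (/ qPochInf q q * / qPochInf q q).
Proof.
  intros Hq. eapply cvg_ext_from with (K := (Z.to_nat (Z.abs N) + i + j)%nat).
  2:{ apply cvg_mult.
      - apply (inv_qPoch_shift_cvg q q (fun M => Z.to_nat (Z.of_nat M - N - Z.of_nat i))
          (Z.abs N + Z.of_nat i) Hq (q_generic_small q Hq)). intros; lia.
      - apply (inv_qPoch_shift_cvg q q (fun M => Z.to_nat (Z.of_nat M + N - Z.of_nat j))
          (Z.abs N + Z.of_nat j) Hq (q_generic_small q Hq)). intros; lia. }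
  intros M HM. unfold inv_qfact_pair_shift. now rewrite !(proj2 (Z.leb_le _ _)) by lia.
Qed.

Lemma inv_qfact_pair_shift_bounded (q : C) : (Cmod q < 1)%R ->
  exists B : R, (0 < B)%R /\ forall i j M N, (Cmod (inv_qfact_pair_shift q i j M N) <= B)%R.
Proof.
  intros Hq. destruct (inv_qPoch_bounded q q Hq (q_generic_small q Hq)) as [B [HB H]].
  exists (B * B)%R. split; [now apply Rmult_lt_0_compat|]. intros i j M N. unfold inv_qfact_pair_shift.
  destruct (_ && _)%bool.
  - rewrite Cmod_mult. apply Rmult_le_compat; auto using Cmod_ge_0.
  - rewrite Cmod_0. nra.
Qed.

Lemma zsum_bound (M : nat) (f : Z -> C) (K rho : R) :
  (0 <= K)%R -> (0 < rho < 1)%R -> zdom K rho f -> (Cmod (zsum M f) <= 2 * (K / (1 - rho)))%R.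
Proof.
  intros HK Hr H. rewrite zsum_halves. eapply Rle_trans; [apply Cmod_triangle|].
  replace (2 * (K / (1 - rho)))%R with (K / (1 - rho) + K / (1 - rho))%R by ring.
  apply Rplus_le_compat; apply csum_Cmod_bound; try exact HK; try lra.
  - apply (zdom_reindex K rho f Z.of_nat); auto. intros; lia.
  - apply (zdom_reindex K rho f (fun n => (-1 - Z.of_nat n)%Z)); auto. intros; lia.
Qed.

Definition dom3 (K rho : R) (c : nat -> nat -> Z -> C) : Prop :=
  forall i j N, (Cmod (c i j N) <= K * rho ^ i * rho ^ j * rho ^ Z.abs_nat N)%R.

(** [tannery] for [i], [tannery] for [j] and [weighted_tannery] for [N], nested; the product form of
    [dom3] keeps each inner estimate geometric in the outer index. *)
Lemma tannery3 (c : nat -> nat -> Z -> C) (w : nat -> nat -> nat -> Z -> C) (K rho B : R) (W : C) :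
  (0 <= K)%R -> (0 < rho < 1)%R -> dom3 K rho c ->
  (forall i j M N, (Cmod (w i j M N) <= B)%R) ->
  (forall i j N, cvg (fun M => w i j M N) W) ->
  cvg (fun M => csum (2 * M + 1) (fun i => csum (2 * M + 1) (fun j =>
         zsum M (fun N => c i j N * w i j M N))))
    (cseries (fun i => cseries (fun j => zseries (c i j) * W))).
Proof.
  intros HK Hr Hc HB HW.
  assert (HB0 : (0 <= B)%R) by (eapply Rle_trans; [apply Cmod_ge_0|apply (HB 0%nat 0%nat 0%nat 0%Z)]).
  assert (Hp : forall n, (0 <= rho ^ n)%R) by (intros; apply pow_le; lra).
  set (K1 := (2 * (K * B / (1 - rho)))%R).
  assert (HK1 : (0 <= K1)%R).
  { unfold K1. apply Rmult_le_pos; [lra|]. apply Rle_mult_inv_pos; [now apply Rmult_le_pos|lra]. }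
  assert (Hphi : forall k, exists N, forall n, (N <= n)%nat -> (k <= 2 * n + 1)%nat)
    by (intros k; exists k; lia).
  assert (H1 : forall i j M, (Cmod (zsum M (fun N => c i j N * w i j M N)%C) <= K1 * rho ^ i * rho ^ j)%R).
  { intros i j M.
    replace (K1 * rho ^ i * rho ^ j)%R with (2 * (K * rho ^ i * rho ^ j * B / (1 - rho)))%R
      by (unfold K1; field; lra).
    apply zsum_bound; [repeat apply Rmult_le_pos; auto|exact Hr|].
    intros N. rewrite Cmod_mult.
    replace (K * rho ^ i * rho ^ j * B * rho ^ Z.abs_nat N)%R
      with (K * rho ^ i * rho ^ j * rho ^ Z.abs_nat N * B)%R by ring.
    apply Rmult_le_compat; auto using Cmod_ge_0. }
  assert (H2 : forall i, cvg (fun M => csum (2 * M + 1) (fun j => zsum M (fun N => c i j N * w i j M N)))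
    (cseries (fun j => zseries (c i j) * W))).
  { intros i. refine (proj2 (tannery (fun M j => zsum M (fun N => c i j N * w i j M N))
      (fun j => zseries (c i j) * W) (fun M => (2 * M + 1)%nat) (K1 * rho ^ i) rho _ _ _ _ Hphi)).
    - apply Rmult_le_pos; auto.
    - lra.
    - intros M j. apply H1.
    - intros j. apply (weighted_tannery (c i j) (w i j) B W); auto.
      exists (K * rho ^ i * rho ^ j)%R, rho. split; [repeat apply Rmult_le_pos; auto|].
      split; [exact Hr|]. intros N. apply Hc. }
  refine (proj2 (tannery (fun M i => csum (2 * M + 1) (fun j => zsum M (fun N => c i j N * w i j M N)))
    (fun i => cseries (fun j => zseries (c i j) * W)) (fun M => (2 * M + 1)%nat) (K1 / (1 - rho)) rho _ _ _ H2 Hphi)).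
  - apply Rle_mult_inv_pos; lra.
  - lra.
  - intros M i. replace (K1 / (1 - rho) * rho ^ i)%R with (K1 * rho ^ i / (1 - rho))%R by (field; lra).
    apply csum_Cmod_bound; [apply Rmult_le_pos; auto|lra|]. intros j. apply H1.
Qed.

(** Four Bailey steps in total: one gives [/ qPoch q q n3], and each of the three sums adds one. *)
Lemma chain3_0 (a q : C) (L : nat) : q_generic q -> poch_generic a q ->
  chain3 a q 0 L = bailey_sum a q (iter_alpha a q 4) L.
Proof.
  intros Hq Ha. unfold chain3.
  assert (E1 : forall n, csum (n + 1) (fun n3 =>
      a ^ n3 * q ^ (n3 * n3) * q ^ (0 * n3) * inv_qfact q n n3 * / qPoch q q n3)
    = bailey_sum a q (iter_alpha a q 2) n).
  { intros n. transitivity (bailey_sum a q (fun s => a ^ s * q ^ (s * s) * iter_alpha a q 1 s) n).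
    - rewrite <- bailey_lemma by assumption. apply csum_ext. intros k Hk.
      replace (bailey_sum a q (iter_alpha a q 1) k) with (/ qPoch q q k); [simpl; ring|].
      rewrite <- (bailey_first a q k) by assumption.
      apply bailey_sum_ext. intros s _. unfold iter_alpha. simpl. ring.
    - apply bailey_sum_ext. intros s _. unfold iter_alpha. simpl. ring. }
  transitivity (bailey_sum a q (fun s => a ^ s * q ^ (s * s) * (a ^ s * q ^ (s * s)
    * iter_alpha a q 2 s)) L).
  - rewrite <- bailey_lemma by assumption. apply csum_ext. intros n1 H1. f_equal.
    rewrite <- bailey_lemma by assumption. apply csum_ext. intros n2 H2. now rewrite E1.
  - apply bailey_sum_ext. intros s _. unfold iter_alpha. simpl. ring.
Qed.

(** The sequence [alpha] after two steps with parameter [a * q], a descent to [a] and two steps with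
    parameter [a]. The factor [q ^ (2 * s)] comes from the two steps at [a * q]. *)
Definition lowered_alpha (a q : C) (s : nat) : C :=
  (a ^ s * q ^ (s * s)) ^ 4 * q ^ (2 * s) * ((- (1)) ^ s * q ^ triangular s / qPoch q q s)
  * ((1 - a * q ^ s) + (1 - q ^ s) / (a * q ^ (3 * s))).

(** The factor [q^(n3)] turns [a^(n3)] into [(a q)^(n3)], so the innermost sum is a Bailey step
    relative to [a * q]; [bailey_lower] brings the result back to [a] for the two outer sums. *)
Lemma chain3_1 (a q : C) (L : nat) : a <> 0 -> q <> 0 -> q_generic q -> poch_generic a q ->
  chain3 a q 1 L = bailey_sum a q (lowered_alpha a q) L.
Proof.
  intros Ha0 Hq0 Hq Ha. unfold chain3.
  assert (Haq : poch_generic (a * q) q) by (rewrite <- (Cpow_1_r q) at 1; apply poch_generic_shift, Ha).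
  set (c := fun s => ((a * q) ^ s * q ^ (s * s)) ^ 2 * ((- (1)) ^ s * q ^ triangular s / qPoch q q s)).
  set (b := fun s => (1 - a * q ^ s) * c s
      - match s with O => 0 | S s' => a * q ^ (2 * s' + 1) * c s' end).
  assert (E1 : forall n, csum (n + 1) (fun n3 =>
      a ^ n3 * q ^ (n3 * n3) * q ^ (1 * n3) * inv_qfact q n n3 * / qPoch q q n3)
    = bailey_sum a q b n).
  { intros n. unfold b. rewrite <- bailey_lower by assumption.
    transitivity (bailey_sum (a * q) q
      (fun s => (a * q) ^ s * q ^ (s * s) * iter_alpha (a * q) q 1 s) n).
    - rewrite <- bailey_lemma by assumption. apply csum_ext. intros k Hk.
      replace (bailey_sum (a * q) q (iter_alpha (a * q) q 1) k) with (/ qPoch q q k).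
      + rewrite Cpow_mult_l. replace (1 * k)%nat with k by lia. ring.
      + rewrite <- (bailey_first (a * q) q k) by assumption.
        apply bailey_sum_ext. intros s _. unfold iter_alpha. simpl. ring.
    - apply bailey_sum_ext. intros s _. unfold iter_alpha, unit_alpha, c.
      replace (a * q * q ^ (2 * s)) with (a * q ^ (2 * s + 1)) by (rewrite Cpow_add_r; simpl (q ^ 1); ring).
      simpl (_ ^ 2). simpl (_ ^ 1). unfold Cdiv. ring. }
  transitivity (bailey_sum a q (fun s => a ^ s * q ^ (s * s) * (a ^ s * q ^ (s * s) * b s)) L).
  - rewrite <- bailey_lemma by assumption. apply csum_ext. intros n1 H1. f_equal.
    rewrite <- bailey_lemma by assumption. apply csum_ext. intros n2 H2. now rewrite E1.
  - apply bailey_sum_ext. intros s _. unfold lowered_alpha.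
    (* The descent leaves a term in [c (s - 1)]; the recurrence [c (s+1) (1 - q^(s+1)) = - a^2
       q^(5s+4) c s] rewrites it through [c s]. At [s = 0] the factor [1 - q^s] vanishes, matching
       the value [0] in [b]. *)
    assert (Eb : b s = c s * ((1 - a * q ^ s) + (1 - q ^ s) / (a * q ^ (3 * s)))).
    { unfold b. destruct s as [|s].
      - simpl. field. exact Ha0.
      - assert (Ec : c (S s) * (1 - q ^ S s) = - (a * a) * q ^ (5 * s + 4) * c s).
        { unfold c. replace (S s * S s)%nat with (s * s + 2 * s + 1)%nat by lia.
          change (triangular (S s)) with (triangular s + s)%nat. cbn [qPoch].
          replace (5 * s + 4)%nat with (s + (2 * s) + (2 * s) + 4)%nat by lia.
          rewrite !Cpow_add_r, !Cpow_S. simpl (q ^ 0).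
          pose proof (Hq s) as N1. pose proof (q_generic_qPoch q s Hq) as N2.
          rewrite ?Cpow_mult_l. field. auto. }
        transitivity ((1 - a * q ^ S s) * c (S s) + c (S s) * (1 - q ^ S s) / (a * q ^ (3 * S s)));
          [|unfold Cdiv; ring].
        rewrite Ec. replace (3 * S s)%nat with (3 * s + 3)%nat by lia.
        replace (5 * s + 4)%nat with ((2 * s + 1) + (3 * s + 3))%nat by lia.
        pose proof (Cpow_nz q (3 * s + 3) Hq0). rewrite (Cpow_add_r q (2 * s + 1)). field. auto. }
    rewrite Eb. unfold c. rewrite (Cpow_mult_l a q s).
    replace (2 * s)%nat with (s + s)%nat by lia. rewrite Cpow_add_r. unfold Cdiv. ring.
Qed.

(** * Level-three identities *)

Definition dseries (f : nat -> nat -> C) : C := cseries (fun i => cseries (f i)).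

(** The constant [k] is carried inside the double series because it will be the reciprocal of a
    theta value that is to be divided out term by term. *)
Lemma chain3_limit (z q : C) (e : nat) (K rho : R) (k l : C) :
  z <> 0 -> q <> 0 -> (Cmod q < 1)%R -> (0 <= K)%R -> (0 < rho < 1)%R ->
  dom3 K rho (chain_coef z q e) ->
  cvg (fun M => chain3 (z * zpow q (- Z.of_nat (2 * M))) q e (2 * M)
    / ((zpow z (Z.of_nat M) * zpow q (- (Z.of_nat M * Z.of_nat M))) ^ 3 * q ^ (e * M))) l ->
  dseries (fun i j => zseries (chain_coef z q e i j) * k) = l * (qPochInf q q * qPochInf q q) * k.
Proof.
  intros Hz Hq0 Hq HK Hr Hd Hl.
  destruct (inv_qfact_pair_shift_bounded q Hq) as [B [HB HvB]].
  pose proof (qPochInf_neq_0 q q Hq (q_generic_small q Hq)) as N1.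
  set (kk := qPochInf q q * qPochInf q q * k).
  assert (H1 : cvg (fun M => csum (2 * M + 1) (fun i => csum (2 * M + 1) (fun j =>
      zsum M (fun N => chain_coef z q e i j N * (inv_qfact_pair_shift q i j M N * kk)))))
    (dseries (fun i j => zseries (chain_coef z q e i j) * k))).
  { apply (tannery3 (chain_coef z q e) (fun i j M N => inv_qfact_pair_shift q i j M N * kk) K rho (B * Cmod kk) k); try assumption.
    - intros i j M N. rewrite Cmod_mult. apply Rmult_le_compat_r; [apply Cmod_ge_0|apply HvB].
    - intros i j N. replace k with (/ qPochInf q q * / qPochInf q q * kk) by (unfold kk; field; auto).
      apply cvg_mult; [now apply inv_qfact_pair_shift_cvg|apply cvg_const]. }
  eapply cvg_unique; [exact H1|].
  replace (l * (qPochInf q q * qPochInf q q) * k) with (kk * l) by (unfold kk; ring).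
  refine (cvg_ext _ _ _ _ (cvg_scal kk _ _ Hl)). intros M. cbv beta.
  rewrite (chain3_symmetric z q e M Hz Hq0).
  set (c := (zpow z (Z.of_nat M) * zpow q (- (Z.of_nat M * Z.of_nat M))) ^ 3 * q ^ (e * M)).
  assert (Hc : c <> 0).
  { apply Cmult_neq_0; [apply Cpow_nz, Cmult_neq_0; now apply zpow_neq_0|now apply Cpow_nz]. }
  set (X := csum (2 * M + 1) (fun i => csum (2 * M + 1) (fun j =>
     zsum M (fun N => chain_coef z q e i j N * inv_qfact_pair_shift q i j M N)))).
  replace (kk * (c * X / c)) with (kk * X) by (field; exact Hc).
  unfold X. rewrite <- csum_scal. apply csum_ext. intros i _.
  rewrite <- csum_scal. apply csum_ext. intros j _. unfold zsum.
  rewrite <- csum_scal. apply csum_ext. intros n _. ring.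
Qed.

Lemma level3_vacuum (z q : C) (K rho : R) (k : C) :
  z <> 0 -> q <> 0 -> (Cmod q < 1)%R -> bilateral_generic z q -> (0 <= K)%R -> (0 < rho < 1)%R ->
  dom3 K rho (chain_coef z q 0) -> zsummable (level_coef 4 z q) ->
  dseries (fun i j => zseries (chain_coef z q 0 i j) * k)
  = zseries (level_coef 4 z q) / (qPochInf z q * qPochInf (q / z) q) * k.
Proof.
  intros Hz Hq0 Hq Hg HK Hr Hd Hs.
  pose proof (qPochInf_neq_0 q q Hq (q_generic_small q Hq)) as N1.
  pose proof (qPochInf_neq_0 z q Hq (bilateral_generic_poch_generic z q Hg)) as N2.
  pose proof (qPochInf_neq_0 (q / z) q Hq (bilateral_generic_poch_generic_inv z q Hz Hq0 Hg)) as N3.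
  destruct (bailey_weight_bounded q z Hz Hq0 Hq Hg) as [B [_ HB]].
  pose proof (weighted_tannery _ (bailey_weight q z) B _ Hs HB (fun r => bailey_weight_cvg q z r Hz Hq0 Hq Hg)) as H1.
  rewrite (chain3_limit z q 0 K rho k (zseries (level_coef 4 z q)
    * (/ qPochInf q q * / qPochInf q q * (/ qPochInf z q * / qPochInf (q / z) q)))); try assumption.
  - field. auto.
  - refine (cvg_ext _ _ _ _ H1). intros M. cbv beta.
    rewrite chain3_0; [|now apply q_generic_small|now apply bilateral_generic_poch_generic_shift].
    rewrite (bailey_symmetric z q M 3 Hz Hq0 Hq Hg). change (Z.of_nat 4) with 4%Z.
    simpl (q ^ (0 * M)). field. split; now apply zpow_neq_0.
Qed.

(** The two summands in the last factor of [lowered_alpha] give one series each in the limit: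
    [1 - a q^s] yields this one and the quotient yields [spin_coef2]. *)
Definition spin_coef1 (z q : C) (r : Z) : C := - z * (zpow z (5 * r) * zpow q (5 * (r * r) + 2 * r)).
Definition spin_coef2 (z q : C) (r : Z) : C := / z * (zpow z (5 * r) * zpow q (5 * (r * r) - 2 * r)).

(** Here [a q^s = z q^(r-M)] is large, so [1 - a q^s] is written [- z q^(r-M) (1 - q^(M-r) / z)];
    the remaining corrections then tend to [1]. *)
Lemma lowered_symmetric (z q : C) (M : nat) : z <> 0 -> q <> 0 -> (Cmod q < 1)%R -> bilateral_generic z q ->
  bailey_sum (z * zpow q (- Z.of_nat (2 * M))) q
    (lowered_alpha (z * zpow q (- Z.of_nat (2 * M))) q) (2 * M)
  = (zpow z (Z.of_nat M) * zpow q (- (Z.of_nat M * Z.of_nat M))) ^ 3 * q ^ (1 * M)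
    * (zsum M (fun r => spin_coef1 z q r * ((1 - zpow q (Z.of_nat M - r) / z) * bailey_weight q z M r))
      + zsum M (fun r => spin_coef2 z q r * ((1 - zpow q (Z.of_nat M + r)) * bailey_weight q z M r))).
Proof.
  intros Hz Hq Hq1 Hg. unfold zsum. rewrite <- csum_plus, <- csum_scal. apply csum_ext. intros s Hs.
  set (a := z * zpow q (- Z.of_nat (2 * M))). unfold lowered_alpha.
  set (r := (Z.of_nat s - Z.of_nat M)%Z).
  pose proof (shifted_unit z q M s r Hz Hq Hq1 Hg ltac:(lia) eq_refl) as E. cbv zeta in E. fold a in E.
  pose proof (shifted_gauss z q M s r Hz Hq eq_refl) as E1. fold a in E1.
  set (m := Z.of_nat M) in *.
  assert (Hs' : Z.of_nat s = (m + r)%Z) by (unfold r; ring).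
  rewrite E1.
  assert (E2 : a * q ^ s = z * zpow q (r - m)).
  { unfold a. rewrite <- zpow_nat, <- Cmult_assoc, <- zpow_add by exact Hq. do 2 f_equal. lia. }
  assert (E3 : a * q ^ (3 * s) = z * zpow q (m + 3 * r)).
  { unfold a. rewrite <- zpow_nat, <- Cmult_assoc, <- zpow_add by exact Hq. do 2 f_equal. lia. }
  assert (E4 : q ^ s = zpow q (m + r)) by (rewrite <- zpow_nat; f_equal; lia).
  assert (E5 : q ^ (2 * s) = zpow q (2 * m + 2 * r)) by (rewrite <- zpow_nat; f_equal; lia).
  assert (E6 : q ^ (1 * M) = zpow q m) by (rewrite <- zpow_nat; f_equal; lia).
  rewrite E3, E5, E6.
  replace (1 - a * q ^ s) with (1 - z * zpow q (r - m)) by (now rewrite E2).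
  replace (1 - q ^ s) with (1 - zpow q (m + r)) by (now rewrite E4).
  transitivity ((zpow z (m + r) * zpow q (r * r - m * m)) ^ 4 * zpow q (2 * m + 2 * r)
    * (1 - z * zpow q (r - m) + (1 - zpow q (m + r)) / (z * zpow q (m + 3 * r)))
    * ((- (1)) ^ s * q ^ triangular s / qPoch q q s
      * (inv_qfact q (2 * M) s / qPoch (a * q ^ s) q (2 * M + 1)))); [unfold Cdiv; ring|].
  rewrite E. unfold spin_coef1, spin_coef2.
  transitivity (((zpow z (m + r) * zpow q (r * r - m * m)) ^ 4
    * (zpow z (r - m) * zpow q (m * m + r * r - r))) * zpow q (2 * m + 2 * r)
    * (1 - z * zpow q (r - m) + (1 - zpow q (m + r)) / (z * zpow q (m + 3 * r))) * bailey_weight q z M r);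
    [ring|].
  replace ((zpow z (m + r) * zpow q (r * r - m * m)) ^ 4
    * (zpow z (r - m) * zpow q (m * m + r * r - r)))
    with ((zpow z m * zpow q (- (m * m))) ^ 3 * (zpow z (5 * r) * zpow q (5 * (r * r) - r))).
  2:{ rewrite <- !zpow_nat. rewrite !(zpow_mult_l (zpow z _)) by (now apply zpow_neq_0).
      rewrite !zpow_zpow by assumption.
      transitivity (zpow z (m * Z.of_nat 3 + 5 * r) * zpow q (- (m * m) * Z.of_nat 3 + (5 * (r * r) - r)));
        [rewrite !zpow_add by assumption; ring|].
      transitivity (zpow z ((m + r) * Z.of_nat 4 + (r - m))
        * zpow q ((r * r - m * m) * Z.of_nat 4 + (m * m + r * r - r)));
        [f_equal; f_equal; lia|rewrite !zpow_add by assumption; ring]. }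
  set (c := (zpow z m * zpow q (- (m * m))) ^ 3).
  transitivity (c * zpow z (5 * r) * bailey_weight q z M r * (zpow q (5 * (r * r) - r) * zpow q (2 * m + 2 * r)
    * (1 - z * zpow q (r - m) + (1 - zpow q (m + r)) / (z * zpow q (m + 3 * r))))); [ring|].
  transitivity (c * zpow z (5 * r) * bailey_weight q z M r * (zpow q m * (- z * zpow q (5 * (r * r) + 2 * r)
    * (1 - zpow q (m - r) / z) + / z * zpow q (5 * (r * r) - 2 * r) * (1 - zpow q (m + r)))));
    [|ring].
  f_equal.
  replace (5 * (r * r) + 2 * r)%Z with (5 * (r * r) - r + 3 * r)%Z by ring.
  replace (5 * (r * r) - 2 * r)%Z with (5 * (r * r) - r - r)%Z by ring.
  replace (2 * m + 2 * r)%Z with (m + m + r + r)%Z by ring.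
  replace (3 * r)%Z with (r + r + r)%Z by ring.
  unfold Z.sub. rewrite ?(zpow_add q _ _ Hq), ?(zpow_opp q _ Hq), ?(zpow_add q _ _ Hq).
  pose proof (zpow_neq_0 q m Hq). pose proof (zpow_neq_0 q r Hq).
  pose proof (zpow_neq_0 q (5 * (r * r)) Hq).
  field. auto.
Qed.

Lemma cvg_pow_0 (q : C) (phi : nat -> nat) : (Cmod q < 1)%R ->
  (forall K, exists N, forall n, (N <= n)%nat -> (K <= phi n)%nat) ->
  cvg (fun n => q ^ phi n) 0.
Proof.
  intros Hq Hphi. apply (cvg_comp (fun n => q ^ n)); [exact Hphi|].
  intros eps He. destruct (pow_small (Cmod q) eps) as [N HN];
    [split; [apply Cmod_ge_0|exact Hq]|exact He|].
  exists N. intros n Hn. replace (q ^ n - 0) with (q ^ n) by ring. rewrite Cmod_pow. auto.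
Qed.

Lemma zpow_corr_cvg (q : C) (r : Z) : (Cmod q < 1)%R ->
  cvg (fun M => zpow q (Z.of_nat M + r)) 0.
Proof.
  intros Hq. eapply cvg_ext_from with (K := Z.to_nat (Z.abs r)).
  2:{ apply (cvg_pow_0 q (fun M => Z.to_nat (Z.of_nat M + r)) Hq).
      intros K. exists (K + Z.to_nat (Z.abs r))%nat. intros; lia. }
  intros M HM. cbv beta. rewrite zpow_pos by lia. reflexivity.
Qed.

(** For [|r| > M] the correction may be huge, but then [bailey_weight] is zero; for [|r| <= M] the
    exponent [M + k] is nonnegative. *)
Lemma corr_bounded (q z x : C) (B : R) (M : nat) (r k : Z) : (Cmod q < 1)%R ->
  (Cmod (bailey_weight q z M r) <= B)%R -> (Z.abs k = Z.abs r)%Z ->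
  (Cmod ((1 - zpow q (Z.of_nat M + k) * x) * bailey_weight q z M r) <= (1 + Cmod x) * B)%R.
Proof.
  intros Hq HB Hk. assert (HB0 : (0 <= B)%R) by (eapply Rle_trans; [apply Cmod_ge_0|exact HB]).
  pose proof (Cmod_ge_0 x) as Hx.
  destruct (Z.leb_spec (Z.abs r) (Z.of_nat M)) as [H|H].
  - rewrite Cmod_mult. apply Rmult_le_compat; auto using Cmod_ge_0.
    eapply Rle_trans; [apply Cmod_triangle|]. rewrite Cmod_1, Cmod_opp, Cmod_mult.
    apply Rplus_le_compat_l. rewrite zpow_pos, Cmod_pow by lia.
    rewrite <- (Rmult_1_l (Cmod x)) at 2. apply Rmult_le_compat_r; [exact Hx|].
    rewrite <- (pow1 (Z.to_nat (Z.of_nat M + k))). apply pow_incr.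
    split; [apply Cmod_ge_0|lra].
  - unfold bailey_weight, inv_qfact_pair. rewrite (proj2 (Z.leb_gt _ _)) by lia.
    rewrite Cmult_0_l, Cmult_0_r, Cmod_0. apply Rmult_le_pos; lra.
Qed.

Lemma level3_spin (z q : C) (K rho : R) (k : C) :
  z <> 0 -> q <> 0 -> (Cmod q < 1)%R -> bilateral_generic z q -> (0 <= K)%R -> (0 < rho < 1)%R ->
  dom3 K rho (chain_coef z q 1) -> zsummable (spin_coef1 z q) -> zsummable (spin_coef2 z q) ->
  dseries (fun i j => zseries (chain_coef z q 1 i j) * k)
  = (zseries (spin_coef1 z q) + zseries (spin_coef2 z q)) / (qPochInf z q * qPochInf (q / z) q) * k.
Proof.
  intros Hz Hq0 Hq Hg HK Hr Hd Hs1 Hs2.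
  pose proof (qPochInf_neq_0 q q Hq (q_generic_small q Hq)) as N1.
  pose proof (qPochInf_neq_0 z q Hq (bilateral_generic_poch_generic z q Hg)) as N2.
  pose proof (qPochInf_neq_0 (q / z) q Hq (bilateral_generic_poch_generic_inv z q Hz Hq0 Hg)) as N3.
  destruct (bailey_weight_bounded q z Hz Hq0 Hq Hg) as [B [_ HB]].
  set (W := / qPochInf q q * / qPochInf q q * (/ qPochInf z q * / qPochInf (q / z) q)).
  assert (H1 : cvg (fun M => zsum M (fun r =>
      spin_coef1 z q r * ((1 - zpow q (Z.of_nat M - r) / z) * bailey_weight q z M r)))
    (zseries (spin_coef1 z q) * W)).
  { apply (weighted_tannery _ (fun M r => (1 - zpow q (Z.of_nat M - r) / z) * bailey_weight q z M r)
      ((1 + Cmod (/ z)) * B) W Hs1).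
    - intros M r. apply corr_bounded; [exact Hq|apply HB|lia].
    - intros r. replace W with ((1 - 0 * / z) * W) by ring.
      apply cvg_mult; [|now apply bailey_weight_cvg].
      apply cvg_minus; [apply cvg_const|]. apply cvg_mult; [|apply cvg_const].
      apply (zpow_corr_cvg q (- r) Hq). }
  assert (H2 : cvg (fun M => zsum M (fun r =>
      spin_coef2 z q r * ((1 - zpow q (Z.of_nat M + r)) * bailey_weight q z M r)))
    (zseries (spin_coef2 z q) * W)).
  { apply (weighted_tannery _ (fun M r => (1 - zpow q (Z.of_nat M + r)) * bailey_weight q z M r)
      ((1 + Cmod 1) * B) W Hs2).
    - intros M r. rewrite <- (Cmult_1_r (zpow q (Z.of_nat M + r))).
      apply corr_bounded; [exact Hq|apply HB|lia].
    - intros r. replace W with ((1 - 0) * W) by ring.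
      apply cvg_mult; [|now apply bailey_weight_cvg].
      apply cvg_minus; [apply cvg_const|]. apply (zpow_corr_cvg q r Hq). }
  rewrite (chain3_limit z q 1 K rho k ((zseries (spin_coef1 z q) * W + zseries (spin_coef2 z q) * W)));
    try assumption.
  - unfold W. field. auto.
  - refine (cvg_ext _ _ _ _ (cvg_plus _ _ _ _ H1 H2)). intros M. cbv beta.
    rewrite chain3_1;
      [|apply Cmult_neq_0; [exact Hz|now apply zpow_neq_0]|exact Hq0|now apply q_generic_small|now apply bilateral_generic_poch_generic_shift].
    rewrite (lowered_symmetric z q M Hz Hq0 Hq Hg).
    pose proof (Cpow_nz q (1 * M) Hq0). field. repeat split; auto; now apply zpow_neq_0.
Qed.

(** * Specialisation to z = -p^e and base p^3 *)

Definition signed_gauss (p : C) (a b c n : Z) : C := zpow (- (1)) n * zpow p (a * (n * n) + b * n + c).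

Lemma zsummable_signed_gauss (p : C) (a b c : Z) : p <> 0 -> (Cmod p < 1)%R -> (0 < a)%Z ->
  zsummable (signed_gauss p a b c).
Proof.
  intros Hp Hp1 Ha. apply (zsummable_theta p _ _ ((Z.abs b + 1) * (Z.abs b + 1) + Z.abs c)); try assumption.
  - intros n. rewrite Cmod_zpow_m1. lra.
  - intros n. set (B := (Z.abs b + 1)%Z).
    assert (H1 : (- (Z.abs b * Z.abs n) <= b * n)%Z) by (rewrite <- Z.abs_mul; lia).
    assert (H3 : (n * n <= a * (n * n))%Z) by nia.
    assert (H5 : (n * n = Z.abs n * Z.abs n)%Z) by nia.
    assert (H6 : (0 <= Z.abs n * Z.abs n - B * Z.abs n + B * B)%Z) by nia.
    unfold B in *. lia.
Qed.

Lemma signed_gauss_shift_const (p : C) (a b c d n : Z) : p <> 0 ->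
  signed_gauss p a b (c + d) n = zpow p d * signed_gauss p a b c n.
Proof.
  intros Hp. unfold signed_gauss. rewrite Z.add_assoc, (zpow_add p _ d) by exact Hp. ring.
Qed.

Lemma zseries_signed_gauss_const (p : C) (a b c d : Z) : p <> 0 -> (Cmod p < 1)%R -> (0 < a)%Z ->
  zseries (signed_gauss p a b (c + d)) = zpow p d * zseries (signed_gauss p a b c).
Proof.
  intros Hp Hp1 Ha. rewrite <- zseries_scal by now apply zsummable_signed_gauss.
  apply zseries_ext. intros n. now apply signed_gauss_shift_const.
Qed.

Lemma zpow_m1_opp (n : Z) : zpow (- (1)) (- n) = zpow (- (1)) n.
Proof. apply (zpow_m1_parity _ _ (- n)). ring. Qed.

Lemma zseries_signed_gauss_opp (p : C) (a b c : Z) : p <> 0 -> (Cmod p < 1)%R -> (0 < a)%Z ->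
  zseries (signed_gauss p a (- b) c) = zseries (signed_gauss p a b c).
Proof.
  intros Hp Hp1 Ha. rewrite <- (zseries_opp_index (signed_gauss p a b c)) by now apply zsummable_signed_gauss.
  apply zseries_ext. intros n. unfold signed_gauss. rewrite zpow_m1_opp. do 2 f_equal. ring.
Qed.

Lemma zseries_signed_gauss_succ (p : C) (a b c : Z) : p <> 0 -> (Cmod p < 1)%R -> (0 < a)%Z ->
  zseries (signed_gauss p a b c) = - zseries (signed_gauss p a (2 * a + b) (a + b + c)).
Proof.
  intros Hp Hp1 Ha. rewrite <- (zseries_succ (signed_gauss p a b c)) by now apply zsummable_signed_gauss.
  replace (- zseries (signed_gauss p a (2 * a + b) (a + b + c)))
    with (- (1) * zseries (signed_gauss p a (2 * a + b) (a + b + c))) by ring.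
  rewrite <- zseries_scal by now apply zsummable_signed_gauss.
  apply zseries_ext. intros n. unfold signed_gauss. rewrite zpow_add, zpow_1_r by apply m1_neq_0.
  replace (a * ((n + 1) * (n + 1)) + b * (n + 1) + c)%Z
    with (a * (n * n) + (2 * a + b) * n + (a + b + c))%Z by ring. ring.
Qed.

Lemma theta_signed_gauss (p : C) (f e n : Z) : theta p (2 * f) e n = signed_gauss p f (e - f) 0 n.
Proof.
  unfold theta, signed_gauss. do 2 f_equal. pose proof (half_consecutive n) as H.
  replace (2 * f * (n * (n - 1) / 2))%Z with (f * (2 * (n * (n - 1) / 2)))%Z by ring.
  rewrite H. ring.
Qed.

Lemma zpow_neg_zpow (p : C) (e n : Z) : p <> 0 ->
  zpow (- zpow p e) n = zpow (- (1)) n * zpow p (e * n).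
Proof.
  intros Hp. replace (- zpow p e) with (- (1) * zpow p e) by ring.
  rewrite zpow_mult_l, zpow_zpow by auto using m1_neq_0, zpow_neq_0. reflexivity.
Qed.

Lemma zpow_pow (p : C) (f : nat) (n : Z) : p <> 0 -> zpow (p ^ f) n = zpow p (Z.of_nat f * n).
Proof. intros Hp. now rewrite <- (zpow_nat p f), zpow_zpow. Qed.

(** The factor [2 h + 1] is odd, so the sign [(-1)^((2h+1) r)] is just [(-1)^r]; the two series come
    from the two terms of [1 - z q^(2r)]. *)
Lemma level_coef_signed_gauss (p : C) (h e : Z) (f : nat) (r : Z) : p <> 0 ->
  level_coef (2 * h) (- zpow p e) (p ^ f) r
  = signed_gauss p ((2 * h + 1) * Z.of_nat f) ((2 * h + 1) * e - Z.of_nat f) 0 r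
    + signed_gauss p ((2 * h + 1) * Z.of_nat f) ((2 * h + 1) * e + Z.of_nat f) e r.
Proof.
  intros Hp. unfold level_coef, signed_gauss. rewrite zpow_neg_zpow, !zpow_pow by exact Hp.
  rewrite (zpow_m1_parity ((2 * h + 1) * r) r (h * r)) by ring.
  replace ((2 * h + 1) * Z.of_nat f * (r * r) + ((2 * h + 1) * e - Z.of_nat f) * r + 0)%Z
    with (e * ((2 * h + 1) * r) + Z.of_nat f * ((2 * h + 1) * (r * r) - r))%Z by ring.
  replace ((2 * h + 1) * Z.of_nat f * (r * r) + ((2 * h + 1) * e + Z.of_nat f) * r + e)%Z
    with (e * ((2 * h + 1) * r) + Z.of_nat f * ((2 * h + 1) * (r * r) - r)
      + (e + Z.of_nat f * (2 * r)))%Z by ring.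
  rewrite !(zpow_add p _ _ Hp). ring.
Qed.

Lemma zseries_level_coef (p : C) (h e : Z) (f : nat) : p <> 0 -> (Cmod p < 1)%R ->
  (0 <= h)%Z -> (0 < f)%nat ->
  zsummable (level_coef (2 * h) (- zpow p e) (p ^ f)) /\
  zseries (level_coef (2 * h) (- zpow p e) (p ^ f))
  = zseries (signed_gauss p ((2 * h + 1) * Z.of_nat f) ((2 * h + 1) * e - Z.of_nat f) 0)
    + zseries (signed_gauss p ((2 * h + 1) * Z.of_nat f) ((2 * h + 1) * e + Z.of_nat f) e).
Proof.
  intros Hp Hp1 Hh Hf.
  assert (Ha : (0 < (2 * h + 1) * Z.of_nat f)%Z) by nia.
  split.
  - eapply zsummable_ext; [intros r; symmetry; now apply level_coef_signed_gauss|].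
    apply zsummable_plus; now apply zsummable_signed_gauss.
  - rewrite <- zseries_plus by now apply zsummable_signed_gauss.
    apply zseries_ext. intros r. now apply level_coef_signed_gauss.
Qed.

(** Where the exponent vanishes the factor is [1 + 1]; elsewhere [p^(e + f k)] does not have modulus
    [1]. *)
Lemma bilateral_generic_neg_zpow (p : C) (e : Z) (f : nat) : p <> 0 -> (Cmod p < 1)%R ->
  (e = 0%Z \/ forall k, (e + Z.of_nat f * k <> 0)%Z) -> (0 < f)%nat ->
  bilateral_generic (- zpow p e) (p ^ f).
Proof.
  intros Hp Hp1 He Hf k. rewrite zpow_pow by exact Hp.
  replace (1 - - zpow p e * zpow p (Z.of_nat f * k)) with (1 - - zpow p (e + Z.of_nat f * k))
    by (rewrite zpow_add by exact Hp; ring).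
  destruct (Z.eq_dec (e + Z.of_nat f * k) 0) as [E|E].
  - rewrite E. simpl. replace (1 - - (1)) with (RtoC 2) by (rewrite <- RtoC_opp, <- RtoC_minus; f_equal; ring).
    intros H. apply RtoC_inj in H. lra.
  - apply one_minus_neq_0_Cmod. rewrite Cmod_opp. now apply zpow_neq_1.
Qed.

(** For [e = 1] the linear form is [i + 2 j], that of S_3 with [i] and [j] exchanged, because this
    is how [3 N3 = m - i - 2 j] produces it. Integer exponents avoid truncated subtraction. *)
Definition nahm_term (p : C) (e i j : nat) : C :=
  zpow p (2 * Z.of_nat i * Z.of_nat i + 2 * Z.of_nat i * Z.of_nat j + 2 * Z.of_nat j * Z.of_nat j
    - Z.of_nat e * (Z.of_nat i + 2 * Z.of_nat j))
  / (qPoch (p ^ 3) (p ^ 3) i * qPoch (p ^ 3) (p ^ 3) j).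

Lemma q_generic_cube (p : C) : (Cmod p < 1)%R -> q_generic (p ^ 3).
Proof. intros Hp. apply q_generic_small, Cmod_pow_lt_1; [exact Hp|lia]. Qed.

(* With [m = N1 + N2 + N3], [i = N1 - N2], [j = N2 - N3]:
   [3 (N1^2 + N2^2 + N3^2) = m^2 + 2 i^2 + 2 i j + 2 j^2] and [3 N3 = m - i - 2 j]. *)
Lemma chain_coef_split (p : C) (e : Z) (eps i j : nat) (N : Z) : p <> 0 -> (Cmod p < 1)%R ->
  chain_coef (- zpow p e) (p ^ 3) eps i j N
  = nahm_term p eps i j * signed_gauss p 1 (e + Z.of_nat eps) 0 (3 * N + (Z.of_nat i - Z.of_nat j)).
Proof.
  intros Hp Hp1. unfold chain_coef, gauss, nahm_term, signed_gauss.
  rewrite !zpow_neg_zpow, !zpow_pow by exact Hp. change (Z.of_nat 3) with 3%Z.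
  set (I := Z.of_nat i). set (J := Z.of_nat j). set (E := Z.of_nat eps).
  pose proof (q_generic_qPoch (p ^ 3) i (q_generic_cube p Hp1)) as N1.
  pose proof (q_generic_qPoch (p ^ 3) j (q_generic_cube p Hp1)) as N2.
  transitivity (/ qPoch (p ^ 3) (p ^ 3) i * / qPoch (p ^ 3) (p ^ 3) j *
    (zpow (- (1)) (N + I + N + (N - J)) *
     zpow p (e * (N + I) + 3 * ((N + I) * (N + I)) + (e * N + 3 * (N * N))
       + (e * (N - J) + 3 * ((N - J) * (N - J)) + 3 * (E * (N - J)))))).
  { rewrite !(zpow_add p _ _ Hp), !(zpow_add (- (1)) _ _ m1_neq_0).
    unfold Z.sub. rewrite !(zpow_add (- (1)) _ _ m1_neq_0). ring. }
  replace (N + I + N + (N - J))%Z with (3 * N + (I - J))%Z by ring.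
  replace (e * (N + I) + 3 * ((N + I) * (N + I)) + (e * N + 3 * (N * N))
       + (e * (N - J) + 3 * ((N - J) * (N - J)) + 3 * (E * (N - J))))%Z
    with (2 * I * I + 2 * I * J + 2 * J * J - E * (I + 2 * J)
      + (1 * ((3 * N + (I - J)) * (3 * N + (I - J))) + (e + E) * (3 * N + (I - J)) + 0))%Z by ring.
  rewrite (zpow_add p (2 * I * I + 2 * I * J + 2 * J * J - E * (I + 2 * J))) by exact Hp.
  field. auto.
Qed.

Lemma inv_pair_bounded (p : C) : (Cmod p < 1)%R -> exists B : R, (0 < B)%R /\
  forall i j, (Cmod (/ (qPoch (p ^ 3) (p ^ 3) i * qPoch (p ^ 3) (p ^ 3) j)) <= B)%R.
Proof.
  intros Hp1. assert (H3 : (Cmod (p ^ 3) < 1)%R) by (apply Cmod_pow_lt_1; [exact Hp1|lia]).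
  destruct (inv_qPoch_bounded _ _ H3 (q_generic_cube p Hp1)) as [B [HB H]].
  exists (B * B)%R. split; [now apply Rmult_lt_0_compat|]. intros i j.
  replace (/ (qPoch (p ^ 3) (p ^ 3) i * qPoch (p ^ 3) (p ^ 3) j))
    with (/ qPoch (p ^ 3) (p ^ 3) i * / qPoch (p ^ 3) (p ^ 3) j)
    by (field; split; now apply q_generic_qPoch, q_generic_cube).
  rewrite Cmod_mult. apply Rmult_le_compat; auto using Cmod_ge_0.
Qed.

Lemma nahm_term_signed_gauss_dom (p : C) (b : Z) (eps : nat) : p <> 0 -> (Cmod p < 1)%R ->
  (eps <= 1)%nat -> (Z.abs b <= 1)%Z -> exists K : R, (0 <= K)%R /\
  dom3 K (Cmod p) (fun i j N =>
    nahm_term p eps i j * signed_gauss p 1 b 0 (3 * N + (Z.of_nat i - Z.of_nat j))).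
Proof.
  intros Hp Hp1 He Hb. assert (Hp0 : (0 < Cmod p)%R) by now apply Cmod_gt_0.
  destruct (inv_pair_bounded p Hp1) as [B [HB H]].
  (* [5 = 4 + 1]: the form in [i] and [j] is at least [2 i + 2 j - 4], and
     [m^2 + b m >= |m| - 1]. *)
  exists (B * (/ Cmod p) ^ 5)%R. split.
  { apply Rmult_le_pos; [lra|]. left. apply pow_lt. now apply Rinv_0_lt_compat. }
  intros i j N. unfold nahm_term, signed_gauss.
  set (I := Z.of_nat i). set (J := Z.of_nat j). set (m := (3 * N + (I - J))%Z).
  set (Y := / (qPoch (p ^ 3) (p ^ 3) i * qPoch (p ^ 3) (p ^ 3) j)).
  set (X := (2 * I * I + 2 * I * J + 2 * J * J - Z.of_nat eps * (I + 2 * J))%Z).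
  replace (zpow p X / (qPoch (p ^ 3) (p ^ 3) i * qPoch (p ^ 3) (p ^ 3) j)
      * (zpow (- (1)) m * zpow p (1 * (m * m) + b * m + 0)))
    with (Y * (zpow (- (1)) m * zpow p (X + (m * m + b * m)))).
  2:{ rewrite zpow_add by exact Hp. replace (1 * (m * m) + b * m + 0)%Z with (m * m + b * m)%Z by ring.
      unfold Y, Cdiv. ring. }
  rewrite !Cmod_mult, Cmod_zpow_m1, Rmult_1_l, !Rmult_assoc.
  apply Rmult_le_compat; try apply Cmod_ge_0; [apply H|].
  rewrite <- !pow_add.
  replace (i + (j + Z.abs_nat N))%nat with (Z.abs_nat (I + J + Z.abs N)) by (unfold I, J; lia).
  apply Cmod_zpow_le; try assumption. change (Z.of_nat 5) with 5%Z.
  assert (HI : (0 <= I)%Z) by (unfold I; lia). assert (HJ : (0 <= J)%Z) by (unfold J; lia).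
  assert (Hm : (Z.abs m - 1 <= m * m + b * m)%Z).
  { assert ((Z.abs m - 1) * (Z.abs m - 1) >= 0)%Z by nia.
    assert (- Z.abs m <= b * m)%Z by (assert (Z.abs (b * m) <= 1 * Z.abs m)%Z
      by (rewrite Z.abs_mul; apply Z.mul_le_mono_nonneg_r; lia); lia).
    assert (m * m = Z.abs m * Z.abs m)%Z by nia. lia. }
  assert (HX : (2 * I + 2 * J - 4 <= X)%Z).
  { unfold X. assert (0 <= Z.of_nat eps <= 1)%Z by lia.
    assert (Z.of_nat eps * (I + 2 * J) <= 1 * (I + 2 * J))%Z by (apply Z.mul_le_mono_nonneg_r; lia).
    assert (0 <= I * J)%Z by nia. assert (0 <= 2 * I * I - 3 * I + 2)%Z by nia.
    assert (0 <= 2 * J * J - 4 * J + 2)%Z by nia. lia. }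
  unfold m in *. lia.
Qed.

(** * Theta series restricted to a residue class mod 3 *)

Lemma residue_theta_summable (p : C) (b d : Z) : p <> 0 -> (Cmod p < 1)%R ->
  zsummable (fun N => signed_gauss p 1 b 0 (3 * N + d)).
Proof.
  intros Hp Hp1.
  apply (zsummable_ext (fun N => zpow (- (1)) d * signed_gauss p 9 (6 * d + 3 * b) (d * d + b * d) N)).
  - intros N. unfold signed_gauss.
    rewrite (zpow_m1_parity (3 * N + d) (N + d) N) by ring. rewrite (zpow_add (- (1))) by apply m1_neq_0.
    replace (1 * ((3 * N + d) * (3 * N + d)) + b * (3 * N + d) + 0)%Z
      with (9 * (N * N) + (6 * d + 3 * b) * N + (d * d + b * d))%Z by ring. ring.
  - destruct (zsummable_signed_gauss p 9 (6 * d + 3 * b) (d * d + b * d) Hp Hp1 ltac:(lia))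
      as [K [rho [HK [Hr H]]]].
    exists K, rho. split; [exact HK|]. split; [exact Hr|]. intros n.
    rewrite Cmod_mult, Cmod_zpow_m1, Rmult_1_l. apply H.
Qed.

Definition residue_theta (p : C) (b d : Z) : C := zseries (fun N => signed_gauss p 1 b 0 (3 * N + d)).

Lemma residue_theta_3 (p : C) (b d : Z) : p <> 0 -> (Cmod p < 1)%R -> residue_theta p b (d + 3) = residue_theta p b d.
Proof.
  intros Hp Hp1. unfold residue_theta.
  rewrite <- (zseries_succ (fun N => signed_gauss p 1 b 0 (3 * N + d))) by now apply residue_theta_summable.
  apply zseries_ext. intros n. f_equal. ring.
Qed.

Lemma residue_theta_mod (p : C) (b d : Z) : p <> 0 -> (Cmod p < 1)%R -> residue_theta p b d = residue_theta p b (d mod 3).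
Proof.
  intros Hp Hp1.
  assert (H : forall k d, residue_theta p b (d + 3 * Z.of_nat k) = residue_theta p b d).
  { induction k as [|k IH]; intros x; [f_equal; lia|].
    replace (x + 3 * Z.of_nat (S k))%Z with (x + 3 * Z.of_nat k + 3)%Z by lia.
    now rewrite residue_theta_3, IH. }
  pose proof (Z.div_mod d 3 ltac:(lia)) as E.
  destruct (Z.le_gt_cases 0 (d / 3)) as [Hs|Hs].
  - rewrite <- (H (Z.to_nat (d / 3)) (d mod 3)%Z). f_equal. lia.
  - rewrite <- (H (Z.to_nat (- (d / 3))) d). f_equal. lia.
Qed.

Lemma self_opp_0 (x : C) : x = - x -> x = 0.
Proof.
  intros H. apply Cmod_eq_0. assert (E : x + x = 0) by (rewrite H at 2; ring).
  assert (E2 : RtoC 2 * x = 0) by (transitivity (x + x); [ring|exact E]).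
  apply (f_equal Cmod) in E2. rewrite Cmod_mult, Cmod_0, Cmod_R, Rabs_pos_eq in E2 by lra. lra.
Qed.

(** [m -> -b - m] leaves [m^2 + b m] fixed and, [b] being odd, changes the sign [(-1)^m]; it sends
    the class of [d] to that of [-b - d]. *)
Lemma residue_theta_reflect (p : C) (b d d' : Z) : p <> 0 -> (Cmod p < 1)%R ->
  (b = 1 \/ b = -1)%Z -> (d' = 3 - b - d)%Z -> residue_theta p b d' = - residue_theta p b d.
Proof.
  intros Hp Hp1 Hb ->. unfold residue_theta.
  replace (- zseries (fun N => signed_gauss p 1 b 0 (3 * N + d)))
    with (- (1) * zseries (fun N => signed_gauss p 1 b 0 (3 * N + d))) by ring.
  rewrite <- zseries_scal by now apply residue_theta_summable.
  rewrite <- (zseries_reflect (fun n => - (1) * signed_gauss p 1 b 0 (3 * n + d))).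
  apply zseries_ext. intros n. unfold signed_gauss.
  replace (1 * ((3 * n + (3 - b - d)) * (3 * n + (3 - b - d))) + b * (3 * n + (3 - b - d)) + 0)%Z
    with (1 * ((3 * (-1 - n) + d) * (3 * (-1 - n) + d)) + b * (3 * (-1 - n) + d) + 0)%Z by ring.
  replace (zpow (- (1)) (3 * n + (3 - b - d))) with (- (1) * zpow (- (1)) (3 * (-1 - n) + d)); [ring|].
  rewrite <- (zpow_1_r (- (1))) at 1. rewrite <- zpow_add by apply m1_neq_0.
  destruct Hb as [-> | ->].
  - apply (zpow_m1_parity _ _ (-3 * n - 2 + d)). ring.
  - apply (zpow_m1_parity _ _ (-3 * n - 3 + d)). ring.
Qed.

(** The values of [residue_theta p b] divided by the one at [0]; there [c] is the class of [-b],
    equal to [2] for [b = 1] and to [1] for [b = -1]. *)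
Definition residue_sign (c d : Z) : C :=
  if Z.eqb (d mod 3) 0 then 1 else if Z.eqb (d mod 3) c then - (1) else 0.

Lemma residue_theta_residue_sign_pos (p : C) (d : Z) : p <> 0 -> (Cmod p < 1)%R -> residue_theta p 1 d = residue_sign 2 d * residue_theta p 1 0.
Proof.
  intros Hp Hp1. rewrite residue_theta_mod by assumption. unfold residue_sign.
  pose proof (Z.mod_pos_bound d 3 ltac:(lia)) as Hd.
  assert (E : (d mod 3 = 0 \/ d mod 3 = 1 \/ d mod 3 = 2)%Z) by lia.
  destruct E as [-> | [-> | ->]]; simpl Z.eqb; cbv iota.
  - ring.
  - rewrite (self_opp_0 (residue_theta p 1 1)); [ring|]. apply (residue_theta_reflect p 1 1 1); auto.
  - rewrite (residue_theta_reflect p 1 0 2); auto. ring.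
Qed.

Lemma residue_theta_residue_sign_neg (p : C) (d : Z) : p <> 0 -> (Cmod p < 1)%R ->
  residue_theta p (-1) d = residue_sign 1 d * residue_theta p (-1) 0.
Proof.
  intros Hp Hp1. rewrite residue_theta_mod by assumption. unfold residue_sign.
  pose proof (Z.mod_pos_bound d 3 ltac:(lia)) as Hd.
  assert (E : (d mod 3 = 0 \/ d mod 3 = 1 \/ d mod 3 = 2)%Z) by lia.
  destruct E as [-> | [-> | ->]]; simpl Z.eqb; cbv iota.
  - ring.
  - rewrite <- (residue_theta_3 p (-1) 1) by assumption.
    rewrite (residue_theta_reflect p (-1) 0 (1 + 3)); auto. ring.
  - rewrite (self_opp_0 (residue_theta p (-1) 2)); [ring|]. apply (residue_theta_reflect p (-1) 2 2); auto.
Qed.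

(** Multiples of 3 give [(-1)^n p^(9 n^2 + 3 b n)], Euler's pentagonal series in base [p^6]. Its
    triple product [(p^6, p^12, p^18; p^18)_oo] is reassembled by [qPochInf_multisect]. *)
Lemma residue_theta_0 (p : C) (b : Z) : p <> 0 -> (Cmod p < 1)%R -> (b = 1 \/ b = -1)%Z ->
  residue_theta p b 0 = qPochInf (p ^ 6) (p ^ 6).
Proof.
  intros Hp Hp1 Hb.
  transitivity (zseries (signed_gauss p 9 3 0)).
  - transitivity (zseries (signed_gauss p 9 (3 * b) 0)).
    + unfold residue_theta. apply zseries_ext. intros n. unfold signed_gauss.
      rewrite (zpow_m1_parity (3 * n + 0) n n) by ring. do 2 f_equal. ring.
    + destruct Hb as [-> | ->]; [reflexivity|]. change (3 * -1)%Z with (- (3))%Z.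
      apply zseries_signed_gauss_opp; [assumption|assumption|lia].
  - transitivity (zseries (theta p (Z.of_nat 18) (Z.of_nat 12))).
    + apply zseries_ext. intros n. change (Z.of_nat 18) with (2 * 9)%Z. now rewrite theta_signed_gauss.
    + rewrite jacobi_triple by (try assumption; lia).
      rewrite (qPochInf_multisect (p ^ 6) (p ^ 6) 3); [|apply Cmod_pow_lt_1; [exact Hp1|lia]|lia].
      cbn [cprod]. rewrite <- !Cpow_mult_r, <- !Cpow_add_r. simpl Nat.add. simpl Nat.mul. simpl Nat.sub. ring.
Qed.

(** * The two product evaluations *)

Lemma residue_theta_0_neq_0 (p : C) (b : Z) : p <> 0 -> (Cmod p < 1)%R -> (b = 1 \/ b = -1)%Z ->
  residue_theta p b 0 <> 0.
Proof.
  intros Hp Hp1 Hb. rewrite residue_theta_0 by assumption.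
  assert (H6 : (Cmod (p ^ 6) < 1)%R) by (apply Cmod_pow_lt_1; [exact Hp1|lia]).
  apply qPochInf_neq_0; [exact H6|now apply q_generic_small].
Qed.

Lemma dseries_ext (f g : nat -> nat -> C) : (forall i j, f i j = g i j) -> dseries f = dseries g.
Proof.
  intros H. apply cseries_ext. intros i. apply cseries_ext. intros j. apply H.
Qed.

Definition class_sum (p : C) (eps : nat) (c : Z) : C :=
  dseries (fun i j => nahm_term p eps i j * residue_sign c (Z.of_nat i - Z.of_nat j)).

(** For fixed [i] and [j] the sum over [N] runs through one residue class of [m = 3 N + i - j], so
    it is [nahm_term] times a residue theta, which is [residue_sign] times the one at [0]. *)
Lemma class_sum_chain (p : C) (e c b : Z) (eps : nat) : p <> 0 -> (Cmod p < 1)%R ->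
  (b = e + Z.of_nat eps)%Z -> (b = 1 \/ b = -1)%Z ->
  (forall d, residue_theta p b d = residue_sign c d * residue_theta p b 0) ->
  class_sum p eps c
  = dseries (fun i j => zseries (chain_coef (- zpow p e) (p ^ 3) eps i j) * / residue_theta p b 0).
Proof.
  intros Hp Hp1 Hb Hb1 Hchi. apply dseries_ext. intros i j.
  replace (zseries (chain_coef (- zpow p e) (p ^ 3) eps i j))
    with (nahm_term p eps i j * residue_theta p b (Z.of_nat i - Z.of_nat j)).
  - rewrite Hchi. field. now apply residue_theta_0_neq_0.
  - unfold residue_theta. rewrite <- zseries_scal by now apply residue_theta_summable.
    apply zseries_ext. intros N. rewrite chain_coef_split by assumption. now rewrite Hb.
Qed.

Lemma chain_coef_dom (p : C) (e : Z) (eps : nat) : p <> 0 -> (Cmod p < 1)%R ->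
  (eps <= 1)%nat -> (Z.abs (e + Z.of_nat eps) <= 1)%Z ->
  exists K : R, (0 <= K)%R /\ dom3 K (Cmod p) (chain_coef (- zpow p e) (p ^ 3) eps).
Proof.
  intros Hp Hp1 He Hb.
  destruct (nahm_term_signed_gauss_dom p (e + Z.of_nat eps) eps Hp Hp1 He Hb) as [K [HK H]].
  exists K. split; [exact HK|]. intros i j N. rewrite chain_coef_split by assumption. apply H.
Qed.

Lemma qPochInf_S_l (a q : C) : (Cmod q < 1)%R -> qPochInf a q = (1 - a) * qPochInf (a * q) q.
Proof.
  intros Hq. apply qPochInf_eq. apply cvg_ext_from with (fun n => (1 - a) * qPoch (a * q) q (n - 1)) 1%nat.
  - intros n Hn. rewrite <- qPoch_S_l. f_equal. lia.
  - apply cvg_scal. apply (cvg_comp (qPoch (a * q) q) _ (fun n => (n - 1)%nat)).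
    + intros K. exists (K + 1)%nat. intros; lia.
    + now apply qPoch_cvg.
Qed.

Lemma qPochInf_double (p : C) (a b : nat) : (Cmod p < 1)%R -> (0 < b)%nat ->
  qPochInf (p ^ (2 * a)) (p ^ (2 * b)) = qPochInf (p ^ a) (p ^ b) * qPochInf (- p ^ a) (p ^ b).
Proof.
  intros Hp Hb. rewrite <- qPochInf_sqr by now apply Cmod_pow_lt_1.
  rewrite <- !Cpow_mult_r, !(Nat.mul_comm 2). reflexivity.
Qed.

(** Both sides are [(-p;p)_oo], dissected mod 5 and mod 3. This removes all products with negative
    argument from the final evaluations. *)
Lemma qPochInf_neg_5_3 (p : C) : (Cmod p < 1)%R ->
  qPochInf (- p ^ 1) (p ^ 5) * qPochInf (- p ^ 2) (p ^ 5) * qPochInf (- p ^ 3) (p ^ 5)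
    * qPochInf (- p ^ 4) (p ^ 5) * qPochInf (- p ^ 5) (p ^ 5)
  = qPochInf (- p ^ 1) (p ^ 3) * qPochInf (- p ^ 2) (p ^ 3) * qPochInf (- p ^ 3) (p ^ 3).
Proof.
  intros Hp.
  assert (H : forall n, - p * p ^ n = - p ^ S n) by (intros; rewrite Cpow_S; ring).
  transitivity (qPochInf (- p) p).
  - rewrite (qPochInf_multisect (- p) p 5) by (auto; lia). cbn [cprod]. rewrite !H. ring.
  - rewrite (qPochInf_multisect (- p) p 3) by (auto; lia). cbn [cprod]. rewrite !H. ring.
Qed.

Lemma neg_pow_gen (p : C) (a b : nat) : p <> 0 -> (Cmod p < 1)%R -> (0 < a)%nat ->
  poch_generic (- p ^ a) (p ^ b).
Proof.
  intros Hp Hp1 Ha k. apply one_minus_neq_0.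
  replace (- p ^ a * (p ^ b) ^ k) with (- p ^ (a + b * k)) by (rewrite Cpow_add_r, Cpow_mult_r; ring).
  rewrite Cmod_opp. apply Cmod_pow_lt_1; [exact Hp1|lia].
Qed.

Lemma pow_gen (p : C) (a b : nat) : (Cmod p < 1)%R -> (0 < a)%nat ->
  poch_generic (p ^ a) (p ^ b).
Proof.
  intros Hp1 Ha k. apply one_minus_neq_0.
  rewrite <- Cpow_mult_r, <- Cpow_add_r. apply Cmod_pow_lt_1; [exact Hp1|lia].
Qed.

(** Only one factor moves: [1 + p^(-e) = p^(-e) (1 + p^e)], and [1 + p^e] completes the other
    product. *)
Lemma neg_inv_pochs (p : C) (e f : nat) : p <> 0 -> (Cmod p < 1)%R -> (0 < e < f)%nat ->
  qPochInf (- zpow p (- Z.of_nat e)) (p ^ f) * qPochInf (p ^ f / - zpow p (- Z.of_nat e)) (p ^ f)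
  = / p ^ e * (qPochInf (- p ^ (f - e)) (p ^ f) * qPochInf (- p ^ e) (p ^ f)).
Proof.
  intros Hp Hp1 He. pose proof (Cpow_nz p e Hp) as Hpe.
  assert (Hf : (Cmod (p ^ f) < 1)%R) by (apply Cmod_pow_lt_1; [exact Hp1|lia]).
  rewrite zpow_opp, zpow_nat by exact Hp.
  rewrite (qPochInf_S_l (- / p ^ e) (p ^ f)) by exact Hf.
  rewrite (qPochInf_S_l (- p ^ e) (p ^ f)) by exact Hf.
  replace (- / p ^ e * p ^ f) with (- p ^ (f - e)).
  2:{ replace f with (f - e + e)%nat at 2 by lia. rewrite Cpow_add_r. field. exact Hpe. }
  replace (p ^ f / - / p ^ e) with (- p ^ e * p ^ f) by (field; auto).
  field. exact Hpe.
Qed.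

Lemma vacuum_class_sum (p : C) : p <> 0 -> (Cmod p < 1)%R ->
  class_sum p 0 2 * qPochInf (p ^ 3) (p ^ 3) = zseries (theta p 5 2).
Proof.
  intros Hp Hp1.
  assert (H3 : (Cmod (p ^ 3) < 1)%R) by (apply Cmod_pow_lt_1; [exact Hp1|lia]).
  assert (H5 : (Cmod (p ^ 5) < 1)%R) by (apply Cmod_pow_lt_1; [exact Hp1|lia]).
  assert (Hp3 : p ^ 3 <> 0) by now apply Cpow_nz.
  assert (Hp5 : p ^ 5 <> 0) by now apply Cpow_nz.
  assert (Hz : forall e, - zpow p e <> 0).
  { intros e H. apply (zpow_neq_0 p e Hp). replace (zpow p e) with (- - zpow p e) by ring. rewrite H. ring. }
  destruct (chain_coef_dom p 1 0 Hp Hp1 ltac:(lia) ltac:(simpl; lia)) as [K [HK Hd]].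
  destruct (zseries_level_coef p 2 1 3 Hp Hp1 ltac:(lia) ltac:(lia)) as [Hs4 E4].
  destruct (zseries_level_coef p 1 (-1) 5 Hp Hp1 ltac:(lia) ltac:(lia)) as [Hs2 E2].
  simpl Z.mul in Hs4, E4, Hs2, E2. simpl Z.add in E4, E2. simpl Z.sub in E4, E2.
  assert (Hg4 : bilateral_generic (- zpow p 1) (p ^ 3)) by (apply bilateral_generic_neg_zpow; try assumption; [right; lia|lia]).
  assert (Hg2 : bilateral_generic (- zpow p (-1)) (p ^ 5)) by (apply bilateral_generic_neg_zpow; try assumption; [right; lia|lia]).
  assert (Hp0 : (0 < Cmod p)%R) by now apply Cmod_gt_0.
  pose proof (residue_theta_0_neq_0 p 1 Hp Hp1 (or_introl eq_refl)) as Ht.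
  rewrite (class_sum_chain p 1 2 1 0 Hp Hp1 eq_refl (or_introl eq_refl)) by (intros; now apply residue_theta_residue_sign_pos).
  rewrite (level3_vacuum (- zpow p 1) (p ^ 3) K (Cmod p)) by (auto; lra).
  assert (Et : zseries (fun n => zpow (- zpow p (-1)) n * zpow (p ^ 5) (n * n))
    = zseries (theta p (Z.of_nat 10) (Z.of_nat 4))).
  { apply zseries_ext. intros n. change (Z.of_nat 10) with (2 * 5)%Z. rewrite theta_signed_gauss.
    unfold signed_gauss. rewrite zpow_neg_zpow, zpow_pow by exact Hp.
    change (Z.of_nat 5) with 5%Z. change (Z.of_nat 4) with 4%Z.
    rewrite <- Cmult_assoc, <- zpow_add by exact Hp. do 2 f_equal. ring. }
  assert (Hst : zsummable (fun n => zpow (- zpow p (-1)) n * zpow (p ^ 5) (n * n))).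
  { apply (zsummable_ext (signed_gauss p 5 (-1) 0)); [|apply zsummable_signed_gauss; [assumption|assumption|lia]].
    intros n. unfold signed_gauss. rewrite zpow_neg_zpow, zpow_pow by exact Hp.
    change (Z.of_nat 5) with 5%Z.
    rewrite <- Cmult_assoc, <- zpow_add by exact Hp. do 2 f_equal. ring. }
  pose proof (quintuple (- zpow p (-1)) (p ^ 5) (Hz _) Hp5 H5 Hg2 Hs2 Hst) as EQ.
  rewrite Et, jacobi_triple in EQ by (auto; lia).
  pose proof (neg_inv_pochs p 1 5 Hp Hp1 ltac:(lia)) as EI.
  change (- Z.of_nat 1)%Z with (-1)%Z in EI. rewrite EI in EQ. simpl Nat.sub in EQ.
  (* Both sides have quadratic coefficient 15. The left has exponents with linear coefficients [2]
     and [8], the right [2] and [-8]; the reflection [r -> -r] and the factor [p] make them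
     agree. *)
  assert (E4' : zseries (level_coef 4 (- zpow p 1) (p ^ 3)) = p * zseries (level_coef 2 (- zpow p (-1)) (p ^ 5))).
  { rewrite E4, E2.
    rewrite <- (zpow_1_r p) at 3. rewrite Cmult_plus_distr_l, <- !zseries_signed_gauss_const by (auto; lia).
    simpl Z.add. change (-8)%Z with (- (8))%Z. rewrite zseries_signed_gauss_opp by (auto; lia). ring. }
  rewrite E4', EQ, residue_theta_0 by auto.
  change (theta p 5 2) with (theta p (Z.of_nat 5) (Z.of_nat 2)).
  rewrite (jacobi_triple p 5 2) by (auto; lia).
  (* Products in base [p^10] and [p^6] are split as [(x^2; y^2)_oo = (x; y)_oo (-x; y)_oo], leaving
     only the bases [p^5] and [p^3]. *)
  pose proof (qPochInf_double p 5 5 Hp1 ltac:(lia)) as D5.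
  pose proof (qPochInf_double p 2 5 Hp1 ltac:(lia)) as D2.
  pose proof (qPochInf_double p 3 5 Hp1 ltac:(lia)) as D3.
  pose proof (qPochInf_double p 3 3 Hp1 ltac:(lia)) as D33.
  simpl Nat.mul in D5, D2, D3, D33. rewrite D5, D2, D3, D33.
  simpl Nat.sub.
  pose proof (qPochInf_neg_5_3 p Hp1) as EN.
  replace (- zpow p 1) with (- p ^ 1) by (now rewrite zpow_1_r, Cpow_1_r).
  replace (p ^ 3 / - p ^ 1) with (- p ^ 2) by (simpl; field; exact Hp).
  assert (Q1 : qPochInf (- p ^ 1) (p ^ 3) <> 0) by (apply qPochInf_neq_0; [exact H3|apply neg_pow_gen; auto; lia]).
  assert (Q2 : qPochInf (- p ^ 2) (p ^ 3) <> 0) by (apply qPochInf_neq_0; [exact H3|apply neg_pow_gen; auto; lia]).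
  assert (Q3 : qPochInf (- p ^ 3) (p ^ 3) <> 0) by (apply qPochInf_neq_0; [exact H3|apply neg_pow_gen; auto; lia]).
  assert (Q4 : qPochInf (p ^ 3) (p ^ 3) <> 0) by (apply qPochInf_neq_0; [exact H3|apply pow_gen; auto; lia]).
  rewrite Cpow_1_r in *.
  transitivity ((qPochInf (- p) (p ^ 5) * qPochInf (- p ^ 2) (p ^ 5) * qPochInf (- p ^ 3) (p ^ 5)
    * qPochInf (- p ^ 4) (p ^ 5) * qPochInf (- p ^ 5) (p ^ 5))
    * (qPochInf (p ^ 5) (p ^ 5) * (qPochInf (p ^ 2) (p ^ 5) * qPochInf (p ^ 3) (p ^ 5)))
    / (qPochInf (- p) (p ^ 3) * qPochInf (- p ^ 2) (p ^ 3) * qPochInf (- p ^ 3) (p ^ 3))).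
  - field. auto.
  - rewrite EN. field. auto.
Qed.

Lemma neg_zpow_neq_0 (p : C) (e : Z) : p <> 0 -> - zpow p e <> 0.
Proof.
  intros Hp H. apply (zpow_neq_0 p e Hp).
  replace (zpow p e) with (- - zpow p e) by ring. rewrite H. ring.
Qed.

Lemma spin_coef1_signed_gauss (p : C) (e r : Z) : p <> 0 ->
  spin_coef1 (- zpow p e) (p ^ 3) r = signed_gauss p 15 (5 * e + 6) e r.
Proof.
  intros Hp. unfold spin_coef1, signed_gauss. rewrite zpow_neg_zpow, zpow_pow by exact Hp.
  rewrite (zpow_m1_parity (5 * r) r (2 * r)) by ring. change (Z.of_nat 3) with 3%Z.
  replace (15 * (r * r) + (5 * e + 6) * r + e)%Z
    with (e + (e * (5 * r) + 3 * (5 * (r * r) + 2 * r)))%Z by ring.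
  rewrite (zpow_add p e), (zpow_add p (e * (5 * r))) by exact Hp. ring.
Qed.

Lemma spin_coef2_signed_gauss (p : C) (e r : Z) : p <> 0 ->
  spin_coef2 (- zpow p e) (p ^ 3) r = - (1) * signed_gauss p 15 (5 * e - 6) (- e) r.
Proof.
  intros Hp. unfold spin_coef2, signed_gauss. rewrite zpow_neg_zpow, zpow_pow by exact Hp.
  rewrite (zpow_m1_parity (5 * r) r (2 * r)) by ring. change (Z.of_nat 3) with 3%Z.
  replace (15 * (r * r) + (5 * e - 6) * r + - e)%Z
    with (- e + (e * (5 * r) + 3 * (5 * (r * r) - 2 * r)))%Z by ring.
  rewrite (zpow_add p (- e)), (zpow_add p (e * (5 * r))), zpow_opp by exact Hp.
  pose proof (zpow_neq_0 p e Hp). field. auto.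
Qed.

Lemma zsummable_scal (c : C) (f : Z -> C) : zsummable f -> zsummable (fun n => c * f n).
Proof.
  intros [K [rho [HK [Hr H]]]]. exists (Cmod c * K)%R, rho.
  split; [apply Rmult_le_pos; [apply Cmod_ge_0|exact HK]|]. split; [exact Hr|].
  intros n. rewrite Cmod_mult, Rmult_assoc. apply Rmult_le_compat_l; [apply Cmod_ge_0|apply H].
Qed.

Lemma spin_class_chain (p : C) (e c b : Z) : p <> 0 -> (Cmod p < 1)%R ->
  (e = 0%Z \/ forall k, (e + 3 * k <> 0)%Z) -> (b = e + 1)%Z -> (b = 1 \/ b = -1)%Z ->
  (forall d, residue_theta p b d = residue_sign c d * residue_theta p b 0) ->
  class_sum p 1 c = (zseries (signed_gauss p 15 (5 * e + 6) e) - zseries (signed_gauss p 15 (5 * e - 6) (- e)))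
    / (qPochInf (- zpow p e) (p ^ 3) * qPochInf (p ^ 3 / - zpow p e) (p ^ 3)) * / residue_theta p b 0.
Proof.
  intros Hp Hp1 He Hb Hb1 Hchi.
  assert (H3 : (Cmod (p ^ 3) < 1)%R) by (apply Cmod_pow_lt_1; [exact Hp1|lia]).
  assert (Hp3 : p ^ 3 <> 0) by now apply Cpow_nz.
  assert (Hp0 : (0 < Cmod p)%R) by now apply Cmod_gt_0.
  destruct (chain_coef_dom p e 1 Hp Hp1 ltac:(lia) ltac:(simpl; lia)) as [K [HK Hd]].
  rewrite (class_sum_chain p e c b 1 Hp Hp1 Hb Hb1 Hchi).
  rewrite (level3_spin (- zpow p e) (p ^ 3) K (Cmod p)); try assumption; try lra.
  - f_equal. f_equal. rewrite (zseries_ext _ _ (fun r => spin_coef1_signed_gauss p e r Hp)).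
    rewrite (zseries_ext _ _ (fun r => spin_coef2_signed_gauss p e r Hp)).
    rewrite zseries_scal by (apply zsummable_signed_gauss; [assumption|assumption|lia]).
    change (fun r => signed_gauss p 15 (5 * e + 6) e r) with (signed_gauss p 15 (5 * e + 6) e).
    change (fun r => signed_gauss p 15 (5 * e - 6) (- e) r) with (signed_gauss p 15 (5 * e - 6) (- e)). ring.
  - now apply neg_zpow_neq_0.
  - apply bilateral_generic_neg_zpow; try assumption. lia.
  - eapply zsummable_ext; [intros r; symmetry; now apply spin_coef1_signed_gauss|].
    apply zsummable_signed_gauss; [assumption|assumption|lia].
  - eapply zsummable_ext; [intros r; symmetry; now apply spin_coef2_signed_gauss|].
    apply zsummable_scal, zsummable_signed_gauss; [assumption|assumption|lia].
Qed.

(** At [e = 0] the two series have exponents [15 r^2 + 6 r] and [15 r^2 - 6 r], so [r -> -r] makes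
    their difference vanish. *)
Lemma spin_class_sum_zero (p : C) : p <> 0 -> (Cmod p < 1)%R -> class_sum p 1 2 = 0.
Proof.
  intros Hp Hp1.
  rewrite (spin_class_chain p 0 2 1) by (auto; intros; now apply residue_theta_residue_sign_pos).
  simpl Z.mul. simpl Z.add. simpl Z.sub. change (-6)%Z with (- (6))%Z. simpl (- 0)%Z.
  rewrite zseries_signed_gauss_opp by (auto; lia). unfold Cdiv, Cminus. rewrite Cplus_opp_r. ring.
Qed.

Lemma spin_class_sum (p : C) : p <> 0 -> (Cmod p < 1)%R ->
  class_sum p 1 1 * qPochInf (p ^ 3) (p ^ 3) = zseries (theta p 5 1).
Proof.
  intros Hp Hp1.
  assert (H3 : (Cmod (p ^ 3) < 1)%R) by (apply Cmod_pow_lt_1; [exact Hp1|lia]).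
  assert (H5 : (Cmod (p ^ 5) < 1)%R) by (apply Cmod_pow_lt_1; [exact Hp1|lia]).
  assert (Hp5 : p ^ 5 <> 0) by now apply Cpow_nz.
  destruct (zseries_level_coef p 1 (-3) 5 Hp Hp1 ltac:(lia) ltac:(lia)) as [Hs2 E2].
  simpl Z.mul in Hs2, E2. simpl Z.add in E2. simpl Z.sub in E2.
  assert (Hg2 : bilateral_generic (- zpow p (-3)) (p ^ 5)) by (apply bilateral_generic_neg_zpow; try assumption; [right; lia|lia]).
  rewrite (spin_class_chain p (-2) 1 (-1));
    [|assumption|assumption|right; lia|reflexivity|auto|intros; now apply residue_theta_residue_sign_neg].
  simpl Z.mul. simpl Z.add. simpl Z.sub. simpl (- -2)%Z.
  assert (Ht : forall n, zpow (- zpow p (-3)) n * zpow (p ^ 5) (n * n) = signed_gauss p 5 (-3) 0 n).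
  { intros n. unfold signed_gauss. rewrite zpow_neg_zpow, zpow_pow by exact Hp.
    change (Z.of_nat 5) with 5%Z.
    rewrite <- Cmult_assoc, <- zpow_add by exact Hp. do 2 f_equal. ring. }
  assert (Hst : zsummable (fun n => zpow (- zpow p (-3)) n * zpow (p ^ 5) (n * n))).
  { apply (zsummable_ext (signed_gauss p 5 (-3) 0)); [intros; symmetry; apply Ht|].
    apply zsummable_signed_gauss; [assumption|assumption|lia]. }
  pose proof (quintuple (- zpow p (-3)) (p ^ 5) (neg_zpow_neq_0 p (-3) Hp) Hp5 H5 Hg2 Hs2 Hst) as EQ.
  assert (Et : zseries (fun n => zpow (- zpow p (-3)) n * zpow (p ^ 5) (n * n))
    = zseries (theta p (Z.of_nat 10) (Z.of_nat 2))).
  { apply zseries_ext. intros n. change (Z.of_nat 10) with (2 * 5)%Z. rewrite theta_signed_gauss. apply Ht. }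
  rewrite Et, jacobi_triple in EQ by (auto; lia).
  pose proof (neg_inv_pochs p 3 5 Hp Hp1 ltac:(lia)) as EI.
  change (- Z.of_nat 3)%Z with (-3)%Z in EI. rewrite EI in EQ. simpl Nat.sub in EQ.
  (* Shifting [r] by one turns [15 r^2 - 16 r + 2] into [15 r^2 + 14 r + 1] with a change of sign;
     the result is [p] times the quintuple series at [z = -p^(-3)] in base [p^5]. *)
  assert (EN1 : zseries (signed_gauss p 15 (-4) (-2)) - zseries (signed_gauss p 15 (-16) 2)
    = p * zseries (level_coef 2 (- zpow p (-3)) (p ^ 5))).
  { rewrite E2, (zseries_signed_gauss_succ p 15 (-16) 2) by (auto; lia).
    rewrite <- (zpow_1_r p) at 3. rewrite Cmult_plus_distr_l, <- !zseries_signed_gauss_const by (auto; lia).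
    simpl Z.add. change (-14)%Z with (- (14))%Z. rewrite zseries_signed_gauss_opp by (auto; lia).
    simpl Z.add. ring. }
  rewrite EN1, EQ, residue_theta_0 by auto.
  pose proof (neg_inv_pochs p 2 3 Hp Hp1 ltac:(lia)) as EI2.
  change (- Z.of_nat 2)%Z with (-2)%Z in EI2. rewrite EI2. simpl Nat.sub.
  change (theta p 5 1) with (theta p (Z.of_nat 5) (Z.of_nat 1)).
  rewrite (jacobi_triple p 5 1) by (auto; lia).
  pose proof (qPochInf_double p 5 5 Hp1 ltac:(lia)) as D5.
  pose proof (qPochInf_double p 1 5 Hp1 ltac:(lia)) as D2.
  pose proof (qPochInf_double p 4 5 Hp1 ltac:(lia)) as D3.
  pose proof (qPochInf_double p 3 3 Hp1 ltac:(lia)) as D33.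
  simpl Nat.mul in D5, D2, D3, D33. rewrite D5, D2, D3, D33. simpl Nat.sub.
  pose proof (qPochInf_neg_5_3 p Hp1) as EN.
  assert (Q1 : qPochInf (- p ^ 1) (p ^ 3) <> 0) by (apply qPochInf_neq_0; [exact H3|apply neg_pow_gen; auto; lia]).
  assert (Q2 : qPochInf (- p ^ 2) (p ^ 3) <> 0) by (apply qPochInf_neq_0; [exact H3|apply neg_pow_gen; auto; lia]).
  assert (Q3 : qPochInf (- p ^ 3) (p ^ 3) <> 0) by (apply qPochInf_neq_0; [exact H3|apply neg_pow_gen; auto; lia]).
  assert (Q4 : qPochInf (p ^ 3) (p ^ 3) <> 0) by (apply qPochInf_neq_0; [exact H3|apply pow_gen; auto; lia]).
  rewrite Cpow_1_r in *.
  transitivity ((qPochInf (- p) (p ^ 5) * qPochInf (- p ^ 2) (p ^ 5) * qPochInf (- p ^ 3) (p ^ 5)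
    * qPochInf (- p ^ 4) (p ^ 5) * qPochInf (- p ^ 5) (p ^ 5))
    * (qPochInf (p ^ 5) (p ^ 5) * (qPochInf p (p ^ 5) * qPochInf (p ^ 4) (p ^ 5)))
    / (qPochInf (- p) (p ^ 3) * qPochInf (- p ^ 2) (p ^ 3) * qPochInf (- p ^ 3) (p ^ 3))).
  - replace (p ^ 3) with (p * p ^ 2) at 1 by (simpl; ring).
    pose proof (Cpow_nz p 2 Hp). field. auto.
  - rewrite EN. field. auto.
Qed.

(** * Parts of the double sums over the classes of i - j mod 3 *)

Lemma dseries_cvg (g : nat -> nat -> C) (K rho : R) : (0 <= K)%R -> (0 <= rho < 1)%R ->
  (forall i j, (Cmod (g i j) <= K * rho ^ i * rho ^ j)%R) ->
  cvg (fun N => csum N (fun i => csum N (fun j => g i j))) (dseries g).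
Proof.
  intros HK Hr H.
  assert (Hp : forall n, (0 <= rho ^ n)%R) by (intros; apply pow_le; lra).
  assert (Hi : forall k, exists N, forall n, (N <= n)%nat -> (k <= n)%nat) by (intros k; exists k; auto).
  refine (proj2 (tannery (fun N i => csum N (fun j => g i j)) (fun i => cseries (g i)) (fun N => N)
    (K / (1 - rho)) rho _ Hr _ _ Hi)).
  - apply Rle_mult_inv_pos; lra.
  - intros N i. replace (K / (1 - rho) * rho ^ i)%R with (K * rho ^ i / (1 - rho))%R by (field; lra).
    apply csum_Cmod_bound; [apply Rmult_le_pos; auto|exact Hr|]. intros j. apply H.
  - intros i. apply (cseries_cvg (g i) (K * rho ^ i) rho); [apply Rmult_le_pos; auto|exact Hr|].
    intros j. apply H.
Qed.

Lemma nahm_term_dom (p : C) (eps : nat) : p <> 0 -> (Cmod p < 1)%R -> (eps <= 1)%nat ->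
  exists K : R, (0 <= K)%R /\
    forall i j, (Cmod (nahm_term p eps i j) <= K * Cmod p ^ i * Cmod p ^ j)%R.
Proof.
  intros Hp Hp1 He. assert (Hp0 : (0 < Cmod p)%R) by now apply Cmod_gt_0.
  destruct (inv_pair_bounded p Hp1) as [B [HB H]].
  exists (B * (/ Cmod p) ^ 4)%R. split.
  { apply Rmult_le_pos; [lra|]. left. apply pow_lt. now apply Rinv_0_lt_compat. }
  intros i j. unfold nahm_term, Cdiv. rewrite Cmult_comm, Cmod_mult, !Rmult_assoc.
  apply Rmult_le_compat; try apply Cmod_ge_0; [apply H|].
  rewrite <- pow_add. replace (i + j)%nat with (Z.abs_nat (Z.of_nat i + Z.of_nat j)) by lia.
  apply Cmod_zpow_le; try assumption. change (Z.of_nat 4) with 4%Z.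
  set (I := Z.of_nat i). set (J := Z.of_nat j).
  assert (HI : (0 <= I)%Z) by (unfold I; lia). assert (HJ : (0 <= J)%Z) by (unfold J; lia).
  assert (0 <= Z.of_nat eps <= 1)%Z by lia.
  assert (Z.of_nat eps * (I + 2 * J) <= 1 * (I + 2 * J))%Z by (apply Z.mul_le_mono_nonneg_r; lia).
  assert (0 <= I * J)%Z by nia. assert (0 <= 2 * I * I - 3 * I + 2)%Z by nia.
  assert (0 <= 2 * J * J - 4 * J + 2)%Z by nia. lia.
Qed.

Definition in_class (c : Z) (i j : nat) : bool := Z.eqb ((Z.of_nat i - Z.of_nat j) mod 3) c.

Definition class_partial (p : C) (eps : nat) (c : Z) (N : nat) : C :=
  csum N (fun i => csum N (fun j => if in_class c i j then nahm_term p eps i j else 0)).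

Definition class_part (p : C) (eps : nat) (c : Z) : C :=
  dseries (fun i j => if in_class c i j then nahm_term p eps i j else 0).

Lemma class_part_cvg (p : C) (eps : nat) (c : Z) : p <> 0 -> (Cmod p < 1)%R -> (eps <= 1)%nat ->
  cvg (class_partial p eps c) (class_part p eps c).
Proof.
  intros Hp Hp1 He. destruct (nahm_term_dom p eps Hp Hp1 He) as [K [HK H]].
  apply (dseries_cvg _ K (Cmod p)); [exact HK|split; [apply Cmod_ge_0|exact Hp1]|].
  intros i j. destruct (in_class c i j); [apply H|]. rewrite Cmod_0.
  repeat apply Rmult_le_pos; [exact HK|apply pow_le, Cmod_ge_0|apply pow_le, Cmod_ge_0].
Qed.

Lemma class_sum_parts (p : C) (eps : nat) (c : Z) : p <> 0 -> (Cmod p < 1)%R -> (eps <= 1)%nat ->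
  (c <> 0)%Z -> class_sum p eps c = class_part p eps 0 - class_part p eps c.
Proof.
  intros Hp Hp1 He Hc. destruct (nahm_term_dom p eps Hp Hp1 He) as [K [HK H]].
  eapply cvg_unique.
  - apply (dseries_cvg _ K (Cmod p)); [exact HK|split; [apply Cmod_ge_0|exact Hp1]|].
    intros i j. rewrite Cmod_mult. rewrite <- (Rmult_1_r (K * _ * _)).
    apply Rmult_le_compat; try apply Cmod_ge_0; [apply H|].
    unfold residue_sign. destruct (Z.eqb _ _); [rewrite Cmod_1; lra|].
    destruct (Z.eqb _ _); [rewrite Cmod_opp, Cmod_1; lra|rewrite Cmod_0; lra].
  - eapply cvg_ext; [|apply cvg_minus; now apply class_part_cvg].
    intros N. unfold class_partial. rewrite <- csum_minus. apply csum_ext. intros i _.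
    rewrite <- csum_minus. apply csum_ext. intros j _. unfold residue_sign, in_class.
    destruct (Z.eqb_spec ((Z.of_nat i - Z.of_nat j) mod 3) 0) as [E|E].
    + rewrite E. replace (Z.eqb 0 c) with false by (symmetry; apply Z.eqb_neq; lia). ring.
    + destruct (Z.eqb _ _); ring.
Qed.

(** Replacing [p] by [w * p] leaves the denominators alone, since they involve only [p^3]; the power
    of [w] depends on the exponent mod 3. *)
Lemma nahm_term_rotate (p w : C) (eps i j : nat) (k : Z) : p <> 0 -> w ^ 3 = 1 ->
  ((2 * Z.of_nat i * Z.of_nat i + 2 * Z.of_nat i * Z.of_nat j + 2 * Z.of_nat j * Z.of_nat j
    - Z.of_nat eps * (Z.of_nat i + 2 * Z.of_nat j) - k) mod 3 = 0)%Z ->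
  nahm_term (w * p) eps i j = zpow w k * nahm_term p eps i j.
Proof.
  intros Hp Hw Hk.
  assert (Hw0 : w <> 0) by (intros H0; rewrite H0 in Hw; apply C1_nz; rewrite <- Hw; ring).
  unfold nahm_term. replace ((w * p) ^ 3) with (p ^ 3) by (rewrite Cpow_mult_l, Hw; ring).
  rewrite zpow_mult_l by assumption.
  match goal with |- zpow w ?x * _ / _ = _ => set (X := x) in * end.
  replace (zpow w X) with (zpow w k); [unfold Cdiv; ring|].
  apply Z.mod_divide in Hk; [|lia]. destruct Hk as [m Hm].
  replace X with (3 * m + k)%Z by lia. rewrite zpow_add, <- zpow_zpow by assumption.
  change (zpow w 3) with (w ^ 3). rewrite Hw, zpow_1_l. ring.
Qed.

(** [k] is the residue mod 3 shared by all exponents in class [c], so the whole part is multiplied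
    by one power of [w]. *)
Lemma class_part_rotate (p w : C) (eps : nat) (c k : Z) : p <> 0 -> (Cmod p < 1)%R ->
  (eps <= 1)%nat -> w ^ 3 = 1 -> Cmod w = 1%R ->
  (forall i j : Z, ((i - j) mod 3 = c)%Z ->
    ((2 * i * i + 2 * i * j + 2 * j * j - Z.of_nat eps * (i + 2 * j) - k) mod 3 = 0)%Z) ->
  class_part (w * p) eps c = zpow w k * class_part p eps c.
Proof.
  intros Hp Hp1 He Hw Hw1 Hk.
  assert (Hw0 : w <> 0) by (intros H0; rewrite H0 in Hw; apply C1_nz; rewrite <- Hw; ring).
  eapply cvg_unique.
  - apply class_part_cvg; [now apply Cmult_neq_0| |exact He].
    now rewrite Cmod_mult, Hw1, Rmult_1_l.
  - eapply cvg_ext; [|apply cvg_scal; now apply class_part_cvg].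
    intros N. unfold class_partial. rewrite <- csum_scal. apply csum_ext. intros i _.
    rewrite <- csum_scal. apply csum_ext. intros j _. unfold in_class.
    destruct (Z.eqb_spec ((Z.of_nat i - Z.of_nat j) mod 3) c) as [E|E]; [|ring].
    symmetry. apply nahm_term_rotate; auto.
Qed.

(** * Separation of the residue classes *)

Definition omega : C := ((- 1 / 2)%R, (sqrt 3 / 2)%R).

Lemma omega_cube : omega ^ 3 = 1.
Proof.
  pose proof (sqrt_sqrt 3 ltac:(lra)) as H. unfold omega. set (s := sqrt 3) in *.
  assert (H2 : (s * s * s = 3 * s)%R) by (rewrite H; ring).
  apply injective_projections; simpl; nra.
Qed.

Lemma omega_neq_1 : omega <> 1.
Proof. intros H. apply (f_equal fst) in H. simpl in H. lra. Qed.

Lemma Cmod_omega : Cmod omega = 1%R.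
Proof.
  pose proof (f_equal Cmod omega_cube) as H. rewrite Cmod_pow, Cmod_1 in H. simpl in H.
  pose proof (Cmod_ge_0 omega). set (x := Cmod omega) in *.
  assert (H1 : ((x - 1) * (x * x + x + 1) = 0)%R) by nra.
  apply Rmult_integral in H1. destruct H1; nra.
Qed.

Definition poch_pair_45 (p : C) (a b : nat) : C := qPochInf (p ^ a) (p ^ 45) * qPochInf (p ^ b) (p ^ 45).

Lemma jacobi_45 (p : C) (e e' : nat) : p <> 0 -> (Cmod p < 1)%R -> (0 < e < 45)%nat ->
  (e + e' = 45)%nat ->
  zseries (theta p 45 (Z.of_nat e)) = qPochInf (p ^ 45) (p ^ 45) * poch_pair_45 p e e'.
Proof.
  intros Hp Hp1 He He'. change 45%Z with (Z.of_nat 45). rewrite jacobi_triple by assumption.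
  unfold poch_pair_45. replace e' with (45 - e)%nat by lia. reflexivity.
Qed.

(** With [n = 3 k], [3 k + 1], [3 k - 1], the number [n (n-1)/2] becomes [9 k (k-1)/2] plus [3 k],
    [6 k] and [1]; hence base [p^45] and the prefactors [p^e] and [p^(5-e)]. *)
Lemma theta_3_dissection (p : C) (e : Z) (k1 k2 e1 e2 e3 : Z) : p <> 0 -> (Cmod p < 1)%R ->
  (e1 = 15 + 3 * e)%Z -> (e2 = 30 + 3 * e)%Z -> (e3 = 3 * e)%Z -> (k1 = e)%Z -> (k2 = 5 - e)%Z ->
  zseries (theta p 5 e)
  = zseries (theta p 45 e1) - zpow p k1 * zseries (theta p 45 e2) - zpow p k2 * zseries (theta p 45 e3).
Proof.
  intros Hp Hp1 -> -> -> -> ->.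
  assert (Hs : zsummable (theta p 5 e)) by (apply zsummable_theta_series; auto; lia).
  assert (Hs' : forall d, zsummable (theta p 45 d)) by (intros; apply zsummable_theta_series; auto; lia).
  assert (Hh : forall k, ((3 * k) * (3 * k - 1) / 2 = 9 * (k * (k - 1) / 2) + 3 * k)%Z).
  { intros k. pose proof (half_consecutive k). pose proof (half_consecutive (3 * k)). lia. }
  assert (Hh1 : forall k, ((3 * k + 1) * (3 * k + 1 - 1) / 2 = 9 * (k * (k - 1) / 2) + 6 * k)%Z).
  { intros k. pose proof (half_consecutive k). pose proof (half_consecutive (3 * k + 1)). lia. }
  assert (Hh2 : forall k, ((3 * k + -1) * (3 * k + -1 - 1) / 2 = 9 * (k * (k - 1) / 2) + 1)%Z).
  { intros k. pose proof (half_consecutive k). pose proof (half_consecutive (3 * k + -1)). lia. }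
  rewrite zseries_split3 by exact Hs.
  assert (E0 : zseries (fun n => theta p 5 e (3 * n)) = zseries (theta p 45 (15 + 3 * e))).
  { apply zseries_ext. intros n. unfold theta. rewrite Hh.
    rewrite (zpow_m1_parity (3 * n) n n) by ring. do 2 f_equal. ring. }
  assert (E1 : zseries (fun n => theta p 5 e (3 * n + 1)) = - (1) * zpow p e * zseries (theta p 45 (30 + 3 * e))).
  { rewrite <- zseries_scal by apply Hs'. apply zseries_ext. intros n. unfold theta. rewrite Hh1.
    rewrite (zpow_m1_parity (3 * n + 1) (1 + n) n) by ring.
    rewrite zpow_add, zpow_1_r by apply m1_neq_0.
    replace (5 * (9 * (n * (n - 1) / 2) + 6 * n) + e * (3 * n + 1))%Z
      with (e + (45 * (n * (n - 1) / 2) + (30 + 3 * e) * n))%Z by ring.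
    rewrite (zpow_add p e) by exact Hp. ring. }
  assert (E2 : zseries (fun n => theta p 5 e (3 * n + 2)) = - (1) * zpow p (5 - e) * zseries (theta p 45 (3 * e))).
  { transitivity (zseries (fun n => theta p 5 e (3 * (n + 1) + -1))).
    { apply zseries_ext. intros n. f_equal. ring. }
    assert (Hg : forall n, theta p 5 e (3 * n + -1) = - (1) * zpow p (5 - e) * theta p 45 (3 * e) n).
    { intros n. unfold theta. rewrite Hh2.
      rewrite (zpow_m1_parity (3 * n + -1) (1 + n) (n - 1)) by ring.
      rewrite zpow_add, zpow_1_r by apply m1_neq_0.
      replace (5 * (9 * (n * (n - 1) / 2) + 1) + e * (3 * n + -1))%Z
        with (5 - e + (45 * (n * (n - 1) / 2) + 3 * e * n))%Z by ring.
      rewrite (zpow_add p (5 - e)) by exact Hp. ring. }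
    rewrite (zseries_succ (fun n => theta p 5 e (3 * n + -1))).
    - rewrite <- zseries_scal by apply Hs'. now apply zseries_ext.
    - apply (zsummable_ext (fun n => - (1) * zpow p (5 - e) * theta p 45 (3 * e) n)); [intros; now rewrite Hg|].
      apply zsummable_scal, Hs'. }
  rewrite E0, E1, E2. ring.
Qed.

(* Comparing the class identities at [p] and at [omega * p] separates the residue classes. *)
Lemma separate (x y a b P w : C) : P <> 0 -> w <> 1 ->
  (x - y) * P = a - b -> (x - w * y) * P = a - w * b -> x = a / P /\ y = b / P.
Proof.
  intros HP Hw H1 H2.
  assert (Hw' : 1 - w <> 0).
  { intros H. apply Hw. replace w with (1 - (1 - w)) by ring. rewrite H. ring. }
  assert (Hy : (1 - w) * (y * P - b) = 0).
  { transitivity ((x - w * y) * P - (a - w * b) - ((x - y) * P - (a - b))); [ring|].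
    rewrite H1, H2. ring. }
  assert (Hy' : y * P = b).
  { replace (y * P) with (b + / (1 - w) * ((1 - w) * (y * P - b))) by (field; exact Hw').
    rewrite Hy. ring. }
  assert (Hx : x * P = a).
  { replace (x * P) with ((x - y) * P + y * P) by ring. rewrite H1, Hy'. ring. }
  rewrite <- Hx, <- Hy'. split; field; exact HP.
Qed.

Lemma poch_pair_45_rotate (p w : C) (a b : nat) : w ^ 3 = 1 -> poch_pair_45 (w * p) (3 * a) (3 * b) = poch_pair_45 p (3 * a) (3 * b).
Proof.
  intros Hw. assert (H : forall n, (w * p) ^ (3 * n) = p ^ (3 * n)).
  { intros n. rewrite !Cpow_mult_r, Cpow_mult_l, Hw, Cmult_1_l. reflexivity. }
  unfold poch_pair_45. change 45%nat with (3 * 15)%nat. now rewrite !H.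
Qed.

Lemma qPochInf_45_rotate (p w : C) (a b : nat) : w ^ 3 = 1 ->
  qPochInf ((w * p) ^ (3 * a)) ((w * p) ^ (3 * b)) = qPochInf (p ^ (3 * a)) (p ^ (3 * b)).
Proof.
  intros Hw. assert (H : forall n, (w * p) ^ (3 * n) = p ^ (3 * n)).
  { intros n. rewrite !Cpow_mult_r, Cpow_mult_l, Hw, Cmult_1_l. reflexivity. }
  now rewrite !H.
Qed.

Lemma vacuum_parts (p : C) : p <> 0 -> (Cmod p < 1)%R ->
  class_part p 0 0 = qPochInf (p ^ 45) (p ^ 45) * (poch_pair_45 p 21 24 - p ^ 3 * poch_pair_45 p 6 39) / qPochInf (p ^ 3) (p ^ 3)
  /\ class_part p 0 2 = qPochInf (p ^ 45) (p ^ 45) * (p ^ 2 * poch_pair_45 p 9 36) / qPochInf (p ^ 3) (p ^ 3).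
Proof.
  intros Hp Hp1.
  assert (H3 : (Cmod (p ^ 3) < 1)%R) by (apply Cmod_pow_lt_1; [exact Hp1|lia]).
  assert (Hw0 : omega <> 0) by (apply Cmod_gt_0; rewrite Cmod_omega; lra).
  assert (Hwp : omega * p <> 0) by now apply Cmult_neq_0.
  assert (Hwp1 : (Cmod (omega * p) < 1)%R) by now rewrite Cmod_mult, Cmod_omega, Rmult_1_l.
  assert (Hval : forall x : C, x <> 0 -> (Cmod x < 1)%R ->
    (class_part x 0 0 - class_part x 0 2) * qPochInf (x ^ 3) (x ^ 3)
    = qPochInf (x ^ 45) (x ^ 45) * (poch_pair_45 x 21 24 - x ^ 3 * poch_pair_45 x 6 39)
      - qPochInf (x ^ 45) (x ^ 45) * (x ^ 2 * poch_pair_45 x 9 36)).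
  { intros x Hx Hx1. rewrite <- (class_sum_parts x 0 2 Hx Hx1 ltac:(lia) ltac:(lia)).
    rewrite vacuum_class_sum by assumption.
    rewrite (theta_3_dissection x 2 2 3 21 36 6) by (auto; lia).
    change (theta x 45 21) with (theta x 45 (Z.of_nat 21)).
    change (theta x 45 36) with (theta x 45 (Z.of_nat 36)).
    change (theta x 45 6) with (theta x 45 (Z.of_nat 6)).
    rewrite (jacobi_45 x 21 24), (jacobi_45 x 36 9), (jacobi_45 x 6 39) by (auto; lia).
    change (zpow x 2) with (x ^ 2). change (zpow x 3) with (x ^ 3). unfold poch_pair_45. ring. }
  (* All exponents in class 2 are [2] mod 3, and among the three theta terms only the one with [p^2]
     is; this fixes the multiplier and assigns each product to one of the two parts. *)
  apply (separate _ _ _ _ _ (omega ^ 2)).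
  - apply qPochInf_neq_0; [exact H3|now apply q_generic_small].
  - intros H. apply omega_neq_1. rewrite <- omega_cube.
    transitivity (omega * omega ^ 2); [rewrite H; ring|reflexivity].
  - now apply Hval.
  - pose proof (Hval _ Hwp Hwp1) as E.
    rewrite (class_part_rotate p omega 0 0 0) in E; auto using omega_cube, Cmod_omega.
    2:{ intros i j Hij. apply Z.mod_divide in Hij; [|lia]. destruct Hij as [m Hm].
        (* The exponent is [2 (i - j)^2 + 6 i j]; with [i - j = 3 m] it is three times the
           witness. *)
        apply Z.mod_divide; [lia|]. exists (2 * m * m * 3 + 2 * i * j)%Z.
        replace i with (j + m * 3)%Z by lia. simpl Z.of_nat. ring. }
    rewrite (class_part_rotate p omega 0 2 2) in E; auto using omega_cube, Cmod_omega.
    2:{ intros i j Hij. pose proof (Z.div_mod (i - j) 3 ltac:(lia)) as D. rewrite Hij in D.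
        set (m := ((i - j) / 3)%Z) in *. apply Z.mod_divide; [lia|].
        exists (2 * m * m * 3 + 8 * m + 2 + 2 * i * j)%Z.
        replace i with (j + (3 * m + 2))%Z by lia. simpl Z.of_nat. ring. }
    pose proof (qPochInf_45_rotate p omega 1 1 omega_cube) as R1. simpl Nat.mul in R1.
    pose proof (qPochInf_45_rotate p omega 15 15 omega_cube) as R2. simpl Nat.mul in R2.
    pose proof (poch_pair_45_rotate p omega 7 8 omega_cube) as R3. simpl Nat.mul in R3.
    pose proof (poch_pair_45_rotate p omega 2 13 omega_cube) as R4. simpl Nat.mul in R4.
    pose proof (poch_pair_45_rotate p omega 3 12 omega_cube) as R5. simpl Nat.mul in R5.
    rewrite R1, R2, R3, R4, R5 in E.
    rewrite !Cpow_mult_l, omega_cube in E. change (zpow omega 0) with (RtoC 1) in E.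
    change (zpow omega 2) with (omega ^ 2) in E. rewrite !Cmult_1_l in E. rewrite E. ring.
Qed.

Lemma spin_parts (p : C) : p <> 0 -> (Cmod p < 1)%R ->
  class_part p 1 0 = qPochInf (p ^ 45) (p ^ 45) * poch_pair_45 p 18 27 / qPochInf (p ^ 3) (p ^ 3)
  /\ class_part p 1 1 = qPochInf (p ^ 45) (p ^ 45) * (p * poch_pair_45 p 12 33 + p ^ 4 * poch_pair_45 p 3 42)
    / qPochInf (p ^ 3) (p ^ 3).
Proof.
  intros Hp Hp1.
  assert (H3 : (Cmod (p ^ 3) < 1)%R) by (apply Cmod_pow_lt_1; [exact Hp1|lia]).
  assert (Hw0 : omega <> 0) by (apply Cmod_gt_0; rewrite Cmod_omega; lra).
  assert (Hwp : omega * p <> 0) by now apply Cmult_neq_0.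
  assert (Hwp1 : (Cmod (omega * p) < 1)%R) by now rewrite Cmod_mult, Cmod_omega, Rmult_1_l.
  assert (Hval : forall x : C, x <> 0 -> (Cmod x < 1)%R ->
    (class_part x 1 0 - class_part x 1 1) * qPochInf (x ^ 3) (x ^ 3)
    = qPochInf (x ^ 45) (x ^ 45) * poch_pair_45 x 18 27
      - qPochInf (x ^ 45) (x ^ 45) * (x * poch_pair_45 x 12 33 + x ^ 4 * poch_pair_45 x 3 42)).
  { intros x Hx Hx1. rewrite <- (class_sum_parts x 1 1 Hx Hx1 ltac:(lia) ltac:(lia)).
    rewrite spin_class_sum by assumption.
    rewrite (theta_3_dissection x 1 1 4 18 33 3) by (auto; lia).
    change (theta x 45 18) with (theta x 45 (Z.of_nat 18)).
    change (theta x 45 33) with (theta x 45 (Z.of_nat 33)).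
    change (theta x 45 3) with (theta x 45 (Z.of_nat 3)).
    rewrite (jacobi_45 x 18 27), (jacobi_45 x 33 12), (jacobi_45 x 3 42) by (auto; lia).
    rewrite zpow_1_r. change (zpow x 4) with (x ^ 4). unfold poch_pair_45. ring. }
  (* The prefactors [p] and [p^4] both pick up one [omega], so their products belong to class 1; the
     product without prefactor belongs to class 0. *)
  apply (separate _ _ _ _ _ omega).
  - apply qPochInf_neq_0; [exact H3|now apply q_generic_small].
  - apply omega_neq_1.
  - now apply Hval.
  - pose proof (Hval _ Hwp Hwp1) as E.
    rewrite (class_part_rotate p omega 1 0 0) in E; auto using omega_cube, Cmod_omega.
    2:{ intros i j Hij. apply Z.mod_divide in Hij; [|lia]. destruct Hij as [m Hm].
        apply Z.mod_divide; [lia|]. exists (2 * m * m * 3 + 2 * i * j - m - j)%Z.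
        replace i with (j + m * 3)%Z by lia. simpl Z.of_nat. ring. }
    rewrite (class_part_rotate p omega 1 1 1) in E; auto using omega_cube, Cmod_omega.
    2:{ intros i j Hij. pose proof (Z.div_mod (i - j) 3 ltac:(lia)) as D. rewrite Hij in D.
        set (m := ((i - j) / 3)%Z) in *. apply Z.mod_divide; [lia|].
        exists (2 * m * m * 3 + 4 * m + 2 * i * j - m - j)%Z.
        replace i with (j + (3 * m + 1))%Z by lia. simpl Z.of_nat. ring. }
    pose proof (qPochInf_45_rotate p omega 1 1 omega_cube) as R1. simpl Nat.mul in R1.
    pose proof (qPochInf_45_rotate p omega 15 15 omega_cube) as R2. simpl Nat.mul in R2.
    pose proof (poch_pair_45_rotate p omega 6 9 omega_cube) as R3. simpl Nat.mul in R3.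
    pose proof (poch_pair_45_rotate p omega 4 11 omega_cube) as R4. simpl Nat.mul in R4.
    pose proof (poch_pair_45_rotate p omega 1 14 omega_cube) as R5. simpl Nat.mul in R5.
    rewrite R1, R2, R3, R4, R5 in E.
    change (zpow omega 0) with (RtoC 1) in E.
    rewrite zpow_1_r, Cmult_1_l in E. rewrite E.
    replace ((omega * p) ^ 4) with (omega * p ^ 4); [ring|].
    rewrite Cpow_mult_l. rewrite (Cpow_S omega 3), omega_cube. ring.
Qed.

Lemma class_partial_total (p : C) (eps N : nat) :
  csum N (fun i => csum N (fun j => nahm_term p eps i j))
  = class_partial p eps 0 N + class_partial p eps 1 N + class_partial p eps 2 N.
Proof.
  unfold class_partial. rewrite <- !csum_plus. apply csum_ext. intros i _.
  rewrite <- !csum_plus. apply csum_ext. intros j _. unfold in_class.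
  pose proof (Z.mod_pos_bound (Z.of_nat i - Z.of_nat j) 3 ltac:(lia)) as Hd.
  set (d := ((Z.of_nat i - Z.of_nat j) mod 3)%Z) in *.
  assert (E : (d = 0 \/ d = 1 \/ d = 2)%Z) by lia.
  destruct E as [-> | [-> | ->]]; simpl Z.eqb; cbv iota; ring.
Qed.

(** The summand of S_4 is symmetric in [i] and [j], and exchanging them turns [i - j] into its
    negative. *)
Lemma class_partial_0_sym (p : C) (N : nat) : class_partial p 0 1 N = class_partial p 0 2 N.
Proof.
  unfold class_partial. rewrite csum_swap. apply csum_ext. intros i _. apply csum_ext. intros j _.
  unfold in_class, nahm_term.
  replace (Z.eqb ((Z.of_nat j - Z.of_nat i) mod 3) 1) with (Z.eqb ((Z.of_nat i - Z.of_nat j) mod 3) 2).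
  - destruct (Z.eqb _ _); [|reflexivity]. simpl Z.of_nat.
    rewrite (Cmult_comm (qPoch (p ^ 3) (p ^ 3) j)). do 2 f_equal. ring.
  - apply Bool.eq_iff_eq_true. rewrite !Z.eqb_eq.
    pose proof (Z.div_mod (Z.of_nat i - Z.of_nat j) 3 ltac:(lia)).
    pose proof (Z.div_mod (Z.of_nat j - Z.of_nat i) 3 ltac:(lia)).
    pose proof (Z.mod_pos_bound (Z.of_nat i - Z.of_nat j) 3 ltac:(lia)).
    pose proof (Z.mod_pos_bound (Z.of_nat j - Z.of_nat i) 3 ltac:(lia)). lia.
Qed.

Lemma S4_partial_nahm_term (p : C) (N : nat) : 
  S4_partial p N = csum N (fun i => csum N (fun j => nahm_term p 0 i j)).
Proof.
  unfold S4_partial. apply csum_ext. intros i _. apply csum_ext. intros j _. unfold nahm_term.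
  f_equal. rewrite <- zpow_nat. f_equal. lia.
Qed.

Lemma S3_partial_nahm_term (p : C) (N : nat) : 
  S3_partial p N = csum N (fun i => csum N (fun j => nahm_term p 1 i j)).
Proof.
  unfold S3_partial. rewrite csum_swap. apply csum_ext. intros i _. apply csum_ext. intros j _.
  unfold nahm_term. rewrite (Cmult_comm (qPoch (p ^ 3) (p ^ 3) j)).
  f_equal. rewrite <- zpow_nat. f_equal.
  (* The remaining point is that the natural subtraction in the exponent never truncates:
     [2 j + i <= 2 j^2 + 2 j i + 2 i^2]. *)
  destruct (Nat.eq_dec j 0) as [->|Hj]; [nia|].
  assert (2 * j <= 2 * j * j)%nat by nia.
  destruct (Nat.eq_dec i 0) as [->|Hi]; [nia|].
  assert (i <= 2 * j * i)%nat by nia. nia.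
Qed.

(** * The degenerate case q = 0 *)

Lemma qPoch_0_r (n : nat) : qPoch 0 0 n = 1.
Proof. induction n as [|n IH]; simpl; [reflexivity|]. rewrite IH. ring. Qed.

Lemma qPochInf_0 : qPochInf 0 0 = 1.
Proof.
  apply qPochInf_eq. apply cvg_ext with (fun _ => RtoC 1); [intros; now rewrite qPoch_0_r|].
  apply cvg_const.
Qed.

Lemma Cpow_0_l (n : nat) : (0 < n)%nat -> 0 ^ n = 0 :> C.
Proof. intros H. destruct n as [|n]; [lia|]. simpl. ring. Qed.

Lemma csum_support (m N : nat) (f : nat -> C) : (m <= N)%nat ->
  (forall k, (m <= k)%nat -> f k = 0) -> csum N f = csum m f.
Proof.
  intros H Hf. replace N with (m + (N - m))%nat by lia. rewrite csum_add, (csum_zero (N - m)).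
  - ring.
  - intros k _. apply Hf. lia.
Qed.

Lemma S4_partial_0 (N : nat) : (1 <= N)%nat -> S4_partial 0 N = 1.
Proof.
  intros HN. unfold S4_partial.
  rewrite (csum_support 1 N) by (try exact HN; intros i Hi; apply csum_zero; intros j _;
    rewrite (Cpow_0_l (2 * i * i + 2 * i * j + 2 * j * j)) by nia; unfold Cdiv; ring).
  cbn [csum]. rewrite (csum_support 1 N) by (try exact HN; intros j Hj;
    rewrite (Cpow_0_l (2 * 0 * 0 + 2 * 0 * j + 2 * j * j)) by nia; unfold Cdiv; ring).
  simpl. field.
Qed.

(** The value [2] comes from the index pairs [(0, 0)] and [(1, 0)], the only ones with exponent
    zero; hence also the threshold [2 <= N]. *)
Lemma S3_partial_0 (N : nat) : (2 <= N)%nat -> S3_partial 0 N = 2.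
Proof.
  intros HN. unfold S3_partial.
  rewrite (csum_support 2 N) by (try exact HN; intros i Hi; apply csum_zero; intros j _;
    rewrite (Cpow_0_l (2 * i * i + 2 * i * j + 2 * j * j - 2 * i - j)) by nia; unfold Cdiv; ring).
  cbn [csum].
  rewrite (csum_support 1 N (fun j => 0 ^ (2 * 0 * 0 + 2 * 0 * j + 2 * j * j - 2 * 0 - j)%nat
      / (qPoch (0 ^ 3) (0 ^ 3) 0 * qPoch (0 ^ 3) (0 ^ 3) j)))
    by (try lia; intros j Hj;
    rewrite (Cpow_0_l (2 * 0 * 0 + 2 * 0 * j + 2 * j * j - 2 * 0 - j)) by nia; unfold Cdiv; ring).
  rewrite (csum_support 1 N (fun j => 0 ^ (2 * 1 * 1 + 2 * 1 * j + 2 * j * j - 2 * 1 - j)%nat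
      / (qPoch (0 ^ 3) (0 ^ 3) 1 * qPoch (0 ^ 3) (0 ^ 3) j)))
    by (try lia; intros j Hj;
    rewrite (Cpow_0_l (2 * 1 * 1 + 2 * 1 * j + 2 * j * j - 2 * 1 - j)) by nia; unfold Cdiv; ring).
  rewrite (Cpow_0_l 3) by lia. cbn [csum]. rewrite !qPoch_0_r. simpl. field.
Qed.

Theorem theorem1p4 (q : C) (hq : (Cmod q < 1)%R) :
  filterlim (S3_partial q) eventually
    (locally (qPochInf (q^45) (q^45) / qPochInf (q^3) (q^3) *
      (2 * (qPochInf (q^18) (q^45) * qPochInf (q^27) (q^45))
       + q * (qPochInf (q^12) (q^45) * qPochInf (q^33) (q^45))
       + q^4 * (qPochInf (q^3) (q^45) * qPochInf (q^42) (q^45))))) /\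
  filterlim (S4_partial q) eventually
    (locally (qPochInf (q^45) (q^45) / qPochInf (q^3) (q^3) *
      (qPochInf (q^21) (q^45) * qPochInf (q^24) (q^45)
       - q^3 * (qPochInf (q^6) (q^45) * qPochInf (q^39) (q^45))
       + 2 * q^2 * (qPochInf (q^9) (q^45) * qPochInf (q^36) (q^45))))).
Proof.
  (* For [q = 0] negative powers of [q] have no meaning, so both sides are computed directly. *)
  destruct (Ceq_dec q 0) as [->|Hq].
  - split; apply cvg_filterlim; rewrite ?Cpow_0_l by lia; rewrite qPochInf_0.
    + apply cvg_ext_from with (fun _ => RtoC 2) 2%nat.
      * intros N HN. now rewrite S3_partial_0.
      * match goal with |- cvg _ ?l => replace l with (RtoC 2) by field end. apply cvg_const.
    + apply cvg_ext_from with (fun _ => RtoC 1) 1%nat.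
      * intros N HN. now rewrite S4_partial_0.
      * match goal with |- cvg _ ?l => replace l with (RtoC 1) by field end. apply cvg_const.
  - assert (H3 : (Cmod (q ^ 3) < 1)%R) by (apply Cmod_pow_lt_1; [exact hq|lia]).
    pose proof (qPochInf_neq_0 _ _ H3 (q_generic_small _ H3)) as HP.
    split; apply cvg_filterlim.
    (* The specialisation [z = -1] gives [C_2 = C_0], so S_3 is [2 C_0 + C_1]; this is the
       coefficient [2] in the formula. *)
    + pose proof (spin_class_sum_zero q Hq hq) as Z0. rewrite class_sum_parts in Z0 by (auto; lia).
      destruct (spin_parts q Hq hq) as [V0 V1].
      assert (V2 : class_part q 1 2 = class_part q 1 0).
      { transitivity (class_part q 1 0 - (class_part q 1 0 - class_part q 1 2)); [ring|].
        rewrite Z0. ring. }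
      apply cvg_ext with (fun N => class_partial q 1 0 N + class_partial q 1 1 N + class_partial q 1 2 N).
      { intros N. now rewrite S3_partial_nahm_term, class_partial_total. }
      match goal with |- cvg _ ?l =>
        replace l with (class_part q 1 0 + class_part q 1 1 + class_part q 1 2) end.
      * repeat apply cvg_plus; apply class_part_cvg; auto.
      * rewrite V2, V0, V1. unfold poch_pair_45. field. exact HP.
    (* By symmetry [C_1 = C_2], so S_4 is [C_0 + 2 C_2], which doubles the product with prefactor
       [q^2]. *)
    + destruct (vacuum_parts q Hq hq) as [V0 V2].
      apply cvg_ext with (fun N => class_partial q 0 0 N + class_partial q 0 2 N + class_partial q 0 2 N).
      { intros N. now rewrite S4_partial_nahm_term, class_partial_total, class_partial_0_sym. }
      match goal with |- cvg _ ?l =>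
        replace l with (class_part q 0 0 + class_part q 0 2 + class_part q 0 2) end.
      * repeat apply cvg_plus; apply class_part_cvg; auto.
      * rewrite V0, V2. unfold poch_pair_45. field. exact HP.
Qed.
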